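(* Let $G$ be an infinite vertex-transitive graph with adjacency operator $A_G$. Then for each point $\lambda$ of the spectrum $\sigma(A_G)$ there exists a nontrivial invariant Gaussian process $X_v$, $v\in V(G)$, such that $$\sum_{u\in N(v)}X_u=\lambda X_v\qquad\text{for each vertex } v\in V(G).$$ Furthermore, the process $(X_v)$ can be approximated in distribution by linear factor of i.i.d. processes, i.e. there is a sequence of linear factor of i.i.d. processes on $G$ converging in distribution to $(X_v)$; and these approximating linear factors can be chosen to have only finitely many nonzero coefficients (for each $v$, only finitely many $\beta_{v,u}$ are nonzero).
   Context: Graphs are simple and undirected, with countable vertex set and finite degree. Vertex-transitive means that the automorphism group $\mathrm{Aut}(G)$ acts transitively on $V(G)$. $N(v)$ is the set of neighbors of $v$. The adjacency operator $A_G:\ell_2(V(G))\to\ell_2(V(G))$ is the bounded self-adjoint operator $(A_Gf)(v)=\sum_{u\in N(v)}f(u)$. A Gaussian process on $G$ is a collection of jointly Gaussian (every finite linear combination is Gaussian), centered random variables $X_v$, $v\in V(G)$. It is invariant if for every $\Phi\in\mathrm{Aut}(G)$ the process $(X_{\Phi(v)})_{v}$ has the same joint distribution as $(X_v)_v$. Nontrivial means not almost surely identically zero. Let $Z_u$, $u\in V(G)$, be independent standard normal random variables. A linear factor of i.i.d. process is a process of the form $X_v=\sum_{u\in V(G)}\beta_{v,u}Z_u$, $v\in V(G)$, with real coefficients $\beta_{v,u}$ satisfying $\sum_u\beta_{v,u}^2<\infty$ for every $v$ and $\beta_{\Phi v,\Phi u}=\beta_{v,u}$ for all $\Phi\in\mathrm{Aut}(G)$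 and $u,v\in V(G)$. Convergence in distribution means weak convergence of the distributions on $\mathbb{R}^{V(G)}$ with the product topology. *)

(* Defs.v *)
From HB Require Import structures.
From mathcomp Require Export all_boot all_order all_algebra finmap.
From mathcomp Require Export all_classical all_reals all_analysis complex.

Set Implicit Arguments.
Unset Strict Implicit.
Unset Printing Implicit Defensive.

Export Order.TTheory GRing.Theory Num.Theory.
Export numFieldNormedType.Exports.

#[global] Open Scope classical_set_scope.
#[global] Open Scope ring_scope.

Record graph (V : countType) := Graph {
  adj :> rel V;
  adj_sym : symmetric adj;
  adj_irrefl : irreflexive adj;
  adj_finite : forall v, finite_set [set u | adj v u] }.

Section Graphs.
Context {V : countType} (G : graph V).

Definition neighbors (v : V) : set V := [set u | G v u].

Definition automorphism (phi : V -> V) : Prop :=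
  bijective phi /\ forall u v, G (phi u) (phi v) = G u v.

Definition vertex_transitive : Prop :=
  forall u v, exists2 phi, automorphism phi & phi u = v.

(* The formula makes sense for every function on the vertices; on square
   summable complex functions it is the adjacency operator. *)
Definition adjacency {M : nmodType} (f : V -> M) : V -> M :=
  fun v => \sum_(u \in neighbors v) f u.

End Graphs.

Section Spectrum.
Context {R : realType} {V : choiceType}.
Implicit Types (f g : V -> R[i]) (A B : (V -> R[i]) -> (V -> R[i])).

Definition sqnorm2 f : \bar R :=
  \esum_(v in [set: V]) (Normc.normc (f v) ^+ 2)%:E.

Definition l2 : set (V -> R[i]) := [set f | (sqnorm2 f < +oo)%E].

(* Operators on l2 are represented by maps on all functions V -> R[i]; only
   their values on l2 matter. *)
Record bounded_operator B : Prop := BoundedOperator {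
  bounded_operator_stable : forall f, l2 f -> l2 (B f);
  bounded_operator_linear : forall (a : R[i]) f g, l2 f -> l2 g ->
    B (fun v => a * f v + g v) = (fun v => a * B f v + B g v);
  bounded_operator_bound : exists M : R, forall f, l2 f ->
    (sqnorm2 (B f) <= M%:E * sqnorm2 f)%E }.

Definition shift A (lambda : R[i]) f : V -> R[i] :=
  fun v => A f v - lambda * f v.

Definition spectrum A : set R[i] :=
  [set lambda | ~ exists B, bounded_operator B /\
     forall f, l2 f -> shift A lambda (B f) = f /\ B (shift A lambda f) = f].

End Spectrum.

Section Processes.
Context {R : realType} {V : countType} (G : graph V).
Context {d : measure_display} {T : measurableType d} (P : probability T R).
Implicit Types X Y Z : V -> {RV P >-> R}.

Definition has_law (Y : T -> R) (mu : set R -> \bar R) : Prop :=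
  forall B : set R, measurable B -> pushforward P Y B = mu B.

(* Degenerate laws count as Gaussian; they are listed apart because
   normal_prob m 0 is by convention a uniform law. *)
Definition gaussian (Y : T -> R) : Prop :=
  (exists m : R, has_law Y \d_m) \/
  (exists m s : R, s != 0 /\ has_law Y (normal_prob m s)).

Definition gaussian_process X : Prop :=
  (forall (s : seq V) (c : V -> R),
     gaussian (fun w => \sum_(v <- s) c v * X v w)) /\
  (forall v, 'E_P[X v] = 0)%E.

Definition product_measurable : set (set (V -> R)) :=
  <<s [set C | exists v (B : set R),
                 measurable B /\ C = [set x : V -> R | B (x v)]] >>.

Definition same_law X Y : Prop :=
  forall C, product_measurable C ->
    P [set w | C (X^~ w)] = P [set w | C (Y^~ w)].

Definition invariant X : Prop :=
  forall phi, automorphism G phi -> same_law (X \o phi) X.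

Definition nontrivial X : Prop :=
  ~ {ae P, forall w, forall v, X v w = 0}.

Definition independent Z : Prop :=
  forall (s : seq V) (B : V -> set R), uniq s ->
    (forall v, measurable (B v)) ->
    P (\bigcap_(v in [set` s]) (Z v @^-1` B v)) =
      (\prod_(v <- s) P (Z v @^-1` B v))%E.

Definition iid_standard_normal Z : Prop :=
  independent Z /\ forall v, has_law (Z v) (normal_prob 0 1).

(* The sum of beta v u * Z u over u is taken in the L2 sense, along the
   finite sets of vertices; hence X v is determined up to null sets. *)
Definition L2_sum (beta : V -> R) Z (Y : T -> R) : Prop :=
  forall eps : R, 0 < eps -> exists A : {fset V}, forall B : {fset V},
    (A `<=` B)%fset ->
    ('E_P[fun w => ((Y w - \sum_(u <- B) beta u * Z u w) ^+ 2)%R] <= eps%:E)%E.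

Definition linear_factor (beta : V -> V -> R) Z X : Prop :=
  [/\ forall v, (\esum_(u in [set: V]) ((beta v u) ^+ 2)%:E < +oo)%E,
      forall phi, automorphism G phi ->
        forall v u, beta (phi v) (phi u) = beta v u
    & forall v, L2_sum (beta v) Z (X v)].

End Processes.

Definition cvg_in_distribution {R : realType} {V : countType}
    {d d' : measure_display} {T : measurableType d} {T' : measurableType d'}
    (P : probability T R) (Q : probability T' R)
    (Y : nat -> V -> {RV P >-> R}) (X : V -> {RV Q >-> R}) : Prop :=
  forall f : {ptws V -> R} -> R, continuous f ->
    (exists M : R, forall x, `|f x| <= M) ->
    ('E_P[fun w => f ((Y n)^~ w)] @[n --> \oo] --> 'E_Q[fun w => f (X^~ w)])%E.

(* Main.v *)
Require Import Defs.
From HB Require Import structures.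
From mathcomp Require Import measurable_realfun archimedean ring lra.

(* Let A be the adjacency operator and lambda = a + b i a point of its spectrum.
   If the Rayleigh quotient of B = (A - a)^2 + b^2 were bounded below on finitely
   supported functions, B would be invertible by a Neumann series, and so would
   A - lambda. Hence b = 0, and a polynomial in A applied to the point masses
   delta_v gives, by transitivity and a log-convexity argument, an invariant
   family of finitely supported unit vectors beta_n(v) with
   |sum_{u ~ v} beta_n(u) - a beta_n(v)|^2 <= 1/n. Their Gram matrices are the
   covariances of finite linear factors. Writing these matrices as C_n C_n^T with
   C_n lower triangular, and taking an entrywise limit C of C_n along a
   subsequence, we get the process X = C Z, for Z a sequence of independent
   standard normals; C_n Z has the law of the n-th factor and converges pointwise
   to X. The defect in the eigenvalue equation has variance 0 in the limit.
   Gaussian families with the same Gram matrix are identified in law by the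
   rotation invariance of Z, without characteristic functions. *)

Set Implicit Arguments.
Unset Strict Implicit.
Unset Printing Implicit Defensive.

(** * Finitely supported functions *)

(** A linear factor needs kernels that commute with all automorphisms, and an approximate
    eigenvector provided by the spectrum has no such symmetry. Functions p(A) delta_v have it
    automatically, because A commutes with automorphisms, and they are finitely supported. The price
    is that smallness of the Rayleigh quotient must be transferred from some unknown f to the orbits
    of point masses. The polynomials used are powers of C = 1 - B / M, with M a bound for the norm
    of B; growth rates of |C^n f| replace the spectral theorem.

    The kernels may spread over the graph as n grows, so their entrywise limit may lose mass, and
    only the Gram matrices carry usable information. Triangularity of C_n repairs this: row i is
    supported on 0, ..., i for every n, so entrywise convergence implies convergence of all inner
    products. It also couples the approximating processes on one probability space, so that
    dominated convergence yields convergence in distribution. *)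

Section InnerProduct.
Context {R : realType} {I : choiceType}.
Implicit Types (f g h : I -> R) (s : seq I).

Definition fsupp f : Prop := finite_set [set i | f i != 0].

(** The sum over a finite support is 0 by convention when infinitely many terms are nonzero, so [ip]
    is meaningful as soon as one argument is finitely supported. The other may be arbitrary, such as
    a sample of a normal family. *)
Definition ip f g : R := \sum_(i \in [set: I]) f i * g i.

Definition delta (i : I) : I -> R := fun j => (j == i)%:R.

Definition restrict s f : I -> R := fun i => if i \in s then f i else 0.

Lemma fsupp_sub s f : (forall i, i \notin s -> f i = 0) -> fsupp f.
Proof.
move=> f0; apply: (@sub_finite_set _ _ [set` s]); last exact: finite_seq.
by move=> i /=; apply: contraR => /f0 ->.
Qed.

Lemma fsuppP f : fsupp f -> exists2 s, uniq s & forall i, i \notin s -> f i = 0.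
Proof.
move=> ff; exists (fset_set [set i | f i != 0]); first exact: fset_uniq.
by move=> i; rewrite in_fset_set// notin_setE /= => /negP; rewrite negbK => /eqP.
Qed.

Lemma fsuppP2 f g : fsupp f -> fsupp g -> exists2 s, uniq s &
  (forall i, i \notin s -> f i = 0) /\ (forall i, i \notin s -> g i = 0).
Proof.
move=> /fsuppP[s us fs] /fsuppP[t ut gt]; exists (undup (s ++ t)).
  exact: undup_uniq.
by split=> i; rewrite mem_undup mem_cat negb_or => /andP[? ?]; [apply: fs|apply: gt].
Qed.

Lemma fsupp0 : fsupp 0.
Proof. exact: (@fsupp_sub [::]). Qed.

Lemma fsuppD f g : fsupp f -> fsupp g -> fsupp (f + g).
Proof.
move=> ff fg; have [s us [fs gs]] := fsuppP2 ff fg.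
by apply: (@fsupp_sub s) => i si; rewrite addrfctE fs// gs// addr0.
Qed.

Lemma fsuppZ a f : fsupp f -> fsupp (a *: f).
Proof.
move=> /fsuppP[s us fs].
by apply: (@fsupp_sub s) => i si; rewrite scalrfctE fs// scaler0.
Qed.

Lemma fsuppN f : fsupp f -> fsupp (- f).
Proof. by move=> ff; rewrite -scaleN1r; exact: fsuppZ. Qed.

Lemma fsuppB f g : fsupp f -> fsupp g -> fsupp (f - g).
Proof. by move=> ff fg; apply: fsuppD => //; exact: fsuppN. Qed.

Lemma fsupp_delta i : fsupp (delta i).
Proof.
by apply: (@fsupp_sub [:: i]) => j; rewrite inE /delta => /negbTE ->.
Qed.

Lemma fsupp_restrict s f : fsupp (restrict s f).
Proof. by apply: (@fsupp_sub s) => i; rewrite /restrict => /negbTE ->. Qed.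

Lemma ip_seq s f g : uniq s -> (forall i, i \notin s -> f i = 0) ->
  ip f g = \sum_(i <- s) f i * g i.
Proof.
move=> us fs; rewrite /ip (fsbigE s)//; last first.
  by move=> i _ si; rewrite fs// mul0r.
by apply: eq_bigl => i; rewrite in_setT.
Qed.

Lemma ipC f g : ip f g = ip g f.
Proof. by apply: eq_fsbigr => i _; rewrite mulrC. Qed.

Lemma ipZl a f g : ip (a *: f) g = a * ip f g.
Proof.
by rewrite /ip mulr_fsumr; apply: eq_fsbigr => i _; rewrite -mulrA.
Qed.

Lemma ipZr a f g : ip f (a *: g) = a * ip f g.
Proof. by rewrite ipC ipZl ipC. Qed.

Lemma ip0l g : ip 0 g = 0.
Proof. by rewrite -(scale0r (0 : I -> R)) ipZl mul0r. Qed.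

Lemma ip0r g : ip g 0 = 0.
Proof. by rewrite ipC ip0l. Qed.

Lemma ipNl f g : ip (- f) g = - ip f g.
Proof. by rewrite -scaleN1r ipZl mulN1r. Qed.

Lemma ipNr f g : ip f (- g) = - ip f g.
Proof. by rewrite ipC ipNl ipC. Qed.

Lemma ipDl f g h : fsupp f -> fsupp g -> ip (f + g) h = ip f h + ip g h.
Proof.
move=> ff fg; have [s us [fs gs]] := fsuppP2 ff fg.
rewrite !(@ip_seq s)//; last by move=> i si; rewrite addrfctE fs// gs// addr0.
by rewrite -big_split; apply: eq_bigr => i _; rewrite /= addrfctE mulrDl.
Qed.

Lemma ipDr f g h : fsupp f -> ip f (g + h) = ip f g + ip f h.
Proof.
move=> /fsuppP[s us fs]; rewrite !(@ip_seq s)// -big_split.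
by apply: eq_bigr => i _; rewrite addrfctE mulrDr.
Qed.

Lemma ipBl f g h : fsupp f -> fsupp g -> ip (f - g) h = ip f h - ip g h.
Proof. by move=> ff fg; rewrite ipDl// ?ipNl//; exact: fsuppN. Qed.

Lemma ipBr f g h : fsupp f -> ip f (g - h) = ip f g - ip f h.
Proof. by move=> ff; rewrite ipDr// ipNr. Qed.

Lemma ip_delta i g : ip (delta i) g = g i.
Proof.
rewrite (@ip_seq [:: i])// ?big_seq1 /delta ?eqxx ?mul1r// => j.
by rewrite inE => /negbTE ->.
Qed.

Lemma ip_ge0 f : 0 <= ip f f.
Proof. by apply: fsumr_ge0 => i _; rewrite -expr2 sqr_ge0. Qed.

Lemma sum_le_ip s f : uniq s -> fsupp f -> \sum_(i <- s) f i ^+ 2 <= ip f f.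
Proof.
move=> us /fsuppP[t ut ft].
rewrite (@ip_seq (s ++ [seq i <- t | i \notin s])).
- rewrite big_cat/=; under [X in _ <= X + _]eq_bigr do rewrite -expr2.
  by rewrite lerDl; apply: sumr_ge0 => i _; rewrite -expr2 sqr_ge0.
- rewrite cat_uniq us filter_uniq// andbT; apply/hasPn => i /=.
  by rewrite mem_filter => /andP[].
- move=> i; rewrite mem_cat negb_or mem_filter => /andP[si].
  by rewrite si/= => /ft.
Qed.

Lemma sqr_le_ip i f : fsupp f -> f i ^+ 2 <= ip f f.
Proof. by move=> /(@sum_le_ip [:: i] f isT); rewrite big_seq1. Qed.

Lemma ip_eq0 f : fsupp f -> ip f f = 0 -> f = 0.
Proof.
move=> ff f0; apply/funext => i; apply/eqP; rewrite -sqrf_eq0 eq_le sqr_ge0.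
by rewrite -{1}f0 sqr_le_ip.
Qed.

Lemma ip_cauchy_schwarz f g : fsupp f -> fsupp g ->
  ip f g ^+ 2 <= ip f f * ip g g.
Proof.
move=> ff fg; have [g0|g0] := eqVneq (ip g g) 0.
  by rewrite (ip_eq0 fg g0) !ip0r mulr0 expr0n.
have g_gt0 : 0 < ip g g by rewrite lt_neqAle eq_sym g0 ip_ge0.
have := ip_ge0 (ip g g *: f - ip f g *: g).
have fs1 := fsuppZ (ip g g) ff; have fs2 := fsuppZ (ip f g) fg.
rewrite ipBl// !ipBr// !ipZl !ipZr (ipC g f) => h.
rewrite -(ler_pM2l g_gt0) -subr_ge0; apply: le_trans h _.
by rewrite le_eqVlt; apply/orP; left; apply/eqP; ring.
Qed.

Lemma ip_sqrB_le f g : fsupp f -> fsupp g ->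
  ip (f - g) (f - g) <= 2 * (ip f f + ip g g).
Proof.
move=> ff fg; have := ip_ge0 (f + g); have fN := fsuppN fg.
by rewrite !ipDl// !ipDr// !ipNr !ipNl (ipC g f); lra.
Qed.

Lemma restrict_ip_le s f : uniq s ->
  ip (restrict s f) (restrict s f) = \sum_(i <- s) f i ^+ 2.
Proof.
move=> us; rewrite (@ip_seq s)//; last by move=> i; rewrite /restrict => /negbTE ->.
by rewrite !big_seq; apply: eq_bigr => i si; rewrite /restrict si expr2.
Qed.

End InnerProduct.

(** Holds since [K * (q / t) ^+ n] tends to 0; it turns a gap between two rates into a
    contradiction, whatever the constants. *)
Lemma ltr_geometric_growth {R : realType} (q t s K : R) : 0 <= q -> q < t -> 0 < s ->
  exists n, K * q ^+ n < t ^+ n * s.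
Proof.
move=> q0 qt s0; have t0 : 0 < t by exact: le_lt_trans qt.
have : (fun n => K * (q / t) ^+ n) @ \oo --> K * 0.
  apply: cvgMr; apply: cvg_expr; rewrite ger0_norm; last by rewrite divr_ge0// ltW.
  by rewrite ltr_pdivrMr// mul1r.
rewrite mulr0 => /cvgr_lt/(_ s s0)[n _ /(_ n (leqnn n))/= h].
exists n; rewrite mulrC -ltr_pdivrMl ?exprn_gt0//.
by move: h; rewrite expr_div_n mulrC mulrA [in X in X -> _]mulrC mulrA mulrAC.
Qed.

(** * Powers of a symmetric contraction and decay of orbits *)

Section SymmetricOperator.
Context {R : realType} {I : choiceType}.
Variables (L : (I -> R) -> (I -> R)) (l b : R).
Hypotheses (L_linear : linear L)
  (L_fsupp : forall f, fsupp f -> fsupp (L f))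
  (L_sym : forall f g, fsupp f -> fsupp g -> ip (L f) g = ip f (L g))
  (l_ge0 : 0 <= l)
  (L_bound : forall f, fsupp f -> ip (L f) (L f) <= l * ip f f).
Implicit Types (f g : I -> R) (eps q t : R).

(** With [L = A - a] this is the product of [A - lambda] and [A - conj lambda]: a real positive
    operator, which keeps the analysis on real functions. *)
Definition opB f : I -> R := L (L f) + b ^+ 2 *: f.

(** An upper bound for the norm of [opB]. The part [l + 2 * b ^+ 2] comes from the termwise estimate
    in [ip_opB_opB]; the 1 makes it positive even when [l] and [b] vanish. *)
Definition opM : R := l + 2 * b ^+ 2 + 1.

(** Since [opB] lies between 0 and [opM], this is a symmetric contraction, close to the identity
    where [opB] is small. Its powers act as a filter towards approximate kernels of [opB], and they
    are the terms of its Neumann series. *)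
Definition opC f : I -> R := f - opM^-1 *: opB f.

Lemma opM_gt0 : 0 < opM.
Proof. by have := sqr_ge0 b; rewrite /opM; move: l_ge0; lra. Qed.

Lemma L_0 : L 0 = 0.
Proof. by have := L_linear (-1) 0 0; rewrite scaler0 addr0 scaleN1r addNr. Qed.

Lemma L_Z a f : L (a *: f) = a *: L f.
Proof. by have := L_linear a f 0; rewrite addr0 L_0 addr0. Qed.

Lemma L_D f g : L (f + g) = L f + L g.
Proof. by have := L_linear 1 f g; rewrite !scale1r. Qed.

Lemma L_iter_opC n f : L (iter n opC f) = iter n opC (L f).
Proof.
elim: n => [//|n IH]; rewrite !iterS -IH.
by rewrite /opC /opB -!scaleNr L_D L_Z L_D L_Z.
Qed.

Lemma opB_linear : linear opB.
Proof.
move=> a f g; rewrite /opB !L_linear scalerDr scalerDr addrACA; congr (_ + _).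
by rewrite !scalerA mulrC.
Qed.

Lemma opC_linear : linear opC.
Proof.
move=> a f g; rewrite /opC opB_linear scalerDr opprD addrACA scalerBr.
by rewrite !scalerA [_ * a]mulrC.
Qed.

Lemma opB_fsupp f : fsupp f -> fsupp (opB f).
Proof. by move=> ff; apply: fsuppD; [do 2 apply: L_fsupp|apply: fsuppZ]. Qed.

Lemma opC_fsupp f : fsupp f -> fsupp (opC f).
Proof. by move=> ff; apply: fsuppB => //; apply: fsuppZ; apply: opB_fsupp. Qed.

Lemma iter_opC_fsupp n f : fsupp f -> fsupp (iter n opC f).
Proof. by move=> ff; elim: n => //= n; exact: opC_fsupp. Qed.

Lemma ip_opB f : fsupp f -> ip (opB f) f = ip (L f) (L f) + b ^+ 2 * ip f f.
Proof.
move=> ff; rewrite /opB ipDl ?ipZl ?L_sym//; do ?exact: L_fsupp.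
  by apply: L_fsupp; exact: L_fsupp.
exact: fsuppZ.
Qed.

Lemma ip_opB_ge0 f : fsupp f -> 0 <= ip (opB f) f.
Proof.
by move=> ff; rewrite ip_opB// addr_ge0 ?ip_ge0// mulr_ge0 ?sqr_ge0 ?ip_ge0.
Qed.

Lemma opB_sym f g : fsupp f -> fsupp g -> ip (opB f) g = ip f (opB g).
Proof.
move=> ff fg; have fL := L_fsupp ff; have gL := L_fsupp fg.
have fLL := L_fsupp fL; have fZ := fsuppZ (b ^+ 2) ff.
by rewrite /opB ipDl// ipDr// ipZl ipZr !L_sym.
Qed.

Lemma opC_sym f g : fsupp f -> fsupp g -> ip (opC f) g = ip f (opC g).
Proof.
move=> ff fg; have fB := fsuppZ opM^-1 (opB_fsupp ff).
by rewrite /opC ipBl// ipBr// ipZl ipZr opB_sym.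
Qed.

(** The left side is [|L L f|^2 + 2 b^2 |L f|^2 + b^4 |f|^2]. Bound the first term by [l |L f|^2]
    and compare with [|L f|^2 + b^2 |f|^2], which is [ip (opB f) f]. *)
Lemma ip_opB_opB f : fsupp f -> ip (opB f) (opB f) <= opM * ip (opB f) f.
Proof.
move=> ff; have fL := L_fsupp ff; have fLL := L_fsupp fL.
have fZ := fsuppZ (b ^+ 2) ff.
rewrite ip_opB// /opB ipDl// !ipDr// !ipZl !ipZr.
rewrite (L_sym fL)// -(L_sym ff)// (L_sym fL)//.
have := L_bound fL; have := ip_ge0 (L f); have := ip_ge0 f; have := l_ge0.
rewrite (L_sym fL)// /opM; set x := ip f f; set y := ip (L f) (L f).
set z := ip (L f) _; have := sqr_ge0 b; set c := b ^+ 2 => c0 l0 x0 y0 zl.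
have := mulr_ge0 c0 y0; have := mulr_ge0 c0 x0; have := mulr_ge0 c0 (mulr_ge0 c0 x0).
have := mulr_ge0 c0 (mulr_ge0 l0 x0).
move: zl; nra.
Qed.

(** In the expansion of the square, the quadratic term in [opM^-1] cancels at most half of the cross
    term, by [ip_opB_opB]. *)
Lemma opC_contract f : fsupp f ->
  ip (opC f) (opC f) <= ip f f - opM^-1 * ip (opB f) f.
Proof.
move=> ff; have fB := opB_fsupp ff; have fZ := fsuppZ opM^-1 fB.
rewrite /opC ipBl// !ipBr// !ipZl !ipZr (ipC f).
have /(ler_wpM2l (sqr_ge0 opM^-1)) := ip_opB_opB ff.
have -> : opM^-1 ^+ 2 * (opM * ip (opB f) f) = opM^-1 * ip (opB f) f.
  by rewrite mulrA expr2 mulfVK// gt_eqF// opM_gt0.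
rewrite expr2 -mulrA; lra.
Qed.

Lemma opC_contract_eps eps : (forall f, fsupp f -> eps * ip f f <= ip (opB f) f) ->
  forall f, fsupp f -> ip (opC f) (opC f) <= (1 - eps / opM) * ip f f.
Proof.
move=> h f ff; apply: le_trans (opC_contract ff) _.
have := ler_wpM2l (ltW (_ : 0 < opM^-1)) (h f ff); rewrite invr_gt0 => /(_ opM_gt0).
rewrite mulrA [_ * eps]mulrC; lra.
Qed.

Lemma iter_opC_linear n : linear (iter n opC).
Proof. by elim: n => [a f g//|n IH] a f g /=; rewrite IH opC_linear. Qed.

Lemma opB_comp f (phi : I -> I) : (forall g, L (g \o phi) = L g \o phi) ->
  opB (f \o phi) = opB f \o phi.
Proof. by move=> Lphi; rewrite /opB !Lphi. Qed.

Lemma iter_opC_comp n f (phi : I -> I) : (forall g, L (g \o phi) = L g \o phi) ->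
  iter n opC (f \o phi) = iter n opC f \o phi.
Proof.
move=> Lphi; elim: n => [//|n IH]; rewrite !iterS IH.
by rewrite /opC /opB !Lphi.
Qed.

Lemma iter_opC_sym n f g : fsupp f -> fsupp g ->
  ip (iter n opC f) g = ip f (iter n opC g).
Proof.
move=> ff; elim: n g => [//|n IH] g fg.
by rewrite iterS iterSr opC_sym ?IH//; [exact: opC_fsupp|exact: iter_opC_fsupp].
Qed.

(** The sequence [s k = |C^k f|^2] is log-convex: symmetry of C and Cauchy-Schwarz give
    [s (k+1)^2 <= s k * s (k+2)]. Its successive ratios are therefore nondecreasing, and the first
    one is at least [t]. *)
Lemma iter_opC_ge t n f : fsupp f -> t * ip f f <= ip (opC f) (opC f) -> 0 <= t ->
  t ^+ n * ip f f <= ip (iter n opC f) (iter n opC f).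
Proof.
move=> ff h t0; pose s n := ip (iter n opC f) (iter n opC f).
have fs k : fsupp (iter k opC f) by exact: iter_opC_fsupp.
have step k : t * s k <= s k.+1.
  elim: k => [//|k IH].
  have s2 : s k.+1 ^+ 2 <= s k * s k.+2.
    rewrite {1}/s {1}iterS opC_sym// -iterS; exact: ip_cauchy_schwarz.
  have := ip_ge0 (iter k.+1 opC f); rewrite le_eqVlt => /predU1P[s0|s0].
    by rewrite /s -s0 mulr0; exact: ip_ge0.
  have := ip_ge0 (iter k opC f); rewrite le_eqVlt => /predU1P[s1|s1].
    by move: s2; rewrite {2}/s -s1 mul0r real_leNgt ?num_real// exprn_gt0.
  rewrite -(ler_pM2l s1); apply: le_trans s2.
  by rewrite mulrCA mulrA expr2 ler_pM2r.
elim: n => [|n IH]; first by rewrite expr0 mul1r.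
by rewrite exprS -mulrA; apply: le_trans (step n); exact: ler_wpM2l.
Qed.

(** [f] is a finite combination of point masses, and [|x + y|^2 <= 2 (|x|^2 + |y|^2)]. The constant
    [K] depends on [f], but the rate does not. *)
Lemma iter_opC_decay q f : 0 <= q -> fsupp f ->
  (forall i n, ip (iter n opC (delta i)) (iter n opC (delta i)) <= q ^+ n) ->
  exists K, forall n, ip (iter n opC f) (iter n opC f) <= K * q ^+ n.
Proof.
move=> q0 /fsuppP[s us fs] dq.
have -> : f = \sum_(i <- s) f i *: (delta i : I -> R).
  apply/funext => j; rewrite fct_sumE.
  under eq_bigr do rewrite scalrfctE /delta -[_ *: _]/(_ * _).
  have [js|js] := boolP (j \in s).
    rewrite (bigD1_seq j)//= eqxx mulr1 big1 ?addr0// => i ij.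
    by rewrite eq_sym (negbTE ij) mulr0.
  rewrite fs// big_seq big1// => i si.
  by rewrite (_ : j == i = false) ?mulr0//; apply: contraNF js => /eqP ->.
pose P g := fsupp g /\ exists K, forall n, ip (iter n opC g) (iter n opC g) <= K * q ^+ n.
suff [] : P (\sum_(i <- s) f i *: (delta i : I -> R)) by [].
elim/big_rec : _ => [|i g _ [fg [K hK]]].
  split; first exact: fsupp0.
  exists 0 => n; have := iter_opC_linear n (-1) 0 0.
  by rewrite scaler0 addr0 scaleN1r addNr => ->; rewrite ip0l mul0r.
have fd := fsupp_delta (R := R) i.
split; first by apply: fsuppD => //; exact: fsuppZ.
exists (2 * (f i ^+ 2 + K)) => n; rewrite iter_opC_linear.
have h := @ip_sqrB_le _ _ (f i *: iter n opC (delta i)) (- iter n opC g).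
rewrite opprK in h; apply: le_trans (h _ _) _.
- exact/fsuppZ/iter_opC_fsupp.
- exact/fsuppN/iter_opC_fsupp.
rewrite ipNl ipNr opprK ipZl ipZr -mulrA ler_pM2l// mulrDl lerD//.
by rewrite mulrA -expr2 ler_wpM2l// sqr_ge0.
Qed.

(* If the Rayleigh quotient of [opB] stays above [eps] along all the orbits
   [iter n opC (delta i)], these decay like [(1 - eps / opM) ^ n], and so does
   the orbit of every [f]; by log-convexity, the orbit of an [f] with a smaller
   quotient cannot decay that fast. *)
Lemma rayleigh_delta_lt eps f : 0 < eps -> fsupp f -> f != 0 ->
  ip (opB f) f < eps / 2 * ip f f -> eps <= opM ->
  exists i n, ip (opB (iter n opC (delta i))) (iter n opC (delta i)) <
    eps * ip (iter n opC (delta i)) (iter n opC (delta i)).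
Proof.
move=> e0 ff f0 fB eM; apply/not_existsP => H.
have M0 := opM_gt0.
pose q := 1 - eps / opM.
have q0 : 0 <= q by rewrite subr_ge0 ler_pdivrMr// mul1r.
have dec i n : ip (iter n opC (delta i)) (iter n opC (delta i)) <= q ^+ n.
  have fd m := iter_opC_fsupp m (fsupp_delta (R := R) i).
  elim: n => [|n IH]; first by rewrite expr0 /= ip_delta /delta eqxx.
  rewrite iterS exprS; apply: le_trans (opC_contract (fd n)) _.
  have /forallNP/(_ n)/negP := H i; rewrite -leNgt => h.
  have /(ler_wpM2l (ltW (_ : 0 < opM^-1))) := h; rewrite invr_gt0 => /(_ M0) h1.
  have := ler_wpM2l q0 IH; rewrite {1}/q; move: h1.
  rewrite mulrA [opM^-1 * eps]mulrC; lra.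
have [K hK] := iter_opC_decay q0 ff dec.
have f_gt0 : 0 < ip f f.
  rewrite lt_neqAle ip_ge0 andbT eq_sym; apply: contra_neq f0 => h.
  exact: ip_eq0.
(* By hypothesis [ip (opC f) f] is at least [r] times [ip f f], and Cauchy-Schwarz turns this into
   [|C f|^2 >= r^2 |f|^2]. The halved [eps] gives room: [r^2] exceeds [q] by the square of
   [eps / (2 opM)]. *)
pose r := 1 - eps / 2 / opM.
have em0 : 0 < eps / opM by exact: divr_gt0.
have em : eps / opM <= 1 by rewrite ler_pdivrMr// mul1r.
have r0 : 0 <= r by rewrite /r mulrAC; lra.
have qr : q < r ^+ 2 by rewrite /q /r mulrAC expr2; nra.
have t : r ^+ 2 * ip f f <= ip (opC f) (opC f).
  rewrite -(ler_pM2r f_gt0) -mulrA -expr2 -exprMn.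
  apply: le_trans (ip_cauchy_schwarz (opC_fsupp ff) ff).
  rewrite ler_sqr ?nnegrE; last 2 first.
  - by rewrite mulr_ge0// ltW.
  - have fB' := fsuppZ opM^-1 (opB_fsupp ff).
    rewrite /opC ipBl// ipZl subr_ge0 ler_pdivrMl// ltW//; apply: lt_le_trans fB _.
    by rewrite ler_wpM2r ?ltW//; move: eM e0; lra.
  have fB' := fsuppZ opM^-1 (opB_fsupp ff).
  rewrite /opC ipBl// ipZl /r mulrBl mul1r lerD2l lerN2.
  by rewrite mulrAC [_ * opM^-1]mulrC ler_pM2l ?invr_gt0// ltW.
have [n] := ltr_geometric_growth K q0 qr f_gt0.
apply/negP; rewrite -leNgt; apply: le_trans (hK n).
by apply: iter_opC_ge => //; exact: sqr_ge0.
Qed.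

End SymmetricOperator.

(** * The adjacency operator *)

Section Adjacency.
Context {V : countType} (G : graph V).

Definition nbseq (v : V) : seq V := fset_set (neighbors G v).

Lemma mem_nbseq v u : (u \in nbseq v) = G v u.
Proof.
rewrite in_fset_set; last exact: adj_finite.
by apply/idP/idP; rewrite inE.
Qed.

Lemma adjacencyE (M : nmodType) (f : V -> M) v :
  adjacency G f v = \sum_(u <- nbseq v) f u.
Proof. by rewrite /adjacency fsbig_finite//; exact: adj_finite. Qed.

Lemma adjacency_aut (M : nmodType) (f : V -> M) phi : automorphism G phi ->
  adjacency G (f \o phi) = adjacency G f \o phi.
Proof.
move=> [[psi phiK psiK] Gphi]; apply/funext => v; rewrite /adjacency /=.
apply/esym/reindex_fsbig; split.
- by move=> u; rewrite /neighbors /= Gphi.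
- by move=> x y _ _; exact: can_inj phiK x y.
- move=> u; rewrite /neighbors /= => Gu; exists (psi u); rewrite ?psiK//.
  by rewrite -Gphi psiK.
Qed.

(** The degree is the adjacency operator applied to the constant function 1, and that operator
    commutes with automorphisms. *)
Lemma vertex_transitive_regular : vertex_transitive G ->
  exists D, forall v, size (nbseq v) = D.
Proof.
move=> Gt; have [[v0]|V0] := pselect (inhabited V); last first.
  by exists 0%N => v; exfalso; apply: V0.
exists (size (nbseq v0)) => v.
have szE u : size (nbseq u) = adjacency G (fun=> 1%N) u.
  by rewrite adjacencyE sum1_size.
have [phi aphi <-] := Gt v0 v.
by rewrite !szE; have := adjacency_aut (fun=> 1%N) aphi => /(congr1 (@^~ v0)).
Qed.

Section Real.
Context {R : realType}.
Local Notation A := (adjacency G : (V -> R) -> V -> R).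

Lemma adjacency_linear : linear A.
Proof.
move=> a f g; apply/funext => v; rewrite adjacencyE.
by transitivity (a * A f v + A g v) => //; rewrite !adjacencyE mulr_sumr -big_split.
Qed.

Lemma adjacency_seq s (f : V -> R) v : uniq s -> (forall u, u \notin s -> f u = 0) ->
  A f v = \sum_(u <- s) (G v u)%:R * f u.
Proof.
move=> us fs; rewrite /adjacency fsbig_mkcond (fsbigE s)//; last first.
  by move=> u _ su; rewrite /patch; case: ifP => // _; rewrite fs.
apply: eq_big => [u|u _]; first by rewrite in_setT.
rewrite /patch; have -> : (u \in neighbors G v) = G v u by apply/idP/idP; rewrite inE.
by case: ifP; rewrite ?mul1r ?mul0r.
Qed.

Lemma adjacency_fsupp (f : V -> R) : fsupp f -> fsupp (A f).
Proof.
move=> /fsuppP[s us fs]; apply: (@fsupp_sub _ _ (flatten (map nbseq s))) => v vs.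
rewrite (adjacency_seq _ us fs) big_seq big1// => u su.
suff -> : G v u = false by rewrite mul0r.
apply: contraNF vs => Gvu; apply/flattenP; exists (nbseq u); first exact: map_f.
by rewrite mem_nbseq adj_sym.
Qed.

Lemma adjacency_sym (f g : V -> R) : fsupp f -> fsupp g -> ip (A f) g = ip f (A g).
Proof.
move=> ff fg; have [s us [fs gs]] := fsuppP2 ff fg.
rewrite ipC !(@ip_seq _ _ s)//.
under eq_bigr do rewrite (adjacency_seq _ us fs) mulr_sumr.
rewrite exchange_big; apply: eq_bigr => u _ /=.
rewrite (adjacency_seq _ us gs) mulr_sumr; apply: eq_bigr => v _.
by rewrite adj_sym; ring.
Qed.

(** Cauchy-Schwarz at each vertex bounds [(A f v)^2] by [D] times the sum of [f u ^+ 2] over the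
    neighbors of [v]; summing over [v] counts each [u] at most [D] times. *)
Lemma adjacency_bound D (f : V -> R) : (forall v, size (nbseq v) = D) ->
  fsupp f -> ip (A f) (A f) <= D%:R ^+ 2 * ip f f.
Proof.
move=> GD ff; have [s us [fs As]] := fsuppP2 ff (adjacency_fsupp ff).
have loc v : A f v ^+ 2 <= D%:R * \sum_(u <- s) (G v u)%:R * f u ^+ 2.
  have un : uniq (nbseq v) by exact: fset_uniq.
  have -> : A f v = ip (restrict (nbseq v) (fun=> 1)) (restrict (nbseq v) f).
    rewrite (@ip_seq _ _ (nbseq v))//; last first.
      by move=> i; rewrite /restrict => /negbTE ->.
    rewrite adjacencyE !big_seq; apply: eq_bigr => u uv.
    by rewrite /restrict uv mul1r.
  apply: le_trans (ip_cauchy_schwarz _ _) _; do ?exact: fsupp_restrict.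
  rewrite !restrict_ip_le// expr1n big_const_seq count_predT iter_addr_0 GD.
  rewrite ler_wpM2l//; set g := fun u => f u ^+ 2.
  rewrite -(adjacency_seq (f := g) v us) ?adjacencyE// => u us'.
  by rewrite /g fs// expr0n.
rewrite (@ip_seq _ _ s)//; under eq_bigr do rewrite -expr2.
apply: le_trans (ler_sum _ (fun v _ => loc v)) _.
rewrite -mulr_sumr expr2 -mulrA ler_wpM2l// exchange_big/=.
rewrite (@ip_seq _ _ s)// mulr_sumr; apply: ler_sum => u _.
rewrite -mulr_suml -expr2 ler_wpM2r ?sqr_ge0// -(GD u).
under eq_bigr do rewrite adj_sym.
rewrite -natr_sum ler_nat (_ : (\sum_(v <- s) _)%N = size [seq v <- s | G u v]); last first.
  by rewrite size_filter; elim: s {us fs As loc} => [|v s IH]; rewrite ?big_nil ?big_cons ?IH.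
apply: uniq_leq_size; first exact: filter_uniq.
by move=> v; rewrite mem_filter mem_nbseq => /andP[].
Qed.

Definition shiftedA (a : R) (f : V -> R) : V -> R := A f - a *: f.

Lemma shiftedA_linear a : linear (shiftedA a).
Proof.
move=> c f g; rewrite /shiftedA adjacency_linear scalerDr opprD addrACA scalerBr.
by rewrite !scalerA [a * c]mulrC.
Qed.

Lemma shiftedA_fsupp a f : fsupp f -> fsupp (shiftedA a f).
Proof. by move=> ff; apply: fsuppB; [exact: adjacency_fsupp|exact: fsuppZ]. Qed.

Lemma shiftedA_sym a f g : fsupp f -> fsupp g ->
  ip (shiftedA a f) g = ip f (shiftedA a g).
Proof.
move=> ff fg; have fA := adjacency_fsupp ff; have fZ := fsuppZ a ff.
by rewrite /shiftedA ipBl// ipBr// ipZl ipZr adjacency_sym.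
Qed.

Lemma shiftedA_bound a D f : (forall v, size (nbseq v) = D) -> fsupp f ->
  ip (shiftedA a f) (shiftedA a f) <= 2 * (D%:R ^+ 2 + a ^+ 2) * ip f f.
Proof.
move=> GD ff; have fA := adjacency_fsupp ff; have fZ := fsuppZ a ff.
apply: le_trans (ip_sqrB_le fA fZ) _.
rewrite ipZl ipZr -mulrA ler_pM2l// mulrDl mulrA -expr2 lerD2r.
exact: adjacency_bound.
Qed.

Lemma shiftedA_aut a f phi : automorphism G phi ->
  shiftedA a (f \o phi) = shiftedA a f \o phi.
Proof. by move=> aphi; rewrite /shiftedA adjacency_aut. Qed.

End Real.
End Adjacency.

(** * Neumann series *)

Section Bounded.
Context {R : realType} {V : countType}.
Implicit Types (f g : V -> R) (T : (V -> R) -> V -> R).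

(* [f] is square summable, with squared norm at most [m]. *)
Definition bd f (m : R) := forall s, uniq s -> \sum_(i <- s) f i ^+ 2 <= m.

(** Continuity for pointwise convergence. The adjacency operator has it because each value involves
    finitely many neighbors, and so do polynomials in it; this extends facts from finitely supported
    functions to square summable ones by truncation. *)
Definition ptcont T := forall (F : nat -> V -> R) f,
  (forall v, F n v @[n --> \oo] --> f v) ->
  forall v, T (F n) v @[n --> \oo] --> T f v.

Lemma ptcont_id : ptcont id. Proof. by []. Qed.

Lemma ptcont_comp S T : ptcont S -> ptcont T -> ptcont (S \o T).
Proof. by move=> cS cT F f Ff; apply: cS; exact: cT. Qed.

Lemma ptcont_iter n T : ptcont T -> ptcont (iter n T).
Proof. by move=> cT; elim: n => [|n IH]; [exact: ptcont_id|exact: (ptcont_comp cT IH)]. Qed.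

Lemma ptcontD S T : ptcont S -> ptcont T -> ptcont (fun f => S f + T f).
Proof. by move=> cS cT F f Ff v; apply: cvgD; [exact: cS|exact: cT]. Qed.

Lemma ptcontZ a T : ptcont T -> ptcont (fun f => a *: T f).
Proof.
move=> cT F f Ff v; apply: (cvgM (g := fun n => T (F n) v) (cvg_cst a)).
exact: cT.
Qed.

Lemma ptcontB S T : ptcont S -> ptcont T -> ptcont (fun f => S f - T f).
Proof. by move=> cS cT F f Ff v; apply: cvgB; [exact: cS|exact: cT]. Qed.

Lemma cvg_sumr (I : Type) (s : seq I) (F : nat -> I -> R) (f : I -> R) :
  (forall i, F n i @[n --> \oo] --> f i) ->
  \sum_(i <- s) F n i @[n --> \oo] --> \sum_(i <- s) f i.
Proof.
move=> Ff; elim: s => [|i s IH].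
  rewrite big_nil; under eq_fun do rewrite big_nil; exact: cvg_cst.
rewrite big_cons; under eq_fun do rewrite big_cons.
by apply: cvgD.
Qed.

(** A form of Fatou's lemma: [bd] tests only finite partial sums, which pass to the pointwise
    limit. *)
Lemma ptcont_bd (F : nat -> V -> R) f m :
  (forall v, F n v @[n --> \oo] --> f v) -> (forall n, bd (F n) m) -> bd f m.
Proof.
move=> Ff bF s us.
have : \sum_(i <- s) F n i ^+ 2 @[n --> \oo] --> \sum_(i <- s) f i ^+ 2.
  by apply: cvg_sumr => i; under eq_fun do rewrite expr2; rewrite expr2; exact: cvgM.
move=> c; rewrite -(cvg_lim (@Rhausdorff R) c); apply: limr_le.
  by apply/cvg_ex; exists (\sum_(i <- s) f i ^+ 2).
by near=> n; apply: bF.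
Unshelve. all: by end_near. Qed.

Definition trunc n f : V -> R := fun v => if (choice.pickle v < n)%N then f v else 0.

Lemma trunc_cvg f v : trunc n f v @[n --> \oo] --> f v.
Proof.
apply: cvg_near_cst.
by exists (choice.pickle v).+1 => // n /= vn; rewrite /trunc vn.
Qed.

Lemma trunc_fsupp n f : fsupp (trunc n f).
Proof.
apply: (@fsupp_sub _ _ (pmap choice.unpickle (iota 0 n))) => v; rewrite /trunc.
case: ifP => // vn /negP[]; rewrite mem_pmap; apply/mapP.
by exists (choice.pickle v); rewrite ?mem_iota// choice.pickleK.
Qed.

Lemma fsupp_bd f : fsupp f -> bd f (ip f f).
Proof. by move=> ff s us; exact: sum_le_ip. Qed.

Lemma bd_ip_trunc n f m : bd f m -> ip (trunc n f) (trunc n f) <= m.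
Proof.
move=> bf; have [s us fs] := fsuppP (trunc_fsupp n f).
rewrite (@ip_seq _ _ s)//; apply: le_trans (bf s us); apply: ler_sum => v _.
by rewrite -expr2 /trunc; case: ifP; rewrite // expr0n sqr_ge0.
Qed.

(** Apply the bound to the truncations of [f], whose norms are at most that of [f], and pass to the
    limit with [ptcont_bd]. *)
Lemma bd_ext T q f m : ptcont T -> 0 <= q ->
  (forall f, fsupp f -> fsupp (T f)) ->
  (forall f, fsupp f -> ip (T f) (T f) <= q * ip f f) ->
  bd f m -> bd (T f) (q * m).
Proof.
move=> cT q0 fT bT bf.
apply: (@ptcont_bd (fun n => T (trunc n f))).
  by move=> v; apply: cT => {}v; exact: trunc_cvg.
move=> n s us; have ft := trunc_fsupp n f.
apply: le_trans (fsupp_bd (fT _ ft) us) _; apply: le_trans (bT _ ft) _.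
by rewrite ler_wpM2l// bd_ip_trunc.
Qed.

Lemma bd_ge0 f m : bd f m -> 0 <= m.
Proof. by move=> /(_ [::] isT); rewrite big_nil. Qed.

Lemma bdZ a f m : bd f m -> bd (a *: f) (a ^+ 2 * m).
Proof.
move=> bf s us; have := ler_wpM2l (sqr_ge0 a) (bf s us).
rewrite mulr_sumr; under eq_bigr do rewrite -exprMn; exact.
Qed.

Lemma bdD f g m n : bd f m -> bd g n -> bd (f + g) (2 * (m + n)).
Proof.
move=> bf bg s us; have := lerD (bf s us) (bg s us).
rewrite -(@ler_pM2l _ 2)// => /(le_trans _); apply.
rewrite -big_split mulr_sumr; apply: ler_sum => i _ /=.
by rewrite addrfctE; have := sqr_ge0 (f i - g i); nra.
Qed.

Lemma bd_sqr f m v : bd f m -> f v ^+ 2 <= m.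
Proof. by move=> /(_ [:: v] isT); rewrite big_seq1. Qed.

End Bounded.

Section Neumann.
Context {R : realType} {V : countType}.
Variables (L : (V -> R) -> (V -> R)) (l b eps : R).
Hypotheses (L_linear : linear L)
  (L_fsupp : forall f, fsupp f -> fsupp (L f))
  (L_sym : forall f g, fsupp f -> fsupp g -> ip (L f) g = ip f (L g))
  (l_ge0 : 0 <= l)
  (L_bound : forall f, fsupp f -> ip (L f) (L f) <= l * ip f f)
  (L_ptcont : ptcont L)
  (eps_gt0 : 0 < eps) (eps_le : eps <= opM l b)
  (rayleigh_ge : forall f, fsupp f -> eps * ip f f <= ip (opB L b f) f).
Implicit Types f g : V -> R.

Local Notation B := (opB L b).
Local Notation M := (opM l b).
Local Notation C := (opC L l b).
Local Notation q := (1 - eps / M).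

Let M0 : 0 < M. Proof. exact: opM_gt0. Qed.

Let q0 : 0 <= q.
Proof. by rewrite subr_ge0 ler_pdivrMr// mul1r. Qed.

Let q1 : q < 1.
Proof. by rewrite gtrBl divr_gt0. Qed.

Lemma opB_ptcont : ptcont B.
Proof.
apply: ptcontD; first exact: (ptcont_comp L_ptcont L_ptcont).
by apply: ptcontZ; exact: ptcont_id.
Qed.

Lemma opC_ptcont : ptcont C.
Proof. by apply: ptcontB; [exact: ptcont_id|apply: ptcontZ; exact: opB_ptcont]. Qed.

Lemma iter_opC_contract n f : fsupp f ->
  ip (iter n C f) (iter n C f) <= q ^+ n * ip f f.
Proof.
move=> ff; elim: n => [|n IH]; first by rewrite expr0 mul1r.
rewrite iterS exprS -mulrA; apply: le_trans (ler_wpM2l q0 IH).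
apply: opC_contract_eps => //; exact: iter_opC_fsupp.
Qed.

Lemma iter_opC_bd n f m : bd f m -> bd (iter n C f) (q ^+ n * m).
Proof.
apply: bd_ext.
- exact/ptcont_iter/opC_ptcont.
- exact: exprn_ge0.
- by move=> g; exact: iter_opC_fsupp.
- by move=> g; exact: iter_opC_contract.
Qed.

(** Partial sums of the series for the inverse of [B = M (1 - C)]. Applying [B] telescopes. *)
Fixpoint neumann n f : V -> R :=
  if n is k.+1 then M^-1 *: iter k C f + neumann k f else 0.

Lemma neumann_fsupp n f : fsupp f -> fsupp (neumann n f).
Proof.
move=> ff; elim: n => [|n IH] /=; first exact: fsupp0.
by apply: fsuppD => //; apply: fsuppZ; exact: iter_opC_fsupp.
Qed.

Lemma neumann_ptcont n : ptcont (neumann n).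
Proof.
elim: n => [|n IH]; first by move=> F f _ v; exact: cvg_cst.
by apply: ptcontD => //; apply/ptcontZ/ptcont_iter; exact: opC_ptcont.
Qed.

Lemma opB_neumann n f : B (neumann n f) = f - iter n C f.
Proof.
elim: n => [|n IH].
  have := opB_linear b L_linear (-1) 0 0.
  by rewrite scaler0 addr0 scaleN1r addNr /= subrr.
rewrite [neumann _ _]/= opB_linear// IH iterS [in RHS]/opC.
by rewrite opprB addrCA addrC.
Qed.

(** The bound is uniform in [n] by coercivity: with [x = neumann n f],
    [eps |x|^2 <= <B x, x> = <f - C^n f, x>], and [|f - C^n f| <= 2 |f|] since C is a contraction.
    Hence [|x| <= (2 / eps) |f|]. *)
Lemma neumann_bound n f : fsupp f ->
  ip (neumann n f) (neumann n f) <= 4 / eps ^+ 2 * ip f f.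
Proof.
move=> ff; have fN := neumann_fsupp n ff; have fC : fsupp (iter n C f).
  exact: iter_opC_fsupp.
set x := neumann n f; have h : eps ^+ 2 * ip x x <= 4 * ip f f.
  have := ip_ge0 x; rewrite le_eqVlt => /predU1P[<-|x0].
    by rewrite mulr0 mulr_ge0// ip_ge0.
  have h1 := rayleigh_ge fN; rewrite opB_neumann -/x in h1.
  have h2 := ip_cauchy_schwarz (fsuppB ff fC) fN; rewrite -/x in h2.
  have h3 : (eps * ip x x) ^+ 2 <= ip (f - iter n C f) x ^+ 2.
    rewrite ler_sqr// nnegrE ?(le_trans _ h1)// mulr_ge0// ?ip_ge0// ltW//.
  have h4 := le_trans h3 h2; rewrite exprMn expr2 [ip x x ^+ 2]expr2 mulrA in h4.
  rewrite -expr2 ler_pM2r// in h4; apply: le_trans h4 _.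
  apply: le_trans (ip_sqrB_le ff fC) _.
  have h5 := iter_opC_contract n ff.
  have h6 : q ^+ n * ip f f <= 1 * ip f f.
    by rewrite ler_wpM2r ?ip_ge0// exprn_ile1// ltW.
  lra.
by rewrite mulrAC ler_pdivlMr ?exprn_gt0// mulrC.
Qed.

Lemma neumann_bd n f m : bd f m -> bd (neumann n f) (4 / eps ^+ 2 * m).
Proof.
apply: bd_ext.
- exact: neumann_ptcont.
- by rewrite divr_ge0// sqr_ge0.
- by move=> g; exact: neumann_fsupp.
- by move=> g; exact: neumann_bound.
Qed.

Lemma iter_opC_cvg0 f m v : bd f m -> iter n C f v @[n --> \oo] --> 0.
Proof.
move=> bf; apply/cvgr0Pnorm_lt => e e0.
have : q ^+ n * m @[n --> \oo] --> 0 * m.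
  by apply: cvgMl; apply: cvg_expr; rewrite ger0_norm.
rewrite mul0r => /cvgr_lt/(_ (e ^+ 2)) h.
near=> n; rewrite -ltr_sqr ?nnegrE ?normr_ge0 ?(ltW e0)//.
rewrite real_normK ?num_real//; apply: le_lt_trans (bd_sqr v (iter_opC_bd n bf)) _.
by near: n; apply: h; exact: exprn_gt0.
Unshelve. all: by end_near. Qed.

Lemma neumann_is_cvg f m v : bd f m -> cvgn (fun n => neumann n f v).
Proof.
move=> bf; pose u n := M^-1 * iter n C f v.
have -> : (fun n => neumann n f v) = series u.
  apply/funext; elim=> [|n IH]; first by rewrite /series/= big_geq.
  by rewrite seriesSr -IH /= addrC.
apply: normed_cvg.
(* [q] is the rate for squared norms, so the values themselves decay at the rate of its square
   root. *)
have s0 : 0 <= Num.sqrt q by exact: sqrtr_ge0.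
have s1 : `|Num.sqrt q| < 1.
  rewrite ger0_norm// -(@ltr_pXn2r _ 2) ?nnegrE// sqr_sqrtr// expr1n//.
apply: (@series_le_cvg _ _ (geometric (M^-1 * Num.sqrt m) (Num.sqrt q))).
- by move=> n; exact: normr_ge0.
- by move=> n; rewrite /geometric/= !mulr_ge0 ?invr_ge0 ?(ltW M0) ?sqrtr_ge0// exprn_ge0.
- move=> n; rewrite /= /u normrM gtr0_norm ?invr_gt0// -mulrA.
  rewrite ler_pM2l ?invr_gt0// -(@ler_pXn2r _ 2) ?nnegrE ?normr_ge0
    ?mulr_ge0 ?sqrtr_ge0 ?exprn_ge0//.
  rewrite real_normK ?num_real// exprMn sqr_sqrtr ?(bd_ge0 bf)// exprAC.
  by rewrite sqr_sqrtr// mulrC; exact: bd_sqr (iter_opC_bd n bf).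
- exact: is_cvg_geometric_series.
Qed.

Lemma opB_solve f m : bd f m -> exists2 g, bd g (4 / eps ^+ 2 * m) & B g = f.
Proof.
move=> bf; pose g v := limn (fun n => neumann n f v).
have Ng v : neumann n f v @[n --> \oo] --> g v by exact: (neumann_is_cvg (v := v) bf).
exists g; first by apply: ptcont_bd Ng _ => n; exact: neumann_bd.
apply/funext => v.
have h1 : B (neumann n f) v @[n --> \oo] --> B g v by exact: opB_ptcont.
have h2 : B (neumann n f) v @[n --> \oo] --> f v - 0.
  under eq_fun do rewrite opB_neumann.
  by apply: cvgB; [exact: cvg_cst|exact: iter_opC_cvg0 bf].
by rewrite subr0 in h2; exact: (cvg_unique (@Rhausdorff R) h1 h2).
Qed.

(** If [B f = 0], then [f] is a fixed point of C, while the iterates of C tend to 0. *)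
Lemma opB_inj f m : bd f m -> B f = 0 -> f = 0.
Proof.
move=> bf Bf; have Cf n : iter n C f = f.
  by elim: n => //= n ->; rewrite /opC Bf scaler0 subr0.
apply/funext => v; have := iter_opC_cvg0 v bf.
under eq_fun do rewrite Cf; move=> h.
exact: (cvg_unique (@Rhausdorff R) (cvg_cst (f v)) h).
Qed.

End Neumann.

(** * The spectrum *)

Section ComplexL2.
Context {R : realType} {V : countType}.
Implicit Types (f g : V -> R[i]).

Definition ref f : V -> R := fun v => complex.Re (f v).
Definition imf f : V -> R := fun v => complex.Im (f v).

Lemma normc_sqr (z : R[i]) :
  Normc.normc z ^+ 2 = complex.Re z ^+ 2 + complex.Im z ^+ 2.
Proof. by case: z => x y /=; rewrite sqr_sqrtr// addr_ge0// sqr_ge0. Qed.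

Lemma eq_complex_fun f g : ref f = ref g -> imf f = imf g -> f = g.
Proof.
move=> /funeqP fgr /funeqP fgi; apply/funext => v.
have := fgr v; have := fgi v; rewrite /ref /imf.
by case: (f v) (g v) => [x y] [x' y'] /= -> ->.
Qed.

Lemma sqnorm2_bd f m : (sqnorm2 f <= m%:E)%E -> bd (ref f) m /\ bd (imf f) m.
Proof.
move=> fm; have h s : uniq s -> \sum_(v <- s) Normc.normc (f v) ^+ 2 <= m.
  move=> us; rewrite -lee_fin; apply: le_trans fm; apply: ereal_sup_ubound.
  exists [set` s]; first by split; [exact: finite_seq|].
  by rewrite -fsbig_seq//= sumEFin.
split=> s us; apply: le_trans (h s us); apply: ler_sum => v _;
  by rewrite normc_sqr ?lerDl ?lerDr sqr_ge0.
Qed.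

Lemma bd_sqnorm2 f m n : bd (ref f) m -> bd (imf f) n ->
  (sqnorm2 f <= (m + n)%:E)%E.
Proof.
move=> fm fn; apply: ge_ereal_sup => _ [A [Afin _] <-].
rewrite fsbig_finite//= sumEFin lee_fin.
under eq_bigr do rewrite normc_sqr; rewrite big_split /=.
by apply: lerD; [apply: fm|apply: fn]; exact: fset_uniq.
Qed.

Lemma sqnorm2_ge0 f : (0 <= sqnorm2 f)%E.
Proof. by apply: esum_ge0 => v _; rewrite lee_fin sqr_ge0. Qed.

Lemma l2P f : l2 f <-> exists m, bd (ref f) m /\ bd (imf f) m.
Proof.
split=> [lf|[m [h1 h2]]].
  exists (fine (sqnorm2 f)); apply: sqnorm2_bd; rewrite fineK//.
  by rewrite ge0_fin_numE// sqnorm2_ge0.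
by rewrite /l2/=; apply: le_lt_trans (bd_sqnorm2 h1 h2) _; rewrite ltry.
Qed.

Lemma ref_lin (a : R[i]) f g : ref (fun v => a * f v + g v) =
  complex.Re a *: ref f - complex.Im a *: imf f + ref g.
Proof.
apply/funext => v; rewrite /ref.
transitivity (complex.Re a * complex.Re (f v) - complex.Im a * complex.Im (f v) +
  complex.Re (g v)) => //.
by case: a (f v) (g v) => [a1 a2] [x y] [x' y'].
Qed.

Lemma imf_lin (a : R[i]) f g : imf (fun v => a * f v + g v) =
  complex.Re a *: imf f + complex.Im a *: ref f + imf g.
Proof.
apply/funext => v; rewrite /imf.
transitivity (complex.Re a * complex.Im (f v) + complex.Im a * complex.Re (f v) +
  complex.Im (g v)) => //.
by case: a (f v) (g v) => [a1 a2] [x y] [x' y'] /=; rewrite [a2 * x]mulrC.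
Qed.

Lemma l2_lin (a : R[i]) f g : l2 f -> l2 g -> l2 (fun v => a * f v + g v).
Proof.
move=> /l2P[m [fr fi]] /l2P[n [gr gi]]; apply/l2P.
have h x y (p q : V -> R) : bd p m -> bd q m ->
    bd (x *: p + y *: q) (2 * (x ^+ 2 * m + y ^+ 2 * m)).
  by move=> bp bq; apply: bdD; exact: bdZ.
have m0 := bd_ge0 fr; have n0 := bd_ge0 gr.
set r := complex.Re a; set s := complex.Im a.
exists (2 * (2 * (r ^+ 2 * m + s ^+ 2 * m) + n)).
rewrite ref_lin imf_lin; split; apply: bdD => //; last exact: h.
by rewrite -scaleNr -[s ^+ 2]sqrrN; exact: h.
Qed.

End ComplexL2.

Section Spectrum.
Context {R : realType} {V : countType} (G : graph V).
Variable (G_transitive : vertex_transitive G).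
Implicit Types (lambda : R[i]).
Local Notation A := (adjacency G).

Lemma ref_adjacency (f : V -> R[i]) : ref (A f) = A (ref f).
Proof.
apply/funext => v; rewrite /ref !adjacencyE.
by apply: (big_morph (fun z : R[i] => complex.Re z)) => // -[x y] [].
Qed.

Lemma imf_adjacency (f : V -> R[i]) : imf (A f) = A (imf f).
Proof.
apply/funext => v; rewrite /imf !adjacencyE.
by apply: (big_morph (fun z : R[i] => complex.Im z)) => // -[x y] [].
Qed.

Lemma ref_shift lambda (f : V -> R[i]) : ref (shift A lambda f) =
  shiftedA G (complex.Re lambda) (ref f) + complex.Im lambda *: imf f.
Proof.
rewrite /shiftedA -ref_adjacency; apply/funext => v; rewrite /ref /shift.
transitivity (complex.Re (A f v) - complex.Re lambda * complex.Re (f v) +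
  complex.Im lambda * complex.Im (f v)) => //.
case: lambda (f v) (A f v) => [a b] [x y] [x' y'].
transitivity (x' - (a * x - b * y)) => //=; ring.
Qed.

Lemma imf_shift lambda (f : V -> R[i]) : imf (shift A lambda f) =
  shiftedA G (complex.Re lambda) (imf f) - complex.Im lambda *: ref f.
Proof.
rewrite /shiftedA -imf_adjacency; apply/funext => v; rewrite /imf /shift.
transitivity (complex.Im (A f v) - complex.Re lambda * complex.Im (f v) -
  complex.Im lambda * complex.Re (f v)) => //.
case: lambda (f v) (A f v) => [a b] [x y] [x' y'].
transitivity (y' - (a * y + b * x)) => //=; ring.
Qed.

Lemma shiftedA_ptcont a : ptcont (shiftedA G a : (V -> R) -> _).
Proof.
apply: ptcontB; last by apply: ptcontZ; exact: ptcont_id.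
move=> F f Ff v; rewrite adjacencyE; under eq_fun do rewrite adjacencyE.
exact: cvg_sumr.
Qed.

(** Otherwise [B], acting separately on real and imaginary parts, has a bounded inverse, and
    [A - conj lambda] composed with it is a bounded inverse of [A - lambda]. *)
Lemma spectrum_rayleigh lambda (a := complex.Re lambda) (b := complex.Im lambda) :
  spectrum A lambda -> forall eps, 0 < eps ->
  exists f : V -> R, [/\ fsupp f, f != 0 &
    ip (opB (shiftedA G a) b f) f < eps * ip f f].
Proof.
move=> lsp eps0 eps0_gt0.
apply: contrapT => /forallNP none; apply: lsp.
have [D GD] := vertex_transitive_regular G_transitive.
pose l : R := 2 * (D%:R ^+ 2 + a ^+ 2).
have l0 : 0 <= l by rewrite mulr_ge0// addr_ge0// sqr_ge0.
pose L : (V -> R) -> _ := shiftedA G a.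
have Llin : linear L by exact: shiftedA_linear.
have Lfs f : fsupp f -> fsupp (L f) by exact: shiftedA_fsupp.
have Lsym f g : fsupp f -> fsupp g -> ip (L f) g = ip f (L g).
  exact: shiftedA_sym.
have Lbd f : fsupp f -> ip (L f) (L f) <= l * ip f f by exact: shiftedA_bound.
have Lpt : ptcont L by exact: shiftedA_ptcont.
pose M := opM l b; have M0 : 0 < M by exact: opM_gt0.
(* Capping at [M] keeps the rate [1 - eps / M] of the Neumann series nonnegative. *)
pose eps := Num.min eps0 M.
have e0 : 0 < eps by rewrite lt_min eps0_gt0.
have eM : eps <= M by rewrite ge_min lexx orbT.
have ray f : fsupp f -> eps * ip f f <= ip (opB L b f) f.
  move=> ff; have [->|f0] := eqVneq f 0; first by rewrite !ip0r mulr0.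
  apply: (@le_trans _ _ (eps0 * ip f f)).
    by rewrite ler_wpM2r ?ip_ge0// ge_min lexx.
  by rewrite leNgt; apply/negP => h; apply: (none f).
pose c : R := 4 / eps ^+ 2.
have c0 : 0 <= c by rewrite divr_ge0// sqr_ge0.
have solve f m : bd f m -> exists2 g, bd g (c * m) & opB L b g = f.
  by move=> bf; exact: (opB_solve Llin Lfs Lsym l0 Lbd Lpt e0 eM ray bf).
have inj f m : bd f m -> opB L b f = 0 -> f = 0.
  by move=> bf; exact: (opB_inj Lfs Lsym l0 Lbd Lpt e0 eM ray bf).
have LL f m : bd f m -> bd (L f) (l * m) by exact: bd_ext.
(* Composing [shift A lambda] with its complex conjugate gives [opB L b],
   acting separately on real and imaginary parts. *)
have shift2 mu nu (f : V -> R[i]) : complex.Re mu = a -> complex.Re nu = a ->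
    complex.Im nu = - complex.Im mu -> complex.Im mu ^+ 2 = b ^+ 2 ->
    ref (shift A mu (shift A nu f)) = opB L b (ref f) /\
    imf (shift A mu (shift A nu f)) = opB L b (imf f).
  move=> mua nua munu mub; rewrite !(ref_shift, imf_shift) mua nua munu -/L.
  have LD x y z : L (x + z *: y) = L x + z *: L y by rewrite addrC Llin addrC.
  have LB x y z : L (x - z *: y) = L x - z *: L y by rewrite -scaleNr LD scaleNr.
  rewrite /opB -mub; set r := ref f; set i := imf f; set z := complex.Im mu.
  rewrite (LD (L r) i) (LB (L i) r).
  split; apply/funext => v.
    transitivity (L (L r) v + (- z) * L i v + z * (L i v - (- z) * r v)) => //.
    transitivity (L (L r) v + z ^+ 2 * r v).
      by move: (L (L r) v) (L i v) (r v) => x y w; ring.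
    by [].
  transitivity (L (L i) v - (- z) * L r v - z * (L r v + (- z) * i v)) => //.
  transitivity (L (L i) v + z ^+ 2 * i v) => //.
  by move: (L (L i) v) (L r v) (i v) => x y w; ring.
(* The solution will be [(A - conj lambda) h] with [B h = f]. If [h] has parts [p] and [q], its
   parts are [L p - b q] and [L q + b p], whence this constant by
   [|x + y|^2 <= 2 (|x|^2 + |y|^2)]. *)
pose c1 : R := 2 * (l * c + b ^+ 2 * c).
have csolve f m : bd (ref f) m -> bd (imf f) m -> exists g,
    [/\ bd (ref g) (c1 * m), bd (imf g) (c1 * m) & shift A lambda g = f].
  move=> /solve[p bp Bp] /solve[q bq Bq].
  pose h v : R[i] := (p v +i* q v)%C.
  exists (shift A (lambda^*)%C h).
  have c1mE : c1 * m = 2 * (l * (c * m) + b ^+ 2 * (c * m)) by rewrite /c1; ring.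
  have c1E x y : bd x (c * m) -> bd y (c * m) -> bd (L x + (- b) *: y) (c1 * m).
    move=> bx by'; rewrite c1mE; apply: bdD; first exact: LL.
    by rewrite -(sqrrN b); exact: bdZ.
  have c1E' x y : bd x (c * m) -> bd y (c * m) -> bd (L x + b *: y) (c1 * m).
    move=> bx by'; rewrite c1mE; apply: bdD; first exact: LL.
    exact: bdZ.
  have [Bh_re Bh_im] : ref (shift A lambda (shift A (lambda^*)%C h)) = opB L b (ref h) /\
      imf (shift A lambda (shift A (lambda^*)%C h)) = opB L b (imf h).
    by apply: shift2; rewrite // /a /b; case: (lambda).
  have rh : complex.Re (lambda^*)%C = a by rewrite /a; case: (lambda).
  have ih : complex.Im (lambda^*)%C = - b by rewrite /b; case: (lambda).
  split.
  - by rewrite ref_shift rh ih; exact: c1E.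
  - by rewrite imf_shift rh ih -scaleNr opprK; exact: c1E'.
  - by apply: eq_complex_fun; rewrite ?Bh_re ?Bh_im.
(* Applying [A - conj lambda] as well shows that [B] kills both parts of [f]. *)
have cinj (f : V -> R[i]) : l2 f -> shift A lambda f = (fun=> 0) -> f = (fun=> 0).
  move=> /l2P[m [fr fi]] f0.
  have s0 : shift A (lambda^*)%C (shift A lambda f) = (fun=> 0).
    rewrite f0; apply/funext => v; rewrite /shift mulr0 subr0 adjacencyE.
    by rewrite big1.
  have [h1 h2] : ref (shift A (lambda^*)%C (shift A lambda f)) = opB L b (ref f) /\
      imf (shift A (lambda^*)%C (shift A lambda f)) = opB L b (imf f).
    apply: shift2; rewrite /a /b; case: (lambda) => //= x y; first by rewrite opprK.
    by rewrite sqrrN.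
  rewrite s0 in h1 h2.
  by apply: eq_complex_fun; [rewrite (inj _ _ fr)|rewrite (inj _ _ fi)].
have l2_shift (f : V -> R[i]) : l2 f -> l2 (shift A lambda f).
  move=> /l2P[m [fr fi]]; apply/l2P; exists (2 * (l * m + b ^+ 2 * m)).
  rewrite ref_shift imf_shift -/a -/b -scaleNr; split; apply: bdD; do ?exact: LL.
    exact: bdZ.
  by rewrite -(sqrrN b); exact: bdZ.
have shift_lin (k : R[i]) f g : shift A lambda (fun v => k * f v + g v) =
    (fun v => k * shift A lambda f v + shift A lambda g v).
  apply/funext => v; rewrite /shift !adjacencyE big_split/= -mulr_sumr; ring.
(* The inverse must be a total map, so a solution is chosen for each [f], with an arbitrary value
   outside [l2]. The factor 2 adds up the real and imaginary parts. *)
have [S SP] : {S : (V -> R[i]) -> (V -> R[i]) & forall f, l2 f ->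
    [/\ l2 (S f), shift A lambda (S f) = f &
        (sqnorm2 (S f) <= (2 * c1)%:E * sqnorm2 f)%E]}.
  apply: (@choice _ _ (fun f g => l2 f -> [/\ l2 g, shift A lambda g = f &
        (sqnorm2 g <= (2 * c1)%:E * sqnorm2 f)%E])) => f.
  have [lf|] := pselect (l2 f); last by exists f.
  have fE : sqnorm2 f = (fine (sqnorm2 f))%:E.
    by rewrite fineK// ge0_fin_numE// sqnorm2_ge0.
  have [fr fi] : bd (ref f) (fine (sqnorm2 f)) /\ bd (imf f) (fine (sqnorm2 f)).
    by apply: sqnorm2_bd; rewrite -fE.
  have [g [gr gi gf]] := csolve f _ fr fi; exists g => _; split=> //.
    by apply/l2P; eexists; split; [exact: gr|exact: gi].
  apply: le_trans (bd_sqnorm2 gr gi) _; rewrite {3}fE -EFinM lee_fin.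
  set x := fine _; rewrite le_eqVlt; apply/orP; left; apply/eqP; ring.
(* Chosen pointwise, [S] is not linear by construction. Linearity and the left inverse law both
   follow from uniqueness: [A - lambda] kills the difference of the two sides, so [cinj] applies. *)
exists S; split; last first.
  move=> f lf; have [lSf Sf _] := SP f lf; split=> //.
  have [lSs Ss _] := SP _ (l2_shift _ lf).
  have : (fun v => (-1) * f v + S (shift A lambda f) v) = (fun=> 0).
    apply: cinj; first exact: l2_lin.
    by rewrite shift_lin Ss; apply/funext => v; rewrite mulN1r addNr.
  move=> /funeqP h; apply/funext => v; have /eqP := h v.
  by rewrite mulN1r addrC subr_eq0 => /eqP.
split.
- by move=> f /SP[].
- move=> k f g lf lg; have [lSf Sf _] := SP f lf; have [lSg Sg _] := SP g lg.
  have [lSk Sk _] := SP _ (l2_lin k lf lg).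
  have : (fun v => (-1) * (k * S f v + S g v) + S (fun v => k * f v + g v) v) = (fun=> 0).
    apply: cinj; first by apply: l2_lin => //; exact: l2_lin.
    rewrite shift_lin Sk shift_lin Sf Sg.
    by apply/funext => v; rewrite mulN1r addNr.
  move=> /funeqP h; apply/funext => v; have /eqP := h v.
  by rewrite mulN1r addrC subr_eq0 => /eqP.
- by exists (2 * c1) => f /SP[].
Qed.

End Spectrum.

(** * Invariant approximate eigenvectors *)

Lemma ip_comp_bij {R : realType} {I : choiceType} (f g : I -> R) (phi : I -> I) :
  bijective phi -> ip (f \o phi) (g \o phi) = ip f g.
Proof. by move=> bphi; rewrite /ip [RHS](reindex_fsbigT phi _ bphi). Qed.

Section Kernels.
Context {R : realType} {V : countType} (G : graph V).
Variable (G_transitive : vertex_transitive G) (lambda : R[i]).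
Hypothesis lambda_sp : spectrum (adjacency G) lambda.
Local Notation a := (complex.Re lambda).
Local Notation L := (shiftedA G a).

(** The form of [B] is at least [b^2] times the squared norm; for nonzero [b] this contradicts
    [spectrum_rayleigh] with [eps = b^2]. *)
Lemma spectrum_real : complex.Im lambda = 0.
Proof.
apply/eqP/negPn/negP => b0.
have bb : 0 < complex.Im lambda ^+ 2 by rewrite exprn_even_gt0.
have [f [ff f0]] := spectrum_rayleigh G_transitive lambda_sp bb.
rewrite ip_opB; first last.
- exact: ff.
- by move=> g h; exact: shiftedA_sym.
- by move=> g; exact: shiftedA_fsupp.
by rewrite gtrDr ltNge ip_ge0.
Qed.

(** The kernels are [C^k delta_v], normalized. Invariance holds since C commutes with automorphisms,
    and transitivity makes the norms and the Rayleigh quotients independent of [v]. The defect at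
    [v] has squared norm [|L x|^2 / |x|^2], which is at most the quotient of [B]. *)
Lemma approximate_kernels : exists beta : nat -> V -> V -> R,
  [/\ forall n v, fsupp (beta n v),
      forall n phi, automorphism G phi ->
        forall v u, beta n (phi v) (phi u) = beta n v u,
      forall n v, ip (beta n v) (beta n v) = 1 &
      forall n v, let D := \sum_(u <- nbseq G v) beta n u - a *: beta n v in
        ip D D <= n.+1%:R^-1].
Proof.
have [D GD] := vertex_transitive_regular G_transitive.
pose l : R := 2 * (D%:R ^+ 2 + a ^+ 2).
have l0 : 0 <= l by rewrite mulr_ge0// addr_ge0// sqr_ge0.
have Llin : linear L by exact: shiftedA_linear.
have Lfs f : fsupp f -> fsupp (L f) by exact: shiftedA_fsupp.
have Lsym f g : fsupp f -> fsupp g -> ip (L f) g = ip f (L g).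
  exact: shiftedA_sym.
have Lbd f : fsupp f -> ip (L f) (L f) <= l * ip f f by exact: shiftedA_bound.
pose b : R := complex.Im lambda.
pose M := opM l b; have M0 : 0 < M by exact: opM_gt0.
pose x k v : V -> R := iter k (opC L l b) (delta v).
have fx k v : fsupp (x k v) by apply: iter_opC_fsupp => //; exact: fsupp_delta.
have x_aut k v phi : automorphism G phi -> x k (phi v) \o phi = x k v.
  move=> aphi; rewrite /x -iter_opC_comp; last first.
    by move=> g; exact: shiftedA_aut.
  congr (iter _ _ _); apply/funext => u; rewrite /delta /=.
  by rewrite (inj_eq (bij_inj (proj1 aphi))).
have x_sym k v u : x k v u = x k u v.
  have fd w := fsupp_delta (R := R) (w : V).
  by rewrite /x -[LHS]ip_delta -iter_opC_sym// ipC ip_delta.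
have ipx k v w : ip (x k v) (x k v) = ip (x k w) (x k w).
  have [phi aphi <-] := G_transitive v w.
  by rewrite -(x_aut k v phi)// ip_comp_bij//; case: aphi.
have [k kP] : {k : nat -> nat & forall n v,
    ip (opB L b (x (k n) v)) (x (k n) v) < n.+1%:R^-1 * ip (x (k n) v) (x (k n) v)}.
  apply: (@choice _ _ (fun n k => forall v,
    ip (opB L b (x k v)) (x k v) < n.+1%:R^-1 * ip (x k v) (x k v))) => n.
  (* [rayleigh_delta_lt] asks for [eps <= M] and for a test function with quotient below
     [eps / 2]. *)
  pose eps := Num.min n.+1%:R^-1 M.
  have e0 : 0 < eps by rewrite lt_min invr_gt0 ltr0n.
  have e2 : 0 < eps / 2 by rewrite divr_gt0.
  have eM : eps <= M by rewrite ge_min lexx orbT.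
  have [f [ff f0 fe]] := spectrum_rayleigh G_transitive lambda_sp e2.
  have [w [m]] := rayleigh_delta_lt Llin Lfs Lsym l0 Lbd e0 ff f0 fe eM.
  rewrite -/(x m w) => xw; exists m => v; have [phi aphi vw] := G_transitive v w.
  have -> : opB L b (x m v) = opB L b (x m w) \o phi.
    rewrite -(x_aut m v phi aphi) vw; apply: opB_comp => g.
    exact: shiftedA_aut.
  rewrite -[X in ip _ X](x_aut m v phi aphi) vw ip_comp_bij; last by case: aphi.
  rewrite (ipx m v w); apply: lt_le_trans xw _.
  by rewrite ler_wpM2r ?ip_ge0// ge_min lexx.
pose y n v := x (k n) v; pose N n v := ip (y n v) (y n v).
(* Strictness in [kP] forces this: a nonnegative quantity lies strictly below a multiple of
   [N n v]. *)
have N0 n v : 0 < N n v.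
  have := le_lt_trans (ip_opB_ge0 b Lfs Lsym (fx (k n) v)) (kP n v).
  by rewrite pmulr_rgt0.
exists (fun n v => (Num.sqrt (N n v))^-1 *: y n v); split.
- by move=> n v; apply: fsuppZ; exact: fx.
- move=> n phi aphi v u; rewrite !scalrfctE /N (ipx _ _ v) /y.
  by rewrite -(x_aut (k n) v phi aphi).
- move=> n v; rewrite ipZl ipZr mulrA -invfM -expr2 sqr_sqrtr ?ltW//.
  by rewrite mulVf// gt_eqF.
- move=> n v /=; set E := _ - _.
  have -> : E = (Num.sqrt (N n v))^-1 *: L (y n v).
    apply/funext => w; rewrite /E.
    transitivity (\sum_(u <- nbseq G v) (Num.sqrt (N n u))^-1 * y n u w -
      a * ((Num.sqrt (N n v))^-1 * y n v w)).
      by rewrite addrfctE fct_sumE.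
    transitivity ((Num.sqrt (N n v))^-1 * L (y n v) w) => //.
    (* The defect applies L to the vertex [v] that indexes the kernel, whereas the estimate concerns
       L applied to the argument [w]. The two agree because L is symmetric and commutes with C. *)
    have -> : L (y n v) w = L (y n w) v.
      have fd z := fsupp_delta (R := R) (z : V).
      rewrite -[LHS]ip_delta -[RHS]ip_delta -Lsym//; last exact: fx.
      rewrite /y /x (L_iter_opC l b Llin) -iter_opC_sym//; last exact: Lfs.
      by rewrite ipC.
    rewrite /shiftedA; transitivity ((Num.sqrt (N n v))^-1 *
      (adjacency G (y n w) v - a * y n w v)) => //.
    rewrite adjacencyE mulrBr mulr_sumr; congr (_ - _).
      by apply: eq_bigr => u _; rewrite /N (ipx _ u v) /y (x_sym _ u).
    by rewrite mulrCA /y (x_sym _ w).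
  rewrite ipZl ipZr mulrA -invfM -expr2 sqr_sqrtr; last exact: ltW.
  rewrite ler_pdivrMl// mulrC.
  apply: ltW; apply: le_lt_trans (kP n v); rewrite ip_opB//.
  by rewrite lerDl mulr_ge0 ?sqr_ge0 ?ip_ge0.
Qed.

End Kernels.

(** * Cholesky decomposition and limits of Gram matrices *)

Section GramSchmidt.
Context {R : realType} {I : choiceType}.
Variable x : nat -> I -> R.
Hypothesis x_fsupp : forall i, fsupp (x i).

(** Gram-Schmidt: the component of [x i] orthogonal to [x 0, ..., x (k-1)]. When [residual m m]
    vanishes, nothing is subtracted. *)
Fixpoint residual k i : I -> R :=
  if k is m.+1 then
    residual m i -
      (ip (residual m i) (residual m m) / ip (residual m m) (residual m m)) *: residual m m
  else x i.

(* When the residual vanishes, the coefficients are 0, as 0^-1 = 0. *)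
Definition cholesky i k : R :=
  ip (residual k i) (residual k k) / Num.sqrt (ip (residual k k) (residual k k)).

Lemma residual_fsupp k i : fsupp (residual k i).
Proof.
elim: k i => [|k IH] i /=; first exact: x_fsupp.
by apply: fsuppB => //; exact: fsuppZ.
Qed.

Lemma residual_eq0 k i : (i < k)%N -> residual k i = 0.
Proof.
elim: k i => [//|k IH] i; rewrite ltnS leq_eqVlt => /predU1P[->|ik] /=.
  have [n0|n0] := eqVneq (ip (residual k k) (residual k k)) 0.
    by rewrite (ip_eq0 (residual_fsupp k k) n0) scaler0 subr0.
  by rewrite divff// scale1r subrr.
by rewrite IH// ip0l mul0r scale0r subrr.
Qed.

Lemma cholesky_eq0 i k : (i < k)%N -> cholesky i k = 0.
Proof. by move=> ik; rewrite /cholesky residual_eq0// ip0l mul0r. Qed.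

(** Pythagoras for the direction of [residual k k]: the coefficients along it are the [cholesky]
    entries, and the rest is the next residual. *)
Lemma residual_ip k i j : ip (residual k i) (residual k j) =
  cholesky i k * cholesky j k + ip (residual k.+1 i) (residual k.+1 j).
Proof.
rewrite /cholesky [residual k.+1 i]/= [residual k.+1 j]/=.
have fr l := residual_fsupp k l.
have [n0|n0] := eqVneq (ip (residual k k) (residual k k)) 0.
  by rewrite (ip_eq0 (fr k) n0) !scaler0 !subr0 !ip0r !mul0r add0r.
rewrite mulrACA -invfM -expr2 sqr_sqrtr ?ip_ge0//.
have fz c : fsupp (c *: residual k k) by exact: fsuppZ.
rewrite ipBl// !ipBr// !ipZl !ipZr (ipC (residual k k) (residual k j)).
by field.
Qed.

Lemma cholesky_fsupp i : fsupp (cholesky i).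
Proof.
apply: (@fsupp_sub _ _ (iota 0 i.+1)) => k.
by rewrite mem_iota add0n leq0n /= ltnS -ltnNge; exact: cholesky_eq0.
Qed.

Lemma cholesky_ip i j : ip (cholesky i) (cholesky j) = ip (x i) (x j).
Proof.
have h m : ip (x i) (x j) = \sum_(0 <= k < m) cholesky i k * cholesky j k +
    ip (residual m i) (residual m j).
  elim: m => [|m IH]; first by rewrite big_geq// add0r.
  by rewrite big_nat_recr//= -addrA -residual_ip.
rewrite (h i.+1) residual_eq0// ip0l addr0.
rewrite (@ip_seq _ _ (index_iota 0 i.+1)) ?iota_uniq// => k.
by rewrite mem_index_iota leq0n /= ltnS -ltnNge; exact: cholesky_eq0.
Qed.

End GramSchmidt.

(** The cube is compact by Tychonoff, so the sequence has a cluster point. As [I] is countable,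
    [s N] can be chosen beyond [N] and within [1 / (N+1)] of that point on the first [N]
    coordinates. [s] need not be monotone; [N <= s N] suffices to carry error bounds along. *)
Lemma ptws_bounded_subseq {R : realType} {I : countType} (u : nat -> I -> R) :
  (forall n i, `|u n i| <= 1) ->
  exists (s : nat -> nat) (c : I -> R), (forall N, (N <= s N)%N) /\
    forall i, u (s N) i @[N --> \oo] --> c i.
Proof.
move=> u1.
have K : compact [set f : {ptws I -> R} | forall i, `[(-1 : R), 1]%classic (f i)].
  apply: (@tychonoff I (fun=> R) (fun=> `[(-1 : R), 1]%classic)) => i.
  exact: segment_compact.
pose F : set_system {ptws I -> R} := (u : nat -> {ptws I -> R}) @ \oo.
have FF : ProperFilter F by exact: fmap_proper_filter.
have [p [_ clp]] : [set f : {ptws I -> R} | forall i, `[(-1 : R), 1]%classic (f i)]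
    `&` cluster F !=set0.
  by apply: K; exists 0%N => // n _ i; rewrite /= in_itv /= -ler_norml.
have FP : Filter (nbhs (p : {ptws I -> R})) by exact: nbhs_filter.
have near_p N : nbhs (p : {ptws I -> R}) [set f | forall i,
    (choice.pickle i < N)%N -> `|p i - f i| < N.+1%:R^-1].
  have h (k : 'I_N) : nbhs (p : {ptws I -> R}) [set f | forall i,
      choice.pickle i = k -> `|p i - f i| < N.+1%:R^-1].
    have [[i ik]|ni] := pselect (exists i : I, choice.pickle i = k); last first.
      apply: (@filterS _ _ FP setT); last exact: filterT.
      by move=> f _ i ik; exfalso; apply: ni; exists i.
    have ci := @proj_continuous I (fun=> R) i p.
    have e0 : 0 < N.+1%:R^-1 :> R by rewrite invr_gt0 ltr0n.
    move/cvgrPdist_lt/(_ _ e0) : ci.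
    apply: (@filterS _ _ FP) => f fi j jk.
    suff -> : j = i by exact: fi.
    by apply: (pcan_inj (@choice.pickleK I)); rewrite ik jk.
  apply: (@filterS _ _ FP _ _ _ (@filter_forall _ _ _ _ FP h)) => f fN i iN.
  exact: (fN (Ordinal iN) i erefl).
have [s sP] : {s : nat -> nat & forall N, (N <= s N)%N /\
    forall i, (choice.pickle i < N)%N -> `|p i - u (s N) i| < N.+1%:R^-1}.
  apply: (@choice _ _ (fun N m => (N <= m)%N /\
    forall i, (choice.pickle i < N)%N -> `|p i - u m i| < N.+1%:R^-1)) => N.
  have FN : F [set f | exists2 m, (N <= m)%N & f = u m].
    by exists N => // m Nm; exists m.
  have [f [[m Nm ->] h]] := clp _ _ FN (near_p N).
  by exists m.
exists s, p; split; first by move=> N; have [] := sP N.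
move=> i; apply/cvgrPdist_lt => e e0; near=> N.
have [_ /(_ i) h] := sP N; apply: (@lt_trans _ _ N.+1%:R^-1).
  by apply: h; near: N; exists (choice.pickle i).+1.
near: N; exact: near_infty_natSinv_lt (PosNum e0).
Unshelve. all: by end_near. Qed.

Lemma ptws_cvg {R : realType} {I : countType} (F : nat -> {ptws I -> R})
    (f : {ptws I -> R}) :
  (forall i, F n i @[n --> \oo] --> f i) -> F @ \oo --> f.
Proof.
move=> Ff; apply/cvg_sup => i; apply/cvg_image.
  by apply/seteqP; split => // x _; exists (fun=> x).
move=> A /Ff hA; exists (fun g : {ptws I -> R} => A (g i)) => //.
by apply/seteqP; split => [x [g Ag <-]|x Ax] //; exists (fun=> x).
Qed.

(** * Product laws and independence *)

Lemma finite_measureC {R : realType} d (T : measurableType d)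
    (m : {finite_measure set T -> \bar R}) (A : set T) : measurable A ->
  m (~` A) = (m setT - m A)%E.
Proof.
move=> mA; rewrite -setTD measureD ?setTI//.
by rewrite ltey_eq fin_num_measure.
Qed.

Section ProductLaw.
Context {R : realType} {V : countType}.
Implicit Types (s : seq V) (B : V -> set R).

Definition rect s B : set (V -> R) := [set x | forall v, v \in s -> B v (x v)].

Definition rects : set (set (V -> R)) :=
  [set C | exists s B, [/\ uniq s, forall v, measurable (B v) & C = rect s B]].

Lemma rectsI : setI_closed rects.
Proof.
move=> _ _ [s [B [us mB ->]]] [t [D [ut mD ->]]].
exists (undup (s ++ t)).
exists (fun v => (if v \in s then B v else setT) `&` (if v \in t then D v else setT)).
split; first exact: undup_uniq.
- by move=> v; apply: measurableI; case: ifP.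
- apply/seteqP; split=> x.
  + by move=> [xs xt] v; rewrite mem_undup mem_cat => _; split; case: ifP => // ?;
      [exact: xs|exact: xt].
  + move=> h; split=> v vs; have := h v; rewrite mem_undup mem_cat vs ?orbT => -[]//.
Qed.

Lemma cylinders_rects : product_measurable `<=` <<s rects >>.
Proof.
apply: smallest_sub; first exact: smallest_sigma_algebra.
move=> _ [v [B [mB ->]]]; apply: sub_sigma_algebra.
exists [:: v], (fun=> B); split => //; apply/seteqP; split => x /=.
  by move=> Bx u; rewrite inE => /eqP ->.
by apply; rewrite inE.
Qed.

Section Preimage.
Context d (T : measurableType d) (X : V -> T -> R).
Hypothesis mX : forall v, measurable_fun setT (X v).

Lemma measurable_product_preimage (C : set (V -> R)) : product_measurable C ->
  measurable [set w | C (X^~ w)].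
Proof.
move: C.
suff h : product_measurable `<=` [set C : set (V -> R) | measurable [set w | C (X^~ w)]].
  by move=> C /h.
apply: smallest_sub; last first.
  move=> _ [v [B [mB ->]]]; have := mX v measurableT mB.
  by rewrite setTI.
split.
- exact: measurable0.
- by move=> C mC; exact: (measurableD measurableT mC).
- by move=> F mF; apply: bigcupT_measurable.
Qed.

Lemma rect_preimage s B :
  [set w | rect s B (X^~ w)] = \bigcap_(v in [set` s]) (X v @^-1` B v).
Proof. by apply/seteqP; split => w h v /=; exact: h. Qed.

End Preimage.

(** The pi-lambda theorem for finite rectangles. It is stated for finite measures because
    [indep_rows] applies it to a probability restricted to an event. *)
Lemma product_law_unique d d' (T : measurableType d) (T' : measurableType d')
    (m : {finite_measure set T -> \bar R}) (m' : {finite_measure set T' -> \bar R})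
    (X : V -> T -> R) (Y : V -> T' -> R) :
  (forall v, measurable_fun setT (X v)) -> (forall v, measurable_fun setT (Y v)) ->
  (forall s B, uniq s -> (forall v, measurable (B v)) ->
    m (\bigcap_(v in [set` s]) (X v @^-1` B v)) =
    m' (\bigcap_(v in [set` s]) (Y v @^-1` B v))) ->
  forall C, product_measurable C ->
    m [set w | C (X^~ w)] = m' [set w | C (Y^~ w)].
Proof.
move=> mX mY h.
pose D : set (set (V -> R)) := [set C | [/\ measurable [set w | C (X^~ w)],
  measurable [set w | C (Y^~ w)] & m [set w | C (X^~ w)] = m' [set w | C (Y^~ w)]]].
suff DP : <<s rects >> `<=` D by move=> C /cylinders_rects/DP[].
(* The rectangle with no constraint gives equality of total masses. *)
have hT : m setT = m' setT.
  have := h [::] (fun=> setT) isT (fun=> measurableT).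
  by rewrite set_nil !bigcap_set0.
rewrite -(setI_closed_g_dynkin_g_sigma_algebra rectsI).
apply: smallest_sub; last first.
  move=> _ [s [B [us mB ->]]]; rewrite /D /= !rect_preimage.
  split; last exact: h.
  - apply: (@fin_bigcap_measurable _ T); first exact: finite_seq.
    by move=> v _; have := mX v measurableT (B v) (mB v); rewrite setTI.
  - apply: (@fin_bigcap_measurable _ T'); first exact: finite_seq.
    by move=> v _; have := mY v measurableT (B v) (mB v); rewrite setTI.
split.
- by split => //; exact: measurableT.
- move=> C [mC mC' mmC]; split; try exact: measurableC.
  rewrite -[LHS]/(m (~` [set w | C (X^~ w)])) -[RHS]/(m' (~` [set w | C (Y^~ w)])).
  by rewrite !finite_measureC// hT mmC.
- move=> F tF DF; split.
  + by apply: bigcupT_measurable => n; have [] := DF n.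
  + by apply: bigcupT_measurable => n; have [] := DF n.
  rewrite -[LHS]/(m (\bigcup_n [set w | F n (X^~ w)])).
  rewrite -[RHS]/(m' (\bigcup_n [set w | F n (Y^~ w)])).
  rewrite !measure_semi_bigcup//; try (by move=> n; have [] := DF n).
  + by apply: eq_eseriesr => n _; have [] := DF n.
  + apply/trivIsetP => i j _ _ ij; move/trivIsetP : tF => /(_ i j Logic.I Logic.I ij) tF.
    apply/seteqP; split => // w [Fi Fj].
    by suff : set0 (Y^~ w) by []; rewrite -tF.
  + by apply: bigcupT_measurable => n; have [] := DF n.
  + apply/trivIsetP => i j _ _ ij; move/trivIsetP : tF => /(_ i j Logic.I Logic.I ij) tF.
    apply/seteqP; split => // w [Fi Fj].
    by suff : set0 (X^~ w) by []; rewrite -tF.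
  + by apply: bigcupT_measurable => n; have [] := DF n.
Qed.

Definition productType := g_sigma_algebraType
  [set C | exists v (B : set R), measurable B /\ C = [set x : V -> R | B (x v)]].

Lemma measurable_coord v : measurable_fun setT (fun x : productType => (x : V -> R) v).
Proof.
by move=> _ B mB; rewrite setTI; apply: sub_sigma_algebra; exists v, B.
Qed.

End ProductLaw.

Arguments productType R V : clear implicits.

Section Independence.
Context {R : realType} d (T : measurableType d) (P : probability T R).

Definition indep (I : countType) (X : I -> T -> R) : Prop :=
  forall (s : seq I) (B : I -> set R), uniq s -> (forall v, measurable (B v)) ->
    P (\bigcap_(v in [set` s]) (X v @^-1` B v)) =
      (\prod_(v <- s) P (X v @^-1` B v))%E.

Lemma seq_bigcap_measurable (I : choiceType) (s : seq I) (F : I -> set T) :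
  (forall i, measurable (F i)) -> measurable (\bigcap_(i in [set` s]) F i).
Proof. by move=> mF; apply: fin_bigcap_measurable => //; exact: finite_seq. Qed.

Lemma bigcap_seq_cons (I : choiceType) (i : I) (s : seq I) (F : I -> set T) :
  \bigcap_(j in [set` i :: s]) F j = F i `&` \bigcap_(j in [set` s]) F j.
Proof.
apply/seteqP; split => w.
  move=> h; split; first by apply: h; rewrite /= mem_head.
  by move=> j js; apply: h; rewrite /= inE js orbT.
by move=> [Fi h] j /=; rewrite inE => /predU1P[->//|]; exact: h.
Qed.

Lemma bigcap_seq_cat (I : choiceType) (s t : seq I) (F : I -> set T) :
  \bigcap_(j in [set` s ++ t]) F j =
  \bigcap_(j in [set` s]) F j `&` \bigcap_(j in [set` t]) F j.
Proof.
elim: s => [|i s IH]; first by rewrite set_nil bigcap_set0 setTI.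
by rewrite cat_cons !bigcap_seq_cons IH setIA.
Qed.

Lemma bigcap_seq_map (I J : choiceType) (e : J -> I) (r : seq J) (F : I -> set T) :
  \bigcap_(i in [set` map e r]) F i = \bigcap_(j in [set` r]) F (e j).
Proof.
elim: r => [|j r IH]; first by rewrite /= !set_nil !bigcap_set0.
by rewrite map_cons !bigcap_seq_cons IH.
Qed.

(** Disjoint rows of an independent family are independent, also jointly with finitely many
    coordinates [t] outside them. These extra coordinates drive the induction: once the event on a
    new row is reduced to a rectangle, its constraints can be moved into [t]. *)
Lemma indep_rows (I J : countType) (N : choiceType) (X : I -> T -> R)
    (e : N -> J -> I) (C : N -> set (J -> R)) :
  (forall n n' j j', e n j = e n' j' -> n = n' /\ j = j') ->
  (forall i, measurable_fun setT (X i)) -> indep X ->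
  (forall n, product_measurable (C n)) ->
  forall s, uniq s -> forall t B, uniq t -> (forall i, measurable (B i)) ->
  (forall n j, n \in s -> e n j \notin t) ->
  P (\bigcap_(n in [set` s]) [set w | C n (fun j => X (e n j) w)] `&`
     \bigcap_(i in [set` t]) (X i @^-1` B i)) =
  (\prod_(n <- s) P [set w | C n (fun j => X (e n j) w)] *
   \prod_(i <- t) P (X i @^-1` B i))%E.
Proof.
move=> einj mX iX mC.
have mpre i (D : set R) : measurable D -> measurable (X i @^-1` D).
  by move=> mD; have := mX i measurableT _ mD; rewrite setTI.
have mrow n : measurable [set w | C n (fun j => X (e n j) w)].
  exact: (measurable_product_preimage (fun j => mX (e n j)) (mC n)).
elim=> [_ t B ut mB _|n s IH /= /andP[ns us] t B ut mB st].
  by rewrite big_nil mul1e set_nil bigcap_set0 setTI iX.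
set F := \bigcap_(n in [set` s]) [set w | C n (fun j => X (e n j) w)] `&`
     \bigcap_(i in [set` t]) (X i @^-1` B i).
have mF : measurable F by apply: measurableI; apply: seq_bigcap_measurable => // i; exact: mpre.
have st' n' j : n' \in s -> e n' j \notin t by move=> n's; apply: st; rewrite inE n's orbT.
have PF := IH us t B ut mB st'.
rewrite bigcap_seq_cons -setIA -/F big_cons -muleA -PF -/F.
have c0 : 0 <= fine (P F) by rewrite fine_ge0.
(* Independence of row [n] from [F] says that these two finite measures agree on events of that row;
   by [product_law_unique], rectangles suffice. *)
pose m := mrestr P mF.
pose m' := mscale (NngNum c0) P.
have mE A : m A = P (A `&` F) by [].
have m'E A : m' A = (P A * P F)%E.
  by rewrite /m' /mscale -[_%:num]/(fine (P F)) fineK ?fin_num_measure// muleC.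
rewrite -mE -m'E.
apply: (@product_law_unique _ _ _ _ _ _ m m' (fun j => X (e n j)) (fun j => X (e n j))) => //.
move=> r D ur mD; apply: etrans (mE _) _; apply: etrans _ (esym (m'E _)).
(* One family of sets that is [D] on row [n] and [B] elsewhere, so that the induction hypothesis
   applies to [map (e n) r ++ t]. *)
pose B' i := if pselect (exists j, e n j = i) is left h then D (projT1 (cid h)) else B i.
have B'e j : B' (e n j) = D j.
  rewrite /B'; case: pselect => [h|]; last by case; exists j.
  by case: (cid h) => j' /= /einj[_ ->].
have B't i : i \in t -> B' i = B i.
  move=> it; rewrite /B'; case: pselect => // -[j ij]; exfalso.
  by have /negP := st n j (mem_head _ _); rewrite ij.
have mB' i : measurable (B' i) by rewrite /B'; case: pselect.
have uer : uniq (map (e n) r) by rewrite map_inj_uniq// => j j' /einj[].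
have ut' : uniq (map (e n) r ++ t).
  rewrite cat_uniq uer ut andbT; apply/hasPn => i it /=; apply/mapP => -[j _ ij].
  by have /negP := st n j (mem_head _ _); rewrite -ij.
have := IH us (map (e n) r ++ t) B' ut' mB' _.
rewrite bigcap_seq_cat bigcap_seq_map big_cat big_map /=.
have -> : \bigcap_(j in [set` r]) (X (e n j) @^-1` B' (e n j)) =
    \bigcap_(j in [set` r]) (X (e n j) @^-1` D j).
  by apply: eq_bigcapr => j _; rewrite B'e.
have -> : \bigcap_(j in [set` t]) (X j @^-1` B' j) = \bigcap_(j in [set` t]) (X j @^-1` B j).
  by apply: eq_bigcapr => i it; rewrite B't.
rewrite setICA -/F => ->; last first.
  move=> n' j n's; rewrite mem_cat negb_or st' // andbT.
  apply/mapP => -[j' _ /einj[nn' _]]; by move: ns; rewrite -nn' n's.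
have -> : (\prod_(j <- r) P (X (e n j) @^-1` B' (e n j)) =
    P (\bigcap_(j in [set` r]) (X (e n j) @^-1` D j)))%E.
  have := iX (map (e n) r) B' uer mB'; rewrite bigcap_seq_map big_map => <-.
  by congr (P _); apply: eq_bigcapr => j _; rewrite B'e.
rewrite PF muleCA; congr (_ * (_ * _))%E.
by rewrite !big_seq; apply: eq_bigr => i it; rewrite B't.
Qed.

Lemma indep_map (I J : countType) (X : I -> T -> R) (e : J -> I) :
  injective e -> indep X -> indep (X \o e).
Proof.
move=> einj iX s B us mB.
pose B' i := if pselect (exists j, e j = i) is left h then B (projT1 (cid h)) else setT.
have B'e j : B' (e j) = B j.
  rewrite /B'; case: pselect => [h|]; last by case; exists j.
  by case: (cid h) => j' /= /einj ->.
have mB' i : measurable (B' i) by rewrite /B'; case: pselect.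
have := iX (map e s) B'; rewrite map_inj_uniq// => /(_ us mB').
rewrite bigcap_seq_map big_map; under eq_bigr do rewrite B'e.
by move=> <-; congr (P _); apply: eq_bigcapr => j _; rewrite /= B'e.
Qed.

Lemma indep_groups (I J : countType) (N : countType) (X : I -> T -> R)
    (e : N -> J -> I) (g : N -> (J -> R) -> R) :
  (forall n n' j j', e n j = e n' j' -> n = n' /\ j = j') ->
  (forall i, measurable_fun setT (X i)) -> indep X ->
  (forall n B, measurable B -> product_measurable (g n @^-1` B)) ->
  indep (fun n w => g n (fun j => X (e n j) w)).
Proof.
move=> einj mX iX mg s B us mB.
have := indep_rows einj mX iX (fun n => mg n (B n) (mB n)) us (t := [::])
  (B := fun=> setT) isT (fun=> measurableT) (fun _ _ _ => isT).
by rewrite set_nil bigcap_set0 setIT big_nil mule1.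
Qed.

End Independence.

Lemma indep_same_law {R : realType} {V : countType} d d' (T : measurableType d)
    (T' : measurableType d') (P : probability T R) (P' : probability T' R)
    (X : V -> T -> R) (Y : V -> T' -> R) :
  (forall v, measurable_fun setT (X v)) -> (forall v, measurable_fun setT (Y v)) ->
  indep P X -> indep P' Y ->
  (forall v B, measurable B -> P (X v @^-1` B) = P' (Y v @^-1` B)) ->
  forall C, product_measurable C -> P [set w | C (X^~ w)] = P' [set w | C (Y^~ w)].
Proof.
move=> mX mY iX iY XY; apply: product_law_unique => // s B us mB.
apply: etrans (iX s B us mB) _; apply: etrans _ (esym (iY s B us mB)).
by apply: eq_bigr => v _; exact: XY.
Qed.

(** * Rotation invariance of standard normal families *)

Section Affine.
Context {R : realType}.
Local Notation mu := (@lebesgue_measure R).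

Definition affine (c d : R) : measurableTypeR R -> measurableTypeR R :=
  fun x => c * x + d.

Lemma measurable_affine c d : measurable_fun setT (affine c d).
Proof.
apply: (@measurable_funD _ _ R setT (fun x => c * x) (fun=> d)) => //.
exact: (@measurable_funM _ _ R setT (fun=> c) id).
Qed.

Lemma lebesgue_affine_gt0 c d (A : set R) : 0 < c -> measurable A ->
  mu A = (c%:E * mu (affine c d @^-1` A))%E.
Proof.
move=> c0 mA; pose m : {measure set (measurableTypeR R) -> \bar R} :=
  mscale (NngNum (ltW c0)) (pushforward mu (affine c d)).
rewrite -[RHS]/(m (measurable_affine c d) A).
apply: lebesgue_measure_unique => // _ [[a b] _ <-].
rewrite -[RHS]/(c%:E * mu (affine c d @^-1` `]a, b]))%E /=.
have -> : affine c d @^-1` `]a, b] = `](a - d) / c, (b - d) / c]%classic.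
  apply/seteqP; split => x; rewrite /= !in_itv /= /affine.
    by rewrite ltr_pdivrMr// ler_pdivlMr// ltrBlDr lerBrDr mulrC.
  by rewrite ltr_pdivrMr// ler_pdivlMr// ltrBlDr lerBrDr mulrC.
rewrite !lebesgue_measure_itv/= !lte_fin ltr_pM2r ?invr_gt0// ltrD2r.
case: ifP => _; last by rewrite mule0.
rewrite -!EFinD -EFinM; congr (_%:E); field; by rewrite gt_eqF.
Qed.

Lemma lebesgue_affine c d (A : set R) : c != 0 -> measurable A ->
  mu A = (`|c|%:E * mu (affine c d @^-1` A))%E.
Proof.
move=> c0 mA; have [c_gt0|] := ltP 0 c; first by rewrite gtr0_norm//; exact: lebesgue_affine_gt0.
rewrite le_eqVlt (negbTE c0)/= => c_lt0; rewrite ltr0_norm//.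
have nc : 0 < - c by rewrite oppr_gt0.
rewrite (@lebesgue_affine_gt0 (- c) d)//; congr (_ * _)%E.
rewrite -lebesgue_measureN; last first.
  by have := measurable_affine (- c) d measurableT mA; rewrite setTI.
by congr (mu _); apply/seteqP; split => x; rewrite /= /affine mulrNN.
Qed.

Lemma ge0_integral_affine c d (f : R -> \bar R) : c != 0 ->
  measurable_fun setT f -> (forall x, 0 <= f x)%E ->
  (\int[mu]_x f x = `|c|%:E * \int[mu]_x f (c * x + d)%R)%E.
Proof.
move=> c0 mf f0; pose nc := NngNum (normr_ge0 c).
pose p : {measure set (measurableTypeR R) -> \bar R} := pushforward mu (affine c d).
pose m := p (measurable_affine c d).
transitivity (\int[mscale nc m]_x f x)%E.
  by apply: eq_measure_integral => A mA _; exact: lebesgue_affine.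
rewrite ge0_integral_mscale//=; congr (_ * _)%E.
by rewrite (ge0_integral_pushforward (measurable_affine c d)).
Qed.

End Affine.

Section StandardNormal.
Context {R : realType}.
Local Notation mu := (@lebesgue_measure R).
Local Notation gamma := (@normal_prob R 0 1).
Local Notation phi := (@normal_pdf R 0 1).

Lemma normal_pdfE0 (s x : R) : s != 0 ->
  normal_pdf 0 s x = normal_peak s * expR (- x ^+ 2 / (s ^+ 2 *+ 2)).
Proof. by move=> s0; rewrite normal_pdfE// /normal_fun subr0. Qed.

Lemma normal_probN (m s : R) : normal_prob m (- s) = normal_prob m s.
Proof.
apply/funext => B; apply: eq_integral => x _; have [->|s0] := eqVneq s 0.
  by rewrite oppr0.
by rewrite !normal_pdfE ?oppr_eq0// /normal_peak /normal_fun sqrrN.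
Qed.

Lemma indic_integral (m s : R) (B : set R) : measurable B ->
  normal_prob m s B = (\int[mu]_x (\1_B x * normal_pdf m s x)%:E)%E.
Proof.
move=> mB; rewrite /normal_prob integral_mkcond; apply: eq_integral => x _.
by rewrite /patch indicE; case: ifP => _; rewrite ?mul1r ?mul0r.
Qed.

Lemma normal_prob_scale (s : R) (B : set R) : s != 0 -> measurable B ->
  gamma ((fun x => s * x) @^-1` B) = normal_prob 0 s B.
Proof.
move=> s0 mB.
have mpre : measurable ((fun x : R => s * x) @^-1` B).
  by rewrite -[X in measurable X]setTI; apply: (@measurable_funM _ _ R setT (fun=> s) id).
rewrite !indic_integral// [RHS](@ge0_integral_affine _ s 0)//; first last.
- by move=> x; rewrite lee_fin mulr_ge0// normal_pdf_ge0.
- apply/measurable_EFinP/measurable_funM => //; exact: measurable_normal_pdf.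
rewrite -ge0_integralZl//=; first last.
- by move=> x _; rewrite lee_fin mulr_ge0// normal_pdf_ge0.
- apply/measurable_EFinP/measurable_funM => /=.
    apply: measurableT_comp => //; exact: (@measurable_affine R s 0).
  by apply: measurableT_comp; [exact: measurable_normal_pdf|exact: (@measurable_affine R s 0)].
apply: eq_integral => x _; rewrite addr0 -EFinM; congr (_%:E).
rewrite mulrCA; congr (_ * _); rewrite !normal_pdfE0 ?oner_neq0// mulrA.
congr (_ * expR _).
  rewrite /normal_peak expr1n mul1r -mulrnAr sqrtrM ?sqr_ge0// sqrtr_sqr invfM mulrA.
  by rewrite divff ?mul1r// normr_eq0.
by rewrite expr1n exprMn; field.
Qed.

(** The joint density is invariant under the rotation. The change of variables is done one
    coordinate at a time, by affine substitutions on the line and Tonelli, which is why [a] must be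
    nonzero. *)
Lemma normal_rotate (a b : R) (B1 B2 : set R) : a != 0 -> a ^+ 2 + b ^+ 2 = 1 ->
  measurable B1 -> measurable B2 ->
  (\int[mu]_x \int[mu]_y
    (\1_B1 (a * x + b * y) * \1_B2 (a * y - b * x) * (phi x * phi y))%:E =
  gamma B1 * gamma B2)%E.
Proof.
move=> a0 ab1 mB1 mB2.
have phi2 x y : phi x * phi y =
    phi (a * x + b * y) * phi (a * y - b * x).
  rewrite !normal_pdfE0// mulrACA [RHS]mulrACA -!expRD; congr (_ * expR _).
  rewrite expr1n -!mulrDl; congr (_ / _).
  by rewrite -[- x ^+ 2 - y ^+ 2]mulr1 -ab1; ring.
pose g x y : R := phi x * phi y.
have g0 x y : 0 <= g x y by rewrite mulr_ge0// normal_pdf_ge0.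
have lin (p q : R) : measurable_fun setT (fun z : R * R => p * z.1 + q * z.2).
  apply: (@measurable_funD _ _ R setT (fun z : R * R => p * z.1) (fun z => q * z.2)).
    by apply: (@measurable_funM _ _ R setT (fun=> p)) => //; exact: measurable_fst.
  by apply: (@measurable_funM _ _ R setT (fun=> q)) => //; exact: measurable_snd.
pose F u v : R := (\1_B1 u * phi u) * (\1_B2 v * phi v).
have F0 u v : 0 <= F u v by rewrite !mulr_ge0// normal_pdf_ge0.
have m1 (B : set R) : measurable B -> measurable_fun setT (fun u => \1_B u * phi u).
  by move=> mB; apply: measurable_funM => //; exact: measurable_normal_pdf.
have mF (p q p' q' k : R) :
    measurable_fun setT (fun z : R * R => (k * F (p * z.1 + q * z.2) (p' * z.1 + q' * z.2))%:E).
  apply/measurable_EFinP; apply: (@measurable_funM _ _ R setT (fun=> k)) => //.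
  apply: measurable_funM.
    by apply: (measurableT_comp (m1 _ mB1)); exact: lin.
  by apply: (measurableT_comp (m1 _ mB2)); exact: lin.
have mF1 (h h' : R -> R) c d c' d' : (forall u, h u = c * u + d) ->
    (forall u, h' u = c' * u + d') -> measurable_fun setT (fun u => (F (h u) (h' u))%:E).
  move=> hE h'E; apply/measurable_EFinP; apply: measurable_funM.
    apply: (measurableT_comp (m1 _ mB1)).
    by rewrite (_ : h = affine c d); [exact: measurable_affine|exact/funext].
  apply: (measurableT_comp (m1 _ mB2)).
  by rewrite (_ : h' = affine c' d'); [exact: measurable_affine|exact/funext].
pose k := `|a^-1|.
have k0 : 0 <= k by exact: normr_ge0.
transitivity (\int[mu]_y \int[mu]_x (F (a * x + b * y) (a * y - b * x))%:E)%E.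
  have := @fubini_tonelli _ _ _ _ R mu mu _ (mF a b (- b) a 1) _.
  rewrite /= => h; rewrite [RHS](_ : _ = \int[mu]_x \int[mu]_y
    (1 * F (a * x + b * y) (- b * x + a * y))%:E)%E.
    apply: eq_integral => x _; apply: eq_integral => y _.
    rewrite phi2 mul1r mulNr [- _ + _]addrC /F; congr (_%:E); ring.
  rewrite h => [|x]; last by rewrite lee_fin mul1r.
  apply: eq_integral => y _; apply: eq_integral => x _.
  by rewrite mul1r mulNr [- _ + _]addrC.
(* Substitute [u = a x + b y] for fixed [y]; as [a^2 + b^2 = 1], the other argument [a y - b x]
   becomes [y / a - (b / a) u]. *)
transitivity (\int[mu]_y \int[mu]_u (k * F (1 * u + 0 * y) ((- b / a) * u + a^-1 * y))%:E)%E.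
  apply: eq_integral => y _; rewrite (@ge0_integral_affine _ a^-1 (- (b * y / a))) ?invr_neq0//.
  - rewrite -ge0_integralZl//=.
    + apply: eq_integral => u _; rewrite -EFinM; congr (_ * F _ _)%:E.
        by field.
      transitivity ((a ^+ 2 + b ^+ 2) * (a^-1 * y) + - b / a * u).
        by field.
      by rewrite ab1 mul1r addrC.
    + by apply: (mF1 _ _ 1 0 (- b / a) (a * y + b * (b * y / a))) => u; field.
    + by move=> x _; rewrite lee_fin.
  - by apply: (mF1 _ _ a (b * y) (- b) (a * y)) => u; ring.
  - by move=> x; rewrite lee_fin.
rewrite -(@fubini_tonelli _ _ _ _ R mu mu _ (mF 1 0 (- b / a) a^-1 k)); last first.
  by move=> z; rewrite lee_fin mulr_ge0.
(* For fixed [u], substitute [v = y / a - (b / a) u]; this absorbs the factor [k]. *)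
transitivity (\int[mu]_u \int[mu]_v (F u v)%:E)%E.
  apply: eq_integral => u _ /=.
  rewrite [RHS](@ge0_integral_affine _ a^-1 (- b / a * u)) ?invr_neq0//; first last.
  - by move=> x; rewrite lee_fin.
  - by apply: (mF1 _ _ 0 u 1 0) => v; ring.
  rewrite -ge0_integralZl//=; first last.
  - by move=> x _; rewrite lee_fin.
  - by apply: (mF1 _ _ 0 u a^-1 (- b / a * u)) => v; ring.
  apply: eq_integral => v _; rewrite -EFinM mul1r mul0r addr0; congr (_ * F _ _)%:E.
  by rewrite addrC.
rewrite !indic_integral//.
transitivity (\int[mu]_u ((\1_B1 u * phi u)%:E * \int[mu]_v (\1_B2 v * phi v)%:E))%E.
  apply: eq_integral => u _; rewrite -ge0_integralZl//.
  - by apply/measurable_EFinP; exact: m1.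
  - by move=> v _; rewrite lee_fin mulr_ge0// normal_pdf_ge0.
  - by rewrite lee_fin mulr_ge0// normal_pdf_ge0.
rewrite ge0_integralZr//.
- by apply/measurable_EFinP; exact: m1.
- by move=> v _; rewrite lee_fin mulr_ge0// normal_pdf_ge0.
- by apply: integral_ge0 => v _; rewrite lee_fin mulr_ge0// normal_pdf_ge0.
Qed.

End StandardNormal.

Section PairRotation.
Context {R : realType}.
Local Notation mu := (@lebesgue_measure R).
Local Notation gamma := (@normal_prob R 0 1).
Local Notation phi := (@normal_pdf R 0 1).

(** The Radon-Nikodym derivative and [phi] have the same integral over every measurable set, hence
    agree almost everywhere. *)
Lemma ge0_integral_normal_prob (f : R -> \bar R) : measurable_fun setT f ->
  (forall x, 0 <= f x)%E ->
  (\int[gamma]_x f x = \int[mu]_x (f x * (phi x)%:E))%E.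
Proof.
move=> mf f0; have dom := normal_prob_dominates (R := R) 0 1.
have mphi : measurable_fun setT (EFin \o phi).
  by apply/measurable_EFinP; exact: measurable_normal_pdf.
rewrite -(Radon_Nikodym_SigmaFinite.change_of_variables dom f0 measurableT mf).
have mRN := measurable_int _ (Radon_Nikodym_SigmaFinite.f_integrable dom).
apply: ae_eq_integral => //.
- exact: emeasurable_funM.
- exact: emeasurable_funM.
- apply: ae_eqe_mul2l; apply: integral_ae_eq => //.
  + exact: Radon_Nikodym_SigmaFinite.f_integrable.
  + by move=> A _ mA; rewrite -Radon_Nikodym_SigmaFinite.f_integral.
Qed.

Lemma normal_pair_rotate d (T : measurableType d) (P : probability T R)
    (Z1 Z2 : T -> R) (a b : R) : a != 0 -> a ^+ 2 + b ^+ 2 = 1 ->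
  measurable_fun setT Z1 -> measurable_fun setT Z2 ->
  (forall A B, measurable A -> measurable B ->
    P (Z1 @^-1` A `&` Z2 @^-1` B) = (gamma A * gamma B)%E) ->
  forall A B, measurable A -> measurable B ->
    P ((fun w => a * Z1 w + b * Z2 w) @^-1` A `&` (fun w => a * Z2 w - b * Z1 w) @^-1` B) =
    (gamma A * gamma B)%E.
Proof.
move=> a0 ab mZ1 mZ2 hZ A B mA mB.
pose h w : measurableTypeR R * measurableTypeR R := (Z1 w, Z2 w).
have mh : measurable_fun setT h by exact: measurable_fun_pair.
pose p : {measure set (measurableTypeR R * measurableTypeR R) -> \bar R} := pushforward P h.
pose D : set (R * R) := (fun z => a * z.1 + b * z.2) @^-1` A `&`
  (fun z => a * z.2 - b * z.1) @^-1` B.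
have lin (k l : R) : measurable_fun setT (fun z : R * R => k * z.1 + l * z.2).
  apply: (@measurable_funD _ _ R setT (fun z : R * R => k * z.1) (fun z => l * z.2)).
    by apply: (@measurable_funM _ _ R setT (fun=> k)) => //; exact: measurable_fst.
  by apply: (@measurable_funM _ _ R setT (fun=> l)) => //; exact: measurable_snd.
have mD : measurable D.
  apply: measurableI; first by have := lin a b measurableT A mA; rewrite setTI.
  have := lin (- b) a measurableT B mB; rewrite setTI.
  by congr (measurable _); apply/seteqP; split => z /=; rewrite mulNr addrC.
transitivity (p mh D) => //.
rewrite -(@product_measure_unique _ _ _ _ R gamma gamma (p mh)) => [||//]; last first.
  by move=> A' B' mA' mB'; rewrite -hZ.
rewrite -(normal_rotate a0 ab mA mB) /product_measure1/=.
rewrite ge0_integral_normal_prob//; last exact: measurable_fun_xsection.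
apply: eq_integral => x _; rewrite indic_integral; last exact: measurable_xsection.
rewrite -ge0_integralZr//; first last.
- by rewrite lee_fin normal_pdf_ge0.
- by move=> y _; rewrite lee_fin mulr_ge0// normal_pdf_ge0.
- apply/measurable_EFinP/measurable_funM; last exact: measurable_normal_pdf.
  by apply: measurable_indic; exact: measurable_xsection.
apply: eq_integral => y _; rewrite -EFinM; congr (_%:E).
transitivity (\1_(xsection D x) y * (phi x * phi y)); first by ring.
congr (_ * _); rewrite !indicE mem_xsection in_setI -natrM mulnb.
by [].
Qed.

End PairRotation.

Definition givens {R : pzRingType} {I : eqType} (i j : I) (a b : R) (z : I -> R) : I -> R :=
  fun k => if k == i then a * z i + b * z j
  else if k == j then a * z j - b * z i else z k.

Definition flip {R : pzRingType} {I : eqType} (i : I) (z : I -> R) : I -> R :=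
  fun k => if k == i then - z k else z k.

Section IidNormal.
Context {R : realType}.
Local Notation gamma := (@normal_prob R 0 1).

Definition act (T I : Type) (O : (I -> R) -> I -> R) (Z : I -> T -> R) : I -> T -> R :=
  fun k w => O (Z^~ w) k.

Definition iidN d (T : measurableType d) (P : probability T R) (I : countType)
    (Z : I -> T -> R) : Prop :=
  [/\ forall i, measurable_fun setT (Z i), indep P Z &
      forall i B, measurable B -> P (Z i @^-1` B) = gamma B].

Lemma iidN_same_law d d' (T : measurableType d) (T' : measurableType d')
    (P : probability T R) (P' : probability T' R) (I : countType)
    (Z : I -> T -> R) (Z' : I -> T' -> R) : iidN P Z -> iidN P' Z' ->
  forall C, product_measurable C -> P [set w | C (Z^~ w)] = P' [set w | C (Z'^~ w)].
Proof.
move=> [mZ iZ nZ] [mZ' iZ' nZ']; apply: indep_same_law => // v B mB.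
by rewrite nZ// nZ'.
Qed.

Context d (T : measurableType d) (P : probability T R) (I : countType).
Implicit Types (Z : I -> T -> R) (X : I -> T -> R).

(** Padding with [setT] changes neither side, so independence may be checked on larger, conveniently
    ordered lists. *)
Lemma indep_widen X (s s' : seq I) (B : I -> set R) : uniq s -> uniq s' ->
  {subset s <= s'} -> (forall v, measurable (B v)) ->
  (forall B', (forall v, measurable (B' v)) ->
    P (\bigcap_(v in [set` s']) (X v @^-1` B' v)) =
      (\prod_(v <- s') P (X v @^-1` B' v))%E) ->
  P (\bigcap_(v in [set` s]) (X v @^-1` B v)) = (\prod_(v <- s) P (X v @^-1` B v))%E.
Proof.
move=> us us' ss' mB h.
have mBB v : measurable (if v \in s then B v else setT) by case: ifP.
have := h _ mBB.
have -> : \bigcap_(v in [set` s']) (X v @^-1` (if v \in s then B v else setT)) =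
    \bigcap_(v in [set` s]) (X v @^-1` B v).
  apply/seteqP; split=> w hw v /= vs.
    by have := hw v (ss' _ vs); rewrite /= vs.
  by case: ifP => // vs''; exact: hw.
move=> ->.
transitivity (\prod_(v <- s' | v \in s) P (X v @^-1` B v))%E.
  rewrite [RHS]big_mkcond; apply: eq_bigr => v _; case: ifP => // _.
  by rewrite preimage_setT probability_setT.
rewrite -big_filter; apply: perm_big; apply: uniq_perm; rewrite ?filter_uniq//.
by move=> v; rewrite mem_filter andb_idr//; exact: ss'.
Qed.

Lemma iidN_givens_ne0 (i j : I) a b Z : i != j -> a != 0 -> a ^+ 2 + b ^+ 2 = 1 ->
  iidN P Z -> iidN P ((act (givens i j a b) Z)).
Proof.
move=> ij a0 ab [mZ iZ nZ].
have mlin (p q : R) k l : measurable_fun setT (fun w => p * Z k w + q * Z l w).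
  apply: measurable_funD; first exact: (measurable_funM (f := fun=> p)).
  exact: (measurable_funM (f := fun=> q)).
have mZi : measurable_fun setT (fun w => a * Z i w + b * Z j w) by exact: mlin.
have mZj : measurable_fun setT (fun w => a * Z j w - b * Z i w).
  by under eq_fun do rewrite -mulNr; exact: mlin.
have mG k : measurable_fun setT ((act (givens i j a b) Z) k).
  by rewrite /act /givens; case: eqP => // _; case: eqP.
have joint (t : seq I) (B : I -> set R) : uniq t -> i \notin t -> j \notin t ->
    (forall v, measurable (B v)) ->
    P (act (givens i j a b) Z i @^-1` B i `&` act (givens i j a b) Z j @^-1` B j `&`
       \bigcap_(v in [set` t]) (Z v @^-1` B v)) =
    (gamma (B i) * gamma (B j) * \prod_(v <- t) gamma (B v))%E.
  (* The pair [(i, j)] forms a single row, indexed by booleans, so that [indep_rows] separates it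
     from the coordinates in [t]. *)
  move=> ut it jt mB; pose e (_ : unit) (c : bool) := if c then i else j.
  pose C (_ : unit) : set (bool -> R) := [set x | B i (a * x true + b * x false) /\
    B j (a * x false - b * x true)].
  have einj n n' c c' : e n c = e n' c' -> n = n' /\ c = c'.
    case: n n' => -[]; case: c c' => -[] //= eij; first by rewrite eij eqxx in ij.
    by rewrite eij eqxx in ij.
  have mC n : product_measurable (C n).
    have mx c := @measurable_coord R bool c.
    have ml (p q : R) c c' : measurable_fun setT
        (fun x : productType R bool => p * (x : bool -> R) c + q * (x : bool -> R) c').
      apply: measurable_funD; first exact: (measurable_funM (f := fun=> p)).
      exact: (measurable_funM (f := fun=> q)).
    rewrite -[product_measurable _]/(measurable (C n : set (productType R bool))).
    apply: measurableI.
      by have := ml a b true false measurableT (B i) (mB i); rewrite setTI.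
    have := ml a (- b) false true measurableT (B j) (mB j); rewrite setTI.
    by congr (measurable _); apply/seteqP; split => x /=; rewrite mulNr.
  have -> : act (givens i j a b) Z i @^-1` B i `&` act (givens i j a b) Z j @^-1` B j =
      [set w | C tt (fun c => Z (e tt c) w)].
    by rewrite /act /givens !eqxx (eq_sym j i) (negbTE ij).
  have := indep_rows einj mZ iZ mC (s := [:: tt]) isT ut mB.
  rewrite bigcap_seq_cons set_nil bigcap_set0 setIT big_seq1 => ->; last first.
    by case=> -[].
  have -> : [set w | C tt (fun c : bool => Z (e tt c) w)] =
    (fun w => a * Z i w + b * Z j w) @^-1` B i `&` (fun w => a * Z j w - b * Z i w) @^-1` B j.
    by [].
  have hZ A D : measurable A -> measurable D ->
      P (Z i @^-1` A `&` Z j @^-1` D) = (gamma A * gamma D)%E.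
    move=> mA mD; pose B' k := if k == i then A else D.
    have mB' k : measurable (B' k) by rewrite /B'; case: ifP.
    have := iZ [:: i; j] B'; rewrite /= inE ij => /(_ isT mB').
    rewrite !bigcap_seq_cons set_nil bigcap_set0 setIT !big_cons big_nil mule1.
    by rewrite !nZ// /B' eqxx eq_sym (negbTE ij).
  rewrite (normal_pair_rotate a0 ab (mZ i) (mZ j) hZ (mB i) (mB j)); congr (_ * _)%E.
  by apply: eq_bigr => v _; rewrite nZ.
have gT : gamma setT = 1%E by exact: probability_setT.
have marg k B : measurable B -> P ((act (givens i j a b) Z) k @^-1` B) = gamma B.
  move=> mB; have mB' l : measurable (if l == k then B else setT) by case: ifP.
  have [ki|ki] := eqVneq k i; last have [kj|kj] := eqVneq k j.
  - have := joint [::] (fun l => if l == k then B else setT) isT isT isT mB'.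
    rewrite set_nil bigcap_set0 setIT big_nil mule1 ki eqxx eq_sym (negbTE ij).
    by rewrite preimage_setT setIT gT mule1.
  - have := joint [::] (fun l => if l == k then B else setT) isT isT isT mB'.
    rewrite set_nil bigcap_set0 setIT big_nil mule1 kj eqxx (negbTE ij).
    by rewrite preimage_setT setTI gT mul1e.
  - by rewrite /act /givens (negbTE ki) (negbTE kj) nZ.
split => // s B us mB.
pose t := [seq v <- undup s | (v != i) && (v != j)].
have ut : uniq t by rewrite filter_uniq// undup_uniq.
have it : i \notin t by rewrite mem_filter eqxx.
have jt : j \notin t by rewrite mem_filter eqxx andbF.
apply: (@indep_widen _ _ [:: i, j & t]) => //.
- by rewrite /= inE negb_or ij it jt.
- move=> v vs; rewrite !inE mem_filter mem_undup vs andbT.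
  by case: (v == i) => //=; case: (v == j).
move=> B' mB'; rewrite !bigcap_seq_cons !big_cons setIA.
have -> : \bigcap_(v in [set` t]) ((act (givens i j a b) Z) v @^-1` B' v) =
    \bigcap_(v in [set` t]) (Z v @^-1` B' v).
  apply: eq_bigcapr => v; rewrite /= mem_filter => /andP[/andP[vi vj] _].
  by rewrite /act /givens (negbTE vi) (negbTE vj).
rewrite joint// !marg// muleA; congr (_ * _)%E.
by apply: eq_bigr => v _; rewrite marg.
Qed.

Lemma iidN_givens (i j : I) a b Z : i != j -> a ^+ 2 + b ^+ 2 = 1 ->
  iidN P Z -> iidN P ((act (givens i j a b) Z)).
Proof.
move=> ij ab iZ; have [a0|] := eqVneq a 0; last by move=> a0; exact: iidN_givens_ne0.
(* A quarter turn is the composite of two eighth turns. *)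
pose c : R := Num.sqrt 2^-1.
have c2 : c ^+ 2 = 2^-1 by rewrite sqr_sqrtr.
have c0 : c != 0 by rewrite sqrtr_eq0 -ltNge invr_gt0.
have b2 : b ^+ 2 = 1 by move: ab; rewrite a0 expr0n add0r.
have cb : c ^+ 2 + (c * b) ^+ 2 = 1 by rewrite exprMn b2 mulr1 c2; lra.
have := iidN_givens_ne0 ij c0 cb (iidN_givens_ne0 ij c0 cb iZ).
congr (iidN P _); apply/funext => k; apply/funext => w; rewrite /act /givens a0.
rewrite !eqxx (eq_sym j i) (negbTE ij).
have cc : c * c = 2^-1 by rewrite -expr2.
have bb : b * b = 1 by rewrite -expr2.
case: eqP => _; last case: eqP => _ //.
- transitivity (c * c * (1 - b * b) * Z i w + 2 * (c * c) * b * Z j w); first by ring.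
  by rewrite bb cc; field.
- transitivity (c * c * (1 - b * b) * Z j w - 2 * (c * c) * b * Z i w); first by ring.
  by rewrite bb cc; field.
Qed.

Lemma iidN_flip (i : I) Z : iidN P Z -> iidN P (act (flip i) Z).
Proof.
move=> [mZ iZ nZ].
have mN B : measurable B -> measurable ((-%R : R -> R) @^-1` B).
  by move=> mB; rewrite -[X in measurable X]setTI; exact: oppr_measurable.
have flipE k B : act (flip i) Z k @^-1` B =
    Z k @^-1` (if k == i then (-%R : R -> R) @^-1` B else B).
  by rewrite /act /flip; case: (k == i).
have mf (k : I) B : measurable B -> measurable (if k == i then (-%R : R -> R) @^-1` B else B).
  by move=> mB; case: ifP => // _; exact: mN.
split.
- by move=> k; rewrite /act /flip; case: eqP => // _; exact: measurableT_comp.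
- move=> s B us mB.
  have -> : \bigcap_(v in [set` s]) (act (flip i) Z v @^-1` B v) = \bigcap_(v in [set` s])
      (Z v @^-1` (if v == i then (-%R : R -> R) @^-1` B v else B v)).
    by apply: eq_bigcapr => v _; rewrite flipE.
  rewrite (iZ s _ us (fun v => mf v (B v) (mB v))).
  by apply: eq_bigr => v _; rewrite flipE.
- move=> k B mB; rewrite flipE nZ; last exact: mf.
  case: ifP => // _.
  have N1 : (-1 : R) != 0 by rewrite oppr_eq0 oner_neq0.
  have := normal_prob_scale N1 mB; rewrite normal_probN => <-.
  by congr (gamma _); apply/seteqP; split => x /=; rewrite mulN1r.
Qed.

End IidNormal.

(** * Orthogonal transformations preserving standard normal families *)

Section GaussOp.
Context {R : realType} d (T : measurableType d) (P : probability T R).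
Implicit Types (x y z u : nat -> R) (O : (nat -> R) -> nat -> R) (Z : nat -> T -> R).

(** An orthogonal map with its adjoint [O']. Adjointness and inversion allow an arbitrary sequence
    [z], because samples of [Z] are not finitely supported. *)
Record half_gauss_op O O' : Prop := HalfGaussOp {
  gopB : forall x y, O (x - y) = O x - O y;
  gop_fsupp : forall x, fsupp x -> fsupp (O x);
  gop_adj : forall x z, fsupp x -> ip (O x) z = ip x (O' z);
  gopK : forall z, O' (O z) = z;
  gop_iidN : forall Z, iidN P Z -> iidN P (act O Z) }.

Definition gauss_op O O' := half_gauss_op O O' /\ half_gauss_op O' O.

Lemma gauss_op_sym O O' : gauss_op O O' -> gauss_op O' O.
Proof. by case. Qed.

Lemma gauss_op_id : gauss_op id id.
Proof. by split; split. Qed.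

Lemma half_gauss_op_comp O1 O1' O2 O2' : half_gauss_op O1 O1' -> half_gauss_op O2 O2' ->
  half_gauss_op (O1 \o O2) (O2' \o O1').
Proof.
move=> h1 h2; split => /=.
- by move=> x y; rewrite (gopB h2) (gopB h1).
- by move=> x fx; apply: (gop_fsupp h1); exact: (gop_fsupp h2).
- move=> x z fx; rewrite (gop_adj h1); last exact: (gop_fsupp h2).
  exact: (gop_adj h2).
- by move=> z; rewrite (gopK h1) (gopK h2).
- by move=> Z iZ; exact: (gop_iidN h1 (gop_iidN h2 iZ)).
Qed.

Lemma gauss_op_comp O1 O1' O2 O2' : gauss_op O1 O1' -> gauss_op O2 O2' ->
  gauss_op (O1 \o O2) (O2' \o O1').
Proof. by move=> [h1 h1'] [h2 h2']; split; exact: half_gauss_op_comp. Qed.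

(** A finite rank perturbation of the identity, so finite support and adjointness reduce to inner
    products with point masses. *)
Lemma givensE (i j : nat) (a b : R) z : i != j -> givens i j a b z =
  z + (a * z i + b * z j - z i) *: (delta i : nat -> R)
    + (a * z j - b * z i - z j) *: (delta j : nat -> R).
Proof.
move=> ij; apply/funext => k; rewrite /givens.
transitivity (z k + (a * z i + b * z j - z i) * (k == i)%:R
    + (a * z j - b * z i - z j) * (k == j)%:R) => //.
have [->|ki] := eqVneq k i; first by rewrite (negbTE ij) mulr1 mulr0; ring.
have [->|kj] := eqVneq k j; first by rewrite mulr1 mulr0; ring.
by rewrite !mulr0 !addr0.
Qed.

Lemma half_gauss_op_givens (i j : nat) (a b : R) : i != j -> a ^+ 2 + b ^+ 2 = 1 ->
  half_gauss_op (givens i j a b) (givens i j a (- b)).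
Proof.
move=> ij ab; have fd k := fsupp_delta (R := R) (k : nat).
have fz k c := fsuppZ c (fd k).
split.
- move=> x y; apply/funext => k; rewrite /givens !addrfctE !opprfctE.
  case: eqP => _; first by ring.
  by case: eqP => _ //; ring.
- move=> x fx; rewrite givensE//; apply: fsuppD => //; exact: fsuppD.
- move=> x z fx; rewrite !givensE// !ipDl// ?ipDr//; last exact: fsuppD.
  by rewrite !ipZl !ipZr !ip_delta [ip x (delta i)]ipC [ip x (delta j)]ipC !ip_delta; ring.
- move=> z; apply/funext => k; rewrite /givens !eqxx (eq_sym j i) (negbTE ij).
  case: eqP => [->|_].
    by transitivity ((a ^+ 2 + b ^+ 2) * z i); [ring|rewrite ab mul1r].
  case: eqP => [->|_] //.
  by transitivity ((a ^+ 2 + b ^+ 2) * z j); [ring|rewrite ab mul1r].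
- by move=> Z; exact: iidN_givens.
Qed.

Lemma gauss_op_givens (i j : nat) (a b : R) : i != j -> a ^+ 2 + b ^+ 2 = 1 ->
  gauss_op (givens i j a b) (givens i j a (- b)).
Proof.
move=> ij ab; split; first exact: half_gauss_op_givens.
by rewrite -{2}[b]opprK; apply: half_gauss_op_givens; rewrite ?sqrrN.
Qed.

Lemma flipE (i : nat) z : flip i z = z - (2 * z i) *: (delta i : nat -> R).
Proof.
apply/funext => k; rewrite /flip.
transitivity (z k - 2 * z i * (k == i)%:R) => //.
have [->|_] := eqVneq k i; first by rewrite mulr1; ring.
by rewrite mulr0 subr0.
Qed.

Lemma gauss_op_flip (i : nat) : gauss_op (flip i) (flip i).
Proof.
have fd := fsupp_delta (R := R) (i : nat); have fz c := fsuppZ c fd.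
suff : half_gauss_op (flip i) (flip i) by [].
split.
- by move=> x y; apply/funext => k; rewrite /flip !addrfctE !opprfctE; case: eqP => _; ring.
- by move=> x fx; rewrite flipE; exact: fsuppB.
- move=> x z fx; rewrite !flipE ipBl// ipBr// ipZl ipZr ip_delta [ip x (delta i)]ipC ip_delta; ring.
- by move=> z; apply/funext => k; rewrite /flip; case: eqP; rewrite ?opprK.
- by move=> Z; exact: iidN_flip.
Qed.

Lemma gop_ip O O' x y : gauss_op O O' -> fsupp x -> ip (O x) (O y) = ip x y.
Proof. by move=> [h h'] fx; rewrite (gop_adj h)// (gopK h). Qed.

(** Rotations in the planes of coordinates 0 and [N] move the entries of [x] into coordinate 0,
    starting from the last one. *)
Lemma gauss_op_axis x : fsupp x ->
  exists O O', gauss_op O O' /\ forall k, (0 < k)%N -> O x k = 0.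
Proof.
move=> /fsuppP[s _ xs].
suff h N : forall x, (forall k, (N < k)%N -> x k = 0) ->
    exists O O', gauss_op O O' /\ forall k, (0 < k)%N -> O x k = 0.
  (* The sum of the indices in the support bounds each of them. *)
  apply: (h (\sum_(i <- s) i)%N) => k sk; apply: xs; apply: contraTN sk => ks.
  by rewrite -leqNgt (big_rem k)//= leq_addr.
elim: N => {x xs} [|N IH] x xN; first by exists id, id; split; [exact: gauss_op_id|].
pose a0 := x 0%N; pose b0 := x N.+1.
have [r0|r0] := eqVneq (a0 ^+ 2 + b0 ^+ 2) 0.
  apply: IH => k; rewrite leq_eqVlt => /predU1P[<-|]; last exact: xN.
  by apply/eqP; rewrite -sqrf_eq0; move: r0 => /eqP; rewrite paddr_eq0 ?sqr_ge0// => /andP[].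
have r_gt0 : 0 < a0 ^+ 2 + b0 ^+ 2 by rewrite lt_neqAle eq_sym r0 addr_ge0// sqr_ge0.
pose r := Num.sqrt (a0 ^+ 2 + b0 ^+ 2).
have rn0 : r != 0 by rewrite sqrtr_eq0 -ltNge.
have ab : (a0 / r) ^+ 2 + (b0 / r) ^+ 2 = 1.
  by rewrite !expr_div_n -mulrDl sqr_sqrtr ?ltW// divff.
have g := @gauss_op_givens 0%N N.+1 _ _ isT ab.
set G := givens _ _ _ _ in g.
have [k|O [ O' [gO OG]]] := IH (G x); last first.
    exists (O \o G), (givens 0%N N.+1 (a0 / r) (- (b0 / r)) \o O').
    by split => //; exact: gauss_op_comp.
  rewrite /G /givens; case: k => [//|k]; rewrite /= ltnS leq_eqVlt eqSS eq_sym.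
  case: eqP => [_ _|_ /= Nk]; last exact: xN.
  by rewrite -/a0 -/b0; field.
Qed.

(** The reflection in the hyperplane orthogonal to [x - y]: [W] takes [x - y] to the first axis,
    where the reflection is a sign flip, and [W'] carries back. *)
Lemma gauss_op_reflect x y : fsupp x -> fsupp y -> ip x x = ip y y ->
  exists O O', [/\ gauss_op O O', O x = y &
    forall z, fsupp z -> ip z (x - y) = 0 -> O z = z].
Proof.
move=> fx fy xy; have fxy : fsupp (x - y) by exact: fsuppB.
have [W [W' [gW Wxy]]] := gauss_op_axis fxy.
have [xyE|xyN] := eqVneq x y.
  by exists id, id; split => //; exact: gauss_op_id.
have hW := gW.1; have hW' := gW.2.
exists (W' \o (flip 0%N \o W)), ((W' \o flip 0%N) \o W).
have WE k : (0 < k)%N -> W x k = W y k.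
  by move=> k0; apply/eqP; rewrite -subr_eq0 -[X in X == _]/((W x - W y) k) -(gopB hW) Wxy.
have fWx := gop_fsupp hW fx; have fWy := gop_fsupp hW fy.
pose s := W (x - y) 0%N.
have WxyE : W (x - y) = s *: (delta 0%N : nat -> R).
  apply/funext => k; transitivity (s * (k == 0%N)%:R) => //.
  by case: k => [|k]; rewrite ?mulr1// mulr0 Wxy.
have s0 : s != 0.
  apply: contra_neq xyN => s0; apply/eqP; rewrite -subr_eq0; apply/eqP.
  rewrite -[LHS](gopK hW) WxyE s0 scale0r -[X in W' X](subrr 0) (gopB hW').
  exact: subrr.
have Wx0 : W x 0%N = W y 0%N + s.
  by rewrite /s (gopB hW) -[(W x - W y) _]/(W x 0%N - W y 0%N) addrC subrK.
split.
- exact: (gauss_op_comp (gauss_op_sym gW) (gauss_op_comp (gauss_op_flip 0%N) gW)).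
- rewrite /= -[RHS](gopK hW); congr W'; apply/funext => -[|k]; last first.
    by rewrite /flip /= WE.
  have : ip (W x) (W x) = ip (W y) (W y) by rewrite !(gop_ip _ gW).
  have -> : W x = W y + s *: (delta 0%N : nat -> R).
    by rewrite -WxyE (gopB hW) addrC subrK.
  have fd := fsupp_delta (R := R) 0%N; have fz := fsuppZ s fd.
  have fWd : fsupp (W y + s *: (delta 0%N : nat -> R)) by exact: fsuppD.
  rewrite ipDl// !ipDr// !ipZl !ipZr !ip_delta [ip (W y) (delta _)]ipC ip_delta.
  have d00 : (delta 0%N : nat -> R) 0%N = 1 by rewrite /delta eqxx.
  rewrite d00 => E.
  (* [W x] and [W y] differ only in coordinate 0, by [s]. Equal norms then force opposite entries
     there, which the flip exchanges. *)
  have /eqP : s * (2 * W y 0%N + s) = 0 by move: E; lra.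
  rewrite mulf_eq0 (negbTE s0)/= => /eqP E'.
  rewrite /flip eqxx -[(W y + _) 0%N]/(W y 0%N + s * (0%N == 0%N :> nat)%:R) eqxx mulr1.
  by move: E'; lra.
- move=> z fz zxy; rewrite /= -[RHS](gopK hW); congr W'.
  have : ip (W z) (W (x - y)) = 0 by rewrite (gop_ip _ gW).
  rewrite WxyE ipZr ipC ip_delta => /eqP; rewrite mulf_eq0 (negbTE s0)/= => /eqP z0.
  by apply/funext => -[|k]; rewrite /flip //= z0 oppr0.
Qed.

(** One vertex at a time: the reflection taking [O (x v)] to [y v] fixes every [y u] already
    reached, since equal Gram matrices make [y u] orthogonal to [O (x v) - y v]. *)
Lemma gauss_op_match (V : eqType) (x y : V -> nat -> R) (s : seq V) :
  (forall v, fsupp (x v)) -> (forall v, fsupp (y v)) ->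
  (forall u v : V, ip (x u) (x v) = ip (y u) (y v)) ->
  exists O O', gauss_op O O' /\ forall v, v \in s -> O (x v) = y v.
Proof.
move=> fx fy xy; elim: s => [|v s [ O [ O' [gO Ox]]]].
  by exists id, id; split => //; exact: gauss_op_id.
have fOx : fsupp (O (x v)) by exact: (gop_fsupp gO.1).
have [|W [W' [gW Wx Wz]]] := gauss_op_reflect fOx (fy v).
  by rewrite (gop_ip _ gO).
exists (W \o O), (O' \o W'); split; first exact: gauss_op_comp.
move=> u; rewrite inE => /predU1P[->//|us] /=.
have fOu : fsupp (O (x u)) by exact: (gop_fsupp gO.1).
rewrite Wz//; first exact: Ox.
by rewrite ipBr// (gop_ip _ gO)// Ox// xy subrr.
Qed.

End GaussOp.

Section LinearCombinations.
Context {R : realType}.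
Implicit Types (x y : nat -> R).

Definition comb (T : Type) x (Z : nat -> T -> R) : T -> R := fun w => ip x (Z^~ w).

Lemma measurable_comb d (T : measurableType d) x (Z : nat -> T -> R) : fsupp x ->
  (forall k, measurable_fun setT (Z k)) -> measurable_fun setT (comb x Z).
Proof.
move=> /fsuppP[s us xs] mZ; rewrite /comb; under eq_fun do rewrite (ip_seq _ us xs).
by apply: measurable_sum => k; apply: (measurable_funM (f := fun=> x k)).
Qed.

Lemma comb_gauss_op d (T : measurableType d) (P : probability T R) O O' x
    (Z : nat -> T -> R) :
  gauss_op P O O' -> fsupp x -> comb (O x) Z = comb x (act O' Z).
Proof. by move=> [h _] fx; apply/funext => w; rewrite /comb (gop_adj h). Qed.

(* An orthogonal transformation takes [x] to [y] on any finite set of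
   vertices, and standard normal families are invariant under it. *)
Lemma comb_same_law d (T : measurableType d) (P : probability T R) (V : countType)
    (x y : V -> nat -> R) (Z : nat -> T -> R) : iidN P Z ->
  (forall v, fsupp (x v)) -> (forall v, fsupp (y v)) ->
  (forall u v, ip (x u) (x v) = ip (y u) (y v)) ->
  forall C, product_measurable C ->
    P [set w | C (fun v => comb (x v) Z w)] = P [set w | C (fun v => comb (y v) Z w)].
Proof.
move=> iZ fx fy xy; have [mZ _ _] := iZ.
apply: (@product_law_unique _ _ _ _ _ _ P P (fun v => comb (x v) Z)
  (fun v => comb (y v) Z)) => [v|v|s B us mB]; do ?exact: measurable_comb.
have [ O [ O' [gO Ox]]] := gauss_op_match P s fx fy xy.
have iOZ : iidN P (act O' Z) by exact: (gop_iidN gO.2).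
pose C : set (nat -> R) := [set z | forall v, v \in s -> B v (ip (x v) z)].
have mC : product_measurable C.
  have mc v : measurable_fun setT (fun z : productType R nat => ip (x v) (z : nat -> R)).
    have [t ut xt] := fsuppP (fx v).
    apply: (eq_measurable_fun
        (fun z : productType R nat => \sum_(k <- t) x v k * (z : nat -> R) k)).
      by move=> z _; rewrite (ip_seq _ ut xt).
    apply: measurable_sum => k; apply: (measurable_funM (f := fun=> x v k)) => //.
    exact: measurable_coord.
  rewrite -[product_measurable _]/(measurable (C : set (productType R nat))).
  have -> : C = \bigcap_(v in [set` s]) ((fun z => ip (x v) z) @^-1` B v).
    by apply/seteqP; split => z h v; exact: h.
  apply: (@fin_bigcap_measurable _ (productType R nat)); first exact: finite_seq.
  by move=> v _; have := mc v measurableT (B v) (mB v); rewrite setTI.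
transitivity (P [set w | C (Z^~ w)]).
  by congr (P _); apply/seteqP; split => w h v; exact: h.
(* Replacing [Z] by [act O' Z] keeps the law and, by adjointness, turns the combinations with [x v]
   into those with [O (x v) = y v]. *)
rewrite (iidN_same_law iZ iOZ mC); congr (P _); apply/seteqP; split => w h v vs.
  by have := h v vs; rewrite /= -(Ox v vs) (comb_gauss_op _ gO).
by have := h v vs; rewrite /= -(Ox v vs) (comb_gauss_op _ gO).
Qed.

(** A rotation takes [x] to [s *: delta 0], so the combination is [s] times one coordinate of a
    standard normal family. Only the square of [s] is prescribed; [s] may vanish or be negative. *)
Lemma comb_normal d (T : measurableType d) (P : probability T R) x
    (Z : nat -> T -> R) : iidN P Z -> fsupp x ->
  exists2 s, s ^+ 2 = ip x x & exists2 W : T -> R, measurable_fun setT W &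
    (forall B, measurable B -> P (W @^-1` B) = normal_prob 0 1 B) /\
    comb x Z = fun w => s * W w.
Proof.
move=> iZ fx; have [ O [ O' [gO Ox]]] := gauss_op_axis P fx.
have OxE : O x = O x 0%N *: (delta 0%N : nat -> R).
  apply/funext => k; transitivity (O x 0%N * (k == 0%N)%:R) => //.
  by case: k => [|k]; rewrite ?mulr1// mulr0 Ox.
have [mW _ nW] := gop_iidN gO.1 iZ.
exists (O x 0%N).
  by rewrite -(gop_ip _ gO)// OxE ipZl ip_delta -OxE expr2.
exists (act O Z 0%N) => //; split; first exact: nW.
apply/funext => w; rewrite /comb -[in LHS](gopK gO.1 x) (gop_adj gO.2); last first.
  exact: (gop_fsupp gO.1).
by rewrite {1}OxE ipZl ip_delta.
Qed.

End LinearCombinations.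

(** * Existence of independent standard normals *)

Lemma eq_probability_ray {R : realType} (m1 m2 : probability (measurableTypeR R) R) :
  (forall x : R, m1 `]x, +oo[%classic = m2 `]x, +oo[%classic) ->
  forall A : set R, measurable A -> m1 A = m2 A.
Proof.
move=> h A mA.
apply: (@measure_unique _ R (measurableTypeR R) (@RGenOInfty.G R)
  (fun n => `](- n%:R)%R, +oo[%classic) _ _ _ _ m1 m2) => //.
- exact: RGenOInfty.measurableE.
- move=> _ _ [x ->] [y ->]; exists (Num.max x y); apply/seteqP; split => z /=;
    by rewrite !in_itv /= !andbT gt_max => /andP.
- by move=> n; exists (- n%:R).
- apply/seteqP; split => // z _; exists (Num.bound `|z|) => //=.
  rewrite in_itv /= andbT ltrNl; apply: le_lt_trans (archi_boundP (normr_ge0 z)).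
  by rewrite -normrN ler_norm.
- by move=> _ [x ->]; exact: h.
- by move=> n; rewrite ltey_eq fin_num_measure.
Qed.

Section Quantile.
Context {R : realType}.
Local Notation mu := (@lebesgue_measure R).
Variable nu : probability (measurableTypeR R) R.

Local Notation U := (uniform_prob (@ltr01 R)).

(** The half-open interval is the convenient support: the doubling map sends it to itself, and 1/2
    cuts it into two half-open halves. *)
Lemma uniform01E (A : set R) : measurable A -> U A = mu (A `&` `[0, 1[%classic).
Proof.
move=> mA; rewrite /uniform_prob integral_uniform_pdf.
rewrite (eq_integral (cst 1%E)); last first.
  move=> x; rewrite inE => -[_ /=]; rewrite in_itv /= /uniform_pdf => ->.
  by rewrite subr0 invr1.
rewrite integral_cst ?mul1e; last exact: measurableI.
have -> : A `&` `[0, 1]%classic = (A `&` `[0, 1[%classic) `|` (A `&` [set 1]).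
  by rewrite -setIUr setUitv1// bnd_simp.
apply: measureU0; [exact: measurableI|exact: measurableI|].
apply: (@subset_measure0 _ (measurableTypeR R) R mu _ [set (1 : R)]) => //.
  exact: measurableI.
exact: lebesgue_measure_set1.
Qed.

Definition dist (t : R) : R := fine (nu `]-oo, t]%classic).

Definition quantile (u : R) : R :=
  if 0 < u < 1 then sup [set t | dist t < u] else 0.

Let idR : measurableTypeR R -> R := idfun.
Let midR : isMeasurableFun _ _ _ _ idR :=
  isMeasurableFun.Build _ _ _ _ idR (@measurable_id _ _ setT).
Let X : {RV nu >-> R} := HB.pack idR midR.

Let distE t : (dist t)%:E = cdf X t.
Proof. by rewrite /dist fineK// fin_num_measure. Qed.

Lemma dist_ge0 t : 0 <= dist t. Proof. by rewrite fine_ge0. Qed.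

Lemma dist_le1 t : dist t <= 1.
Proof. by rewrite -lee_fin distE cdf_le1. Qed.

Lemma dist_le s t : s <= t -> dist s <= dist t.
Proof. by move=> st; rewrite -lee_fin !distE cdf_nondecreasing. Qed.

(** Right continuity of [dist] gives the strict equivalence: if [dist x < u], the same holds
    slightly to the right of [x], so the supremum exceeds [x]. *)
Lemma quantile_gt x u : 0 < u < 1 -> (x < quantile u) = (dist x < u).
Proof.
move=> u01; rewrite /quantile u01; have /andP[u0 u1] := u01.
have A0 : [set t | dist t < u] !=set0.
  have c0 : dist @ -oo --> (0 : R) by exact/fine_cvg/(cvg_cdfNy0 X).
  by have /cvgr_lt/(_ u u0)/filter_ex[t tu] := c0; exists t.
have Aub : has_ubound [set t | dist t < u].
  have c1 : dist @ +oo --> (1 : R) by exact/fine_cvg/(cvg_cdfy1 X).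
  have /cvgr_gt/(_ u u1)/filter_ex[y uy] := c1; exists y => t /= tu.
  by rewrite leNgt; apply: contraTN tu => /ltW/dist_le yt; rewrite -leNgt (le_trans _ yt)// ltW.
apply/idP/idP.
  move=> /(sup_gt A0)[t /= tu xt]; apply: le_lt_trans tu; exact/dist_le/ltW.
move=> xu.
have [t xt tu] : exists2 t, x < t & dist t < u.
  have cr : dist t @[t --> x^'+] --> dist x.
    by apply: fine_cvg; rewrite distE; exact: (@cdf_right_continuous _ _ _ _ X x).
  have h : \forall t \near x^'+, x < t /\ dist t < u.
    near=> t; split; near: t; first exact: nbhs_right_gt.
    by have /cvgr_lt/(_ u xu) := cr.
  by have [t []] := filter_ex h; exists t.
by apply: lt_le_trans xt _; apply: ub_le_sup.
Unshelve. all: by end_near. Qed.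

Lemma quantile_preimage x : quantile @^-1` `]x, +oo[ =
  (`]0, 1[ `&` `]dist x, +oo[) `|` (if x < 0 then ~` `]0, 1[ else set0).
Proof.
apply/seteqP; split => u.
  rewrite /= in_itv /= andbT; have [u01|u01] := boolP (0 < u < 1).
    by rewrite quantile_gt// => xu; left; split; rewrite /= in_itv /= ?andbT.
  rewrite /quantile (negbTE u01) => x0; right; rewrite x0 /= in_itv /=.
  exact/negP.
rewrite [X in _ -> X]/= in_itv /= andbT; case=> [[]|].
  by rewrite /= !in_itv /= andbT => u01; rewrite quantile_gt.
case: ifP => // x0; rewrite /= in_itv /= => /negP u01.
by rewrite /quantile (negbTE u01).
Qed.

Lemma measurable_quantile : measurable_fun setT quantile.
Proof.
apply: (measurability _ (RGenOInfty.measurableE R)) => // _ [_ [x ->] <-].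
rewrite setTI quantile_preimage; apply: measurableU.
  by apply: measurableI; exact: measurable_itv.
by case: ifP => // _; apply: measurableC; exact: measurable_itv.
Qed.

Lemma quantile_law (B : set R) : measurable B -> U (quantile @^-1` B) = nu B.
Proof.
move=> mB; pose Q : measurableTypeR R -> measurableTypeR R := quantile.
pose mQ : isMeasurableFun _ _ _ _ Q := isMeasurableFun.Build _ _ _ _ Q measurable_quantile.
pose Y : {RV U >-> measurableTypeR R} := HB.pack Q mQ.
apply: (@eq_probability_ray _ (distribution U Y) nu) => // x.
rewrite /distribution /pushforward /= -[Q @^-1` _]/(quantile @^-1` _).
have mp : measurable (quantile @^-1` `]x, +oo[).
  by rewrite -[X in measurable X]setTI; apply: measurable_quantile.
rewrite uniform01E//.
have -> : nu `]x, +oo[%classic = (1 - dist x)%:E.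
  rewrite -(setCitvl (BRight x)) probability_setC//.
  by rewrite EFinB distE.
have -> : (1 - dist x)%:E = mu `]dist x, 1[%classic.
  rewrite lebesgue_measure_itv/= lte_fin; case: ltP => h; first by rewrite EFinB.
  suff -> : dist x = 1 by rewrite subrr.
  by apply/le_anti; rewrite dist_le1 h.
rewrite quantile_preimage setIUl.
have -> : `]0, 1[ `&` `]dist x, +oo[ `&` `[0, 1[ = `]dist x, 1[%classic :> set R.
  have := dist_ge0 x; move: (dist x) => y y0; apply/seteqP; split => u.
    by move=> [[_ +] +]; rewrite /= !in_itv /= andbT => -> /andP[].
  rewrite /= in_itv /= => /andP[yu u1]; have u0 := le_lt_trans y0 yu.
  by rewrite !in_itv /= yu u1 u0 (ltW u0).
set N := (if _ then _ else _).
have mN : measurable N.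
  by rewrite /N; case: ifP => // _; apply: measurableC; exact: measurable_itv.
(* The default value of [quantile] outside the open unit interval matters here only at the point
   0. *)
apply: measureU0; [exact: measurable_itv|exact: measurableI|].
apply: (@subset_measure0 _ (measurableTypeR R) R mu _ [set (0 : R)]) => //.
- exact: measurableI.
- move=> u [+]; rewrite /N; case: ifP => // _; rewrite /= !in_itv /= => /negP.
  rewrite negb_and -leNgt -leNgt => /orP[u0|u1] /andP[u0' u1'].
    by apply/le_anti; rewrite u0 u0'.
  by move: u1; rewrite leNgt u1'.
- exact: lebesgue_measure_set1.
Qed.

End Quantile.

(** * Independent bits from the doubling map *)

Section Digits.
Context {R : realType}.
Local Notation mu := (@lebesgue_measure R).
Local Notation U := (uniform_prob (@ltr01 R)).

Definition doubling (x : R) : R := if x < 2^-1 then 2 * x else 2 * x - 1.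

Definition digit (k : nat) (x : R) : R := (2^-1 <= iter k doubling x)%R%:R.

Lemma measurable_half : measurable_fun setT (fun x : R => x < 2^-1).
Proof. by apply: measurable_fun_ltr. Qed.

Lemma measurable_doubling : measurable_fun setT doubling.
Proof.
apply: measurable_fun_if => //; first exact: measurable_half.
by apply: measurable_funTS; exact: (measurable_affine 2 (-1)).
Qed.

Lemma measurable_digit k : measurable_fun setT (digit k).
Proof.
have mi : measurable_fun setT (iter k doubling).
  elim: k => [|k IH]; first exact: measurable_id.
  exact: (measurableT_comp measurable_doubling IH).
have -> : digit k = fun x => if 2^-1 <= iter k doubling x then 1 else 0.
  by apply/funext => x; rewrite /digit; case: ifP.
by apply: measurable_fun_if => //; exact: measurable_fun_ler.
Qed.

Lemma doubling_half (E : set R) : measurable E ->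
  mu (doubling @^-1` E `&` `[0, 2^-1[) = (2^-1%:E * U E)%E /\
  mu (doubling @^-1` E `&` `[2^-1, 1[) = (2^-1%:E * U E)%E.
Proof.
move=> mE; rewrite uniform01E//.
have mE1 : measurable (E `&` `[0, 1[) by apply: measurableI => //; exact: measurable_itv.
have h d : mu (affine 2 d @^-1` (E `&` `[0, 1[)) = (2^-1%:E * mu (E `&` `[0%R, 1%R[))%E.
  by rewrite [in RHS](@lebesgue_affine_gt0 _ 2 d (E `&` `[0, 1[))// muleA -EFinM mulVf// mul1e.
rewrite -{1}(h 0) -(h (-1)); split; congr (mu _); apply/seteqP; split => x;
  rewrite /= !in_itv /= /doubling /affine.
- move=> [Ex /andP[x0 x2]]; rewrite x2 in Ex; rewrite addr0; split => //.
  by apply/andP; split; lra.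
- rewrite addr0 => -[Ex /andP[x0 x1]]; have x2 : x < 2^-1 by lra.
  split; first by rewrite x2.
  by apply/andP; split; lra.
- move=> [Ex /andP[x0 x2]]; rewrite ltNge x0 /= in Ex; split => //.
  by apply/andP; split; lra.
- move=> [Ex /andP[x0 x1]]; have x2 : 2^-1 <= x by lra.
  split; first by rewrite ltNge x2.
  by apply/andP; split; lra.
Qed.

(** On each half of the unit interval the first digit is constant and [doubling] is affine onto the
    whole interval. So [doubling] preserves the uniform law and is independent of the first
    digit. *)
Lemma digit0_doubling (B E : set R) : measurable B -> measurable E ->
  U (digit 0 @^-1` B `&` doubling @^-1` E) = (U (digit 0 @^-1` B) * U E)%E.
Proof.
move=> mB mE.
have main F : measurable F -> U (digit 0 @^-1` B `&` doubling @^-1` F) =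
   (((0 \in B)%:R / 2 + (1 \in B)%:R / 2)%:E * U F)%E.
  move=> mF.
  have mdF : measurable (doubling @^-1` F).
    by rewrite -[X in measurable X]setTI; exact: measurable_doubling.
  have md : measurable (digit 0 @^-1` B).
    by rewrite -[X in measurable X]setTI; exact: measurable_digit.
  rewrite uniform01E; last exact: measurableI.
  have -> : `[0, 1[%classic = `[0, 2^-1[%classic `|` `[2^-1, 1[%classic :> set R.
    apply/seteqP; split => x; rewrite /= !in_itv /=.
      move=> /andP[x0 x1]; have [h|h] := ltP x 2^-1; [left|right]; by apply/andP.
    by move=> [|] /andP[x0 x1]; apply/andP; split => //; lra.
  rewrite setIUr measureU//=; last 3 first.
  - by apply: measurableI; [exact: measurableI|exact: measurable_itv].
  - by apply: measurableI; [exact: measurableI|exact: measurable_itv].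
  - apply/seteqP; split => // x [[_ +] [_]]; rewrite /= !in_itv /=.
    by move=> /andP[_ x2] /andP[]; rewrite leNgt x2.
  have [h1 h2] := doubling_half mF.
  have part (I : set R) (c : R) : (forall x, I x -> digit 0 x = c) ->
      mu (doubling @^-1` F `&` I) = (2^-1%:E * U F)%E ->
      mu (digit 0 @^-1` B `&` doubling @^-1` F `&` I) = ((c \in B)%:R%:E * (2^-1%:E * U F))%E.
    move=> Ic hI; case: (boolP (c \in B)) => [|] cB.
      rewrite mul1e -hI; congr (mu _); apply/seteqP; split => x; first by move=> [[]].
      by move=> [Fx Ix]; split => //; split => //; rewrite /= Ic//; exact: set_mem.
    rewrite mul0e -[RHS](measure0 mu); congr (mu _); apply/seteqP; split => // x [[Bx _] Ix].
    by move/negP : cB; apply; apply: mem_set; rewrite -(Ic x).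
  rewrite (part _ 0)//; last first.
    by move=> x; rewrite /= in_itv /= /digit /= => /andP[_ h]; rewrite leNgt h.
  rewrite (part _ 1)//; last first.
    by move=> x; rewrite /= in_itv /= /digit /= => /andP[h _]; rewrite h.
  by rewrite !muleA -!EFinM [in RHS]EFinD [RHS]ge0_muleDl ?lee_fin ?divr_ge0.
(* Taking the whole line for [F] in [main] identifies its explicit constant. *)
rewrite main//; congr (_ * _)%E.
have := main setT measurableT.
by rewrite preimage_setT setIT probability_setT mule1 => ->.
Qed.

Lemma digit_law k (B : set R) : measurable B -> U (digit k @^-1` B) = U (digit 0 @^-1` B).
Proof.
move=> mB; elim: k => // k IH.
have -> : digit k.+1 @^-1` B = digit 0 @^-1` setT `&` doubling @^-1` (digit k @^-1` B).
  by rewrite preimage_setT setTI; apply/seteqP; split => x; rewrite /= /digit iterSr.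
rewrite digit0_doubling//; first by rewrite preimage_setT probability_setT mul1e.
by rewrite -[X in measurable X]setTI; exact: measurable_digit.
Qed.

Lemma indep_digit : indep U digit.
Proof.
have init n (B : nat -> set R) : (forall k, measurable (B k)) ->
    U (\bigcap_(k in [set` iota 0 n]) (digit k @^-1` B k)) =
    (\prod_(k <- iota 0 n) U (digit k @^-1` B k))%E.
  elim: n B => [|n IH] B mB.
    by rewrite /= set_nil bigcap_set0 big_nil probability_setT.
  rewrite [iota _ _]/= bigcap_seq_cons big_cons (iotaDl 1 0) bigcap_seq_map big_map.
  have -> : \bigcap_(j in [set` iota 0 n]) (digit (1 + j)%N @^-1` B (1 + j)%N) =
      doubling @^-1` (\bigcap_(j in [set` iota 0 n]) (digit j @^-1` B (1 + j)%N)).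
    by apply/seteqP; split => x h j js; have := h j js; rewrite /= /digit add1n iterSr.
  rewrite digit0_doubling//; last first.
    apply: seq_bigcap_measurable => i.
    by rewrite -[X in measurable X]setTI; exact: measurable_digit.
  rewrite IH//; congr (_ * _)%E; apply: eq_bigr => k _.
  by rewrite (digit_law k)// (digit_law (1 + k))//.
move=> s B us mB.
apply: (indep_widen (s' := iota 0 (\sum_(i <- s) i).+1)) => //; first exact: iota_uniq.
- move=> v vs; rewrite mem_iota /= add0n ltnS (big_rem v)//=.
  exact: leq_addr.
- by move=> B' mB'; exact: init.
Qed.

(* A limit superior rather than a limit, so that [binary] is measurable. *)
Definition binary (z : nat -> R) : R :=
  fine (limn_esup (fun n => (\sum_(k < n) z k / 2 ^+ k.+1)%:E)).

Lemma binary_digit x : 0 <= x < 1 -> binary (digit ^~ x) = x.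
Proof.
move=> x01.
have it n : 0 <= iter n doubling x < 1.
  elim: n => //= n /andP[h0 h1]; rewrite /doubling.
  by case: ltP => h; apply/andP; split; lra.
have E n : x = \sum_(k < n) digit k x / 2 ^+ k.+1 + iter n doubling x / 2 ^+ n.
  elim: n => [|n IH]; first by rewrite big_ord0 add0r expr0 divr1.
  rewrite {1}IH big_ord_recr /= -addrA; congr (_ + _).
  rewrite /digit /doubling exprS; move: (iter n doubling x) => y.
  have p0 : (2 : R) ^+ n != 0 by rewrite expf_neq0.
  by case: ltP => h; rewrite /= ?mulr1n ?mulr0n; field.
have c : (\sum_(k < n) digit k x / 2 ^+ k.+1)%:E @[n --> \oo] --> x%:E.
  apply: cvg_EFin; first by near=> n.
  have c0 : iter n doubling x / 2 ^+ n @[n --> \oo] --> (0 : R).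
    apply: (@squeeze_cvgr _ _ _ _ (fun=> 0) (fun n => (2^-1) ^+ n)); last 2 first.
    - exact: cvg_cst.
    - by apply: cvg_expr; rewrite ger0_norm ?invr_ge0// invf_lt1// ltr1n.
    near=> n; have /andP[h0 h1] := it n; rewrite divr_ge0 ?exprn_ge0//=.
    by rewrite exprVn ler_pdivrMr ?exprn_gt0// mulVf ?expf_neq0// ltW.
  have : x - iter n doubling x / 2 ^+ n @[n --> \oo] --> x - 0.
    by apply: cvgB => //; exact: cvg_cst.
  rewrite subr0; apply: cvg_trans; apply: near_eq_cvg; near=> n.
  by rewrite {1}(E n) addrK.
rewrite /binary is_cvg_limn_esupE; last by apply/cvg_ex; exists x%:E.
by rewrite (cvg_lim _ c).
Unshelve. all: by end_near. Qed.

Lemma measurable_binary : measurable_fun setT (fun z : productType R nat => binary z).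
Proof.
apply: (measurableT_comp (fine_measurable measurableT)).
apply: measurable_fun_limn_esup => n; apply/measurable_EFinP.
apply: measurable_sum => k.
apply: measurable_funM => //; exact: measurable_coord.
Qed.

(** The pairing of [nat * nat] splits the digits of one uniform number into infinitely many
    independent rows. Each row is the binary expansion of a uniform number, which [quantile] makes
    normal. *)
Lemma exists_iidN : exists (Z : nat -> measurableTypeR R -> R), iidN U Z.
Proof.
pose e (n k : nat) : nat := choice.pickle (n, k).
have einj n n' k k' : e n k = e n' k' -> n = n' /\ k = k'.
  by move=> /(pcan_inj (@choice.pickleK _)) [-> ->].
have mD k : measurable_fun [set: measurableTypeR R] (digit k : measurableTypeR R -> R).
  exact: measurable_digit.
pose q := quantile (@normal_prob R 0 1).
pose g (n : nat) (z : nat -> R) := q (binary z).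
have mg n B : measurable B -> product_measurable (g n @^-1` B).
  have mc : measurable_fun setT (fun z : productType R nat => q (binary z)).
    exact: (measurableT_comp (measurable_quantile _) measurable_binary).
  by move=> mB; have := mc measurableT B mB; rewrite setTI.
exists (fun n x => g n (fun k => digit (e n k) x)); split.
- move=> n _ B mB; rewrite setTI.
  exact: (measurable_product_preimage (fun k => measurable_digit (e n k)) (mg n B mB)).
- exact: (indep_groups einj mD indep_digit mg).
- move=> n B mB.
  have einj1 : injective (e n) by move=> k k' /einj[].
  (* A row has the law of the full digit sequence, and [binary] of the latter is [x] itself, so that
     [quantile_law] applies. *)
  transitivity (U [set x | (g n @^-1` B) (digit ^~ x)]).
    apply: (@indep_same_law R nat _ _ _ _ U U (fun k => digit (e n k)) digit _ _ _ _ _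
      (g n @^-1` B)) => //.
    - exact: (indep_map einj1 indep_digit).
    - exact: indep_digit.
    - by move=> k A mA; exact: (etrans (digit_law (e n k) mA) (esym (digit_law k mA))).
    - exact: mg.
  rewrite -(quantile_law (@normal_prob R 0 1) mB) !uniform01E; last 2 first.
  + by rewrite -[X in measurable X]setTI; exact: measurable_quantile.
  + exact: (measurable_product_preimage measurable_digit (mg n B mB)).
  congr (mu _); apply/seteqP; split => x [+ x01]; rewrite /g /= binary_digit//;
    by move: x01; rewrite /= in_itv.
Qed.

End Digits.

(** * Convergence of expectations *)

Lemma eq_law_expectation {R : realType} d d' (T : measurableType d)
    (T' : measurableType d') (P : probability T R) (P' : probability T' R)
    (X : T -> R) (Y : T' -> R) :
  measurable_fun setT X -> measurable_fun setT Y ->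
  P.-integrable setT (EFin \o X) -> P'.-integrable setT (EFin \o Y) ->
  (forall B : set R, measurable B -> P (X @^-1` B) = P' (Y @^-1` B)) ->
  ('E_P[X] = 'E_P'[Y])%E.
Proof.
move=> mX mY iX iY XY; rewrite unlock.
pose X' : T -> measurableTypeR R := X; pose Y' : T' -> measurableTypeR R := Y.
pose XR : {RV P >-> measurableTypeR R} := HB.pack X' (isMeasurableFun.Build _ _ _ _ X' mX).
pose YR : {RV P' >-> measurableTypeR R} := HB.pack Y' (isMeasurableFun.Build _ _ _ _ Y' mY).
have mE : measurable_fun [set: measurableTypeR R] (@EFin R).
  exact: EFin_measurable.
have := @integral_distribution _ _ _ _ _ P XR _ mE iX; rewrite /comp/= => <-.
have := @integral_distribution _ _ _ _ _ P' YR _ mE iY; rewrite /comp/= => <-.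
by apply: eq_measure_integral => B mB _; exact: XY.
Qed.

(** * Measurability of continuous functions on the product *)

Section Discretization.
Context {R : realType} {V : countType}.

Definition coords (N : nat) : seq V := pmap choice.unpickle (iota 0 N).

Lemma mem_coords N v : (choice.pickle v < N)%N -> v \in coords N.
Proof.
move=> vN; rewrite mem_pmap; apply/mapP.
by exists (choice.pickle v); rewrite ?mem_iota// choice.pickleK.
Qed.

(** Rounds the first [N] coordinates down to multiples of [1 / (N+1)] and sets the others to 0,
    leaving countably many values. *)
Definition grid (N : nat) (x : V -> R) : V -> R := fun v =>
  if (choice.pickle v < N)%N then (Num.floor (x v * N.+1%:R))%:~R / N.+1%:R else 0.

Lemma grid_cvg (x : V -> R) v : grid N x v @[N --> \oo] --> x v.
Proof.
apply/cvgrPdist_lt => e e0; near=> N.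
have Nv : (choice.pickle v < N)%N by near: N; exists (choice.pickle v).+1.
rewrite /grid Nv; set y := x v.
have N0 : 0 < N.+1%:R :> R by rewrite ltr0n.
apply: (@le_lt_trans _ _ N.+1%:R^-1); last first.
  by near: N; exact: near_infty_natSinv_lt (PosNum e0).
have -> : y - (Num.floor (y * N.+1%:R))%:~R / N.+1%:R =
    (y * N.+1%:R - (Num.floor (y * N.+1%:R))%:~R) / N.+1%:R.
  by field; rewrite gt_eqF.
have /andP[f1 f2] := floor_itv (y * N.+1%:R).
rewrite normrM ger0_norm ?subr_ge0// gtr0_norm ?invr_gt0//.
rewrite -[leRHS]mul1r ler_pM2r ?invr_gt0// lerBlDr addrC.
by move: f2; rewrite intrD => /ltW.
Unshelve. all: by end_near. Qed.

Definition code N (x : V -> R) : seq int :=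
  [seq Num.floor (x v * N.+1%:R) | v <- coords N].

Lemma measurable_code N (c : seq int) : measurable [set x : productType R V | code N x = c].
Proof.
rewrite /code; elim: (coords N) c => [|v s IH] [|m c] /=.
- have -> : [set x : productType R V | [::] = [::] :> seq int] = setT by apply/seteqP.
  exact: measurableT.
- have -> : [set x : productType R V | [::] = m :: c] = set0.
    by apply/seteqP; split => x.
  exact: measurable0.
- have -> : [set x : productType R V | Num.floor ((x : V -> R) v * N.+1%:R) ::
      [seq Num.floor ((x : V -> R) v * N.+1%:R) | v <- s] = [::]] = set0.
    by apply/seteqP; split => x.
  exact: measurable0.
have -> : [set x : productType R V | Num.floor ((x : V -> R) v * N.+1%:R) ::
      [seq Num.floor ((x : V -> R) v * N.+1%:R) | v <- s] = m :: c] =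
    (fun x : productType R V => (x : V -> R) v) @^-1` `[m%:~R / N.+1%:R, (m + 1)%:~R / N.+1%:R[
    `&` [set x : productType R V | [seq Num.floor ((x : V -> R) v * N.+1%:R) | v <- s] = c].
  have N0 : 0 < N.+1%:R :> R by rewrite ltr0n.
  apply/seteqP; split => x /=.
    move=> [<- <-]; split => //; rewrite in_itv /=.
    by rewrite ler_pdivrMr// ltr_pdivlMr// floor_itv.
  rewrite in_itv /= ler_pdivrMr// ltr_pdivlMr// => -[h <-]; congr (_ :: _).
  by apply/eqP; rewrite floor_eq.
apply: measurableI => //.
have := @measurable_coord R V v measurableT `[m%:~R / N.+1%:R, (m + 1)%:~R / N.+1%:R[%classic.
by rewrite setTI; apply; exact: measurable_itv.
Qed.

Lemma code_grid N x y : code N x = code N y -> grid N x = grid N y.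
Proof.
move=> xy; apply/funext => v; rewrite /grid; case: ifP => // vN.
congr (_%:~R / _); move: vN => /mem_coords vN.
have h z : Num.floor (z v * N.+1%:R) = nth 0 (code N z) (index v (coords N)).
  by rewrite (nth_map v) ?index_mem// nth_index.
by rewrite !h xy.
Qed.

(* [grid N] factors through [code N], which has countably many values. *)
Lemma measurable_grid (f : (V -> R) -> R) N :
  measurable_fun setT (fun x : productType R V => f (grid N x)).
Proof.
move=> _ B mB; rewrite setTI.
pose F n := if choice.unpickle n is Some c then
  [set x : productType R V | code N x = c /\ B (f (grid N x))] else set0.
have -> : (fun x : productType R V => f (grid N x)) @^-1` B = \bigcup_n F n.
  apply/seteqP; split => x.
    by move=> Bx; exists (choice.pickle (code N x)) => //; rewrite /F choice.pickleK.
  by move=> [n _]; rewrite /F; case: choice.unpickle => // c [].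
apply: bigcupT_measurable => n; rewrite /F; case: choice.unpickle => // c.
have [[x [xc Bx]]|ne] := pselect (exists x, code N x = c /\ B (f (grid N x))).
  rewrite (_ : [set _ | _] = [set x : productType R V | code N x = c]).
    exact: measurable_code.
  apply/seteqP; split => y; first by case.
  by move=> yc; split => //; rewrite (@code_grid N y x) ?xc.
have -> : [set x : productType R V | code N x = c /\ B (f (grid N x))] = set0.
  by apply/seteqP; split => // x h; apply: ne; exists x.
exact: measurable0.
Qed.

(** A continuous [f] is the pointwise limit of the functions [f (grid N x)], which are measurable
    whatever [f] is. This avoids comparing Borel sets of the product with the cylinder
    sigma-algebra. *)
Lemma measurable_continuous_ptws (f : {ptws V -> R} -> R) : continuous f ->
  measurable_fun setT (f : productType R V -> R).
Proof.
move=> cf; apply: (@measurable_fun_cvg _ (productType R V) R setT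
  (fun N x => f (grid N x)) f).
  by move=> N; exact: measurable_grid.
move=> x _; apply: (@continuous_cvg _ _ _ _ _ (fun N => grid N x : {ptws V -> R}) f x).
  exact: cf.
by apply: ptws_cvg => v; exact: grid_cvg.
Qed.

End Discretization.

Section Expectation.
Context {R : realType} d (T : measurableType d) (P : probability T R) {V : countType}.
Implicit Types X Y : V -> T -> R.

Lemma bounded_continuous_integrable (f : {ptws V -> R} -> R) M X : continuous f ->
  (forall x, `|f x| <= M) -> (forall v, measurable_fun setT (X v)) ->
  measurable_fun setT (fun w => f (X^~ w)) /\
  P.-integrable setT (EFin \o (fun w => f (X^~ w))).
Proof.
move=> cf fM mX; have mf : measurable_fun setT (fun w => f (X^~ w)).
  move=> _ B mB; rewrite setTI.
  have := measurable_continuous_ptws cf measurableT mB; rewrite setTI => mC.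
  exact: (measurable_product_preimage mX mC).
split => //; apply: measurable_bounded_integrable => //.
  by rewrite ltey_eq fin_num_measure.
by exists M; split; rewrite ?num_real// => y My w _; apply: le_trans (ltW My).
Qed.

Lemma same_law_expectation (f : {ptws V -> R} -> R) M X Y : continuous f ->
  (forall x, `|f x| <= M) ->
  (forall v, measurable_fun setT (X v)) -> (forall v, measurable_fun setT (Y v)) ->
  (forall C, product_measurable C -> P [set w | C (X^~ w)] = P [set w | C (Y^~ w)]) ->
  ('E_P[fun w => f (X^~ w)] = 'E_P[fun w => f (Y^~ w)])%E.
Proof.
move=> cf fM mX mY XY.
have [mfX ifX] := bounded_continuous_integrable cf fM mX.
have [mfY ifY] := bounded_continuous_integrable cf fM mY.
apply: eq_law_expectation => // B mB.
have := measurable_continuous_ptws cf measurableT mB; rewrite setTI => mC.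
exact: (XY _ mC).
Qed.

Lemma cvg_expectation (f : {ptws V -> R} -> R) M (Xn : nat -> V -> T -> R) X :
  continuous f -> (forall x, `|f x| <= M) ->
  (forall n v, measurable_fun setT (Xn n v)) -> (forall v, measurable_fun setT (X v)) ->
  (forall v w, Xn n v w @[n --> \oo] --> X v w) ->
  ('E_P[fun w => f ((Xn n)^~ w)] @[n --> \oo] --> 'E_P[fun w => f (X^~ w)])%E.
Proof.
move=> cf fM mXn mX XnX; rewrite unlock.
have h n := bounded_continuous_integrable cf fM (mXn n).
have [mf _] := bounded_continuous_integrable cf fM mX.
have [] // := @dominated_convergence _ _ _ P setT measurableT
  (fun n => EFin \o (fun w => f ((Xn n)^~ w))) (EFin \o (fun w => f (X^~ w))) (cst M%:E).
- by move=> n; apply/measurable_EFinP; case: (h n).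
- exact/measurable_EFinP.
- apply: aeW => w _; apply: cvg_EFin; first by near=> n.
  apply: (@continuous_cvg _ _ _ _ _ (fun n => (Xn n)^~ w : {ptws V -> R}) f (X^~ w)).
    exact: cf.
  by apply: ptws_cvg => v; exact: XnX.
- exact: finite_measure_integrable_cst.
- by apply: aeW => w n _; rewrite /= lee_fin.
Unshelve. all: by end_near. Qed.

End Expectation.

Section CenteredNormal.
Context {R : realType}.
Local Notation mu := (@lebesgue_measure R).
Local Notation gamma := (@normal_prob R 0 1).
Local Notation phi := (@normal_pdf R 0 1).

(** The 4 leaves half of the Gaussian exponent [- x^2 / 2] for integrability. *)
Lemma normr_le_expR (x : R) : `|x| <= expR (x ^+ 2 / 4).
Proof.
apply: le_trans (expR_ge1Dx _).
have h : 0 <= (`|x| / 2 - 1) ^+ 2 by exact: sqr_ge0.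
have e : `|x| ^+ 2 = x ^+ 2 by rewrite real_normK ?num_real.
by rewrite -e; move: h; move: (`|x|) => y h; lra.
Qed.

Lemma integrable_id_normal : (\int[gamma]_x `|x|%:E < +oo)%E.
Proof.
rewrite ge0_integral_normal_prob//; last first.
  by apply/measurable_EFinP; exact: normr_measurable.
(* The remaining factor [exp (- x^2 / 4)] is, up to the constant [k], the normal density of variance
   2. *)
pose s : R := Num.sqrt 2; have s0 : s != 0 by rewrite sqrtr_eq0 -ltNge.
pose k : R := normal_peak 1 / normal_peak s.
have pk : 0 < normal_peak s by exact: normal_peak_gt0.
have k0 : 0 <= k by rewrite divr_ge0 ?normal_peak_ge0.
apply: (@le_lt_trans _ _ (\int[mu]_x (k%:E * (normal_pdf 0 s x)%:E))%E); last first.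
  rewrite ge0_integralZl//=.
  - by rewrite integral_normal_pdf mule1 ltry.
  - by apply/measurable_EFinP; exact: measurable_normal_pdf.
  - by move=> x _; rewrite lee_fin normal_pdf_ge0.
apply: ge0_le_integral => //=.
- by move=> x _; rewrite mule_ge0// lee_fin normal_pdf_ge0.
- apply: emeasurable_funM; apply/measurable_EFinP; last exact: measurable_normal_pdf.
  exact: normr_measurable.
- apply/measurable_EFinP; apply: (measurable_funM (f := fun=> k)) => //.
  exact: measurable_normal_pdf.
move=> x _; rewrite -!EFinM lee_fin !normal_pdfE0// ?oner_neq0//.
rewrite sqr_sqrtr// expr1n /k [leRHS]mulrA divfK ?gt_eqF// mulrCA ler_wpM2l ?normal_peak_ge0//.
apply: le_trans (ler_wpM2r (expR_ge0 _) (normr_le_expR x)) _.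
rewrite -expRD ler_expR; move: (x ^+ 2) => z.
by rewrite -[2 *+ 2]mulr_natr; lra.
Qed.

(** By symmetry [s W] and [- s W] have the same law; integrability of [W] makes the expectation
    finite, so it equals its opposite and is 0. *)
Lemma standard_normal_mean d (T : measurableType d) (P : probability T R) (W : T -> R) (s : R) :
  measurable_fun setT W ->
  (forall B, measurable B -> P (W @^-1` B) = gamma B) -> ('E_P[fun w => (s * W w)%R] = 0)%E.
Proof.
move=> mW lW.
have iW : P.-integrable setT (EFin \o W).
  apply/integrableP; split; first exact/measurable_EFinP.
  apply: le_lt_trans integrable_id_normal.
  pose W' : T -> measurableTypeR R := W.
  pose WR : {RV P >-> measurableTypeR R} :=
    HB.pack W' (isMeasurableFun.Build _ _ _ _ W' mW).
  rewrite [leRHS](_ : _ = \int[distribution P WR]_x `|x|%:E)%E; last first.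
    by apply: eq_measure_integral => A mA _; exact: (esym (lW A mA)).
  rewrite (@ge0_integral_distribution _ _ _ _ _ P WR (fun x => `|x|%:E))//.
  by apply/measurable_EFinP; exact: normr_measurable.
have msW t : measurable_fun setT (fun w => t * W w).
  exact: (measurable_funM (f := fun=> t)).
have isW t : P.-integrable setT (EFin \o (fun w => t * W w)).
  rewrite (_ : EFin \o _ = (fun w => t%:E * (EFin \o W) w)%E)//.
  exact: integrableZl.
have mN B : measurable B -> measurable ((-%R : R -> R) @^-1` B).
  by move=> mB; rewrite -[X in measurable X]setTI; exact: oppr_measurable.
have lN B : measurable B -> gamma ((-%R : R -> R) @^-1` B) = gamma B.
  move=> mB; have N1 : (-1 : R) != 0 by rewrite oppr_eq0 oner_neq0.
  have := normal_prob_scale N1 mB; rewrite normal_probN => <-.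
  by congr (gamma _); apply/seteqP; split => x /=; rewrite mulN1r.
have E : ('E_P[fun w => (s * W w)%R] = 'E_P[fun w => ((- s) * W w)%R])%E.
  apply: eq_law_expectation => // B mB.
  have msB : measurable ((fun x : R => s * x) @^-1` B).
    have := measurable_affine s 0 measurableT mB; rewrite setTI.
    by congr (measurable _); apply/seteqP; split => x; rewrite /= /affine addr0.
  transitivity (gamma ((fun x : R => s * x) @^-1` B)); first by rewrite -lW.
  rewrite -lN// -lW; last exact: mN.
  by congr (P _); apply/seteqP; split => w /=; rewrite mulrN mulNr.
have fE := integrable_fin_num measurableT (isW s).
move: E; rewrite unlock.
have -> : (\int[P]_w (- s * W w)%R%:E = (-1)%:E * \int[P]_w (s * W w)%R%:E)%E.
  rewrite -(integralZl measurableT (isW s)).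
  by apply: eq_integral => w _; rewrite /= -EFinM mulN1r mulNr.
rewrite -(fineK fE) -EFinM => -[E]; congr (_%:E); lra.
Qed.

End CenteredNormal.

(** * Gaussian processes and linear factors *)

Definition mkRV {R : realType} d (T : measurableType d) (P : probability T R)
    (X : T -> R) (mX : measurable_fun setT X) : {RV P >-> R} :=
  HB.pack X (isMeasurableFun.Build _ _ _ _ X mX).

Section Push.
Context {R : realType} {V : countType}.
Implicit Types f g : V -> R.

(** The normal family is indexed by [nat], and vertex [u] uses the variable at its code; numbers
    that code no vertex get coefficient 0. *)
Definition push f : nat -> R := fun k => if pickle_inv k is Some u then f u else 0.

Lemma push_pickle f u : push f (choice.pickle u) = f u.
Proof. by rewrite /push choice.pickleK_inv. Qed.

Lemma push_eq0 s f k : (forall u, u \notin s -> f u = 0) ->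
  k \notin map choice.pickle s -> push f k = 0.
Proof.
move=> fs ks; rewrite /push; case E : (pickle_inv k) => [u|//]; apply: fs.
apply: contra ks => us; apply/mapP; exists u => //.
by have := @choice.pickle_invK V k; rewrite E /= => ->.
Qed.

Lemma push_fsupp f : fsupp f -> fsupp (push f).
Proof.
by move=> /fsuppP[s us fs]; apply: (fsupp_sub (s := map choice.pickle s)) => k; exact: push_eq0.
Qed.

Lemma ip_push f (z : nat -> R) : fsupp f -> ip (push f) z = ip f (z \o choice.pickle).
Proof.
move=> /fsuppP[s us fs]; rewrite (ip_seq _ us fs) (@ip_seq _ _ (map choice.pickle s)).
- by rewrite big_map; apply: eq_bigr => u _; rewrite push_pickle.
- by rewrite map_inj_uniq//; exact: (pcan_inj choice.pickleK).
- by move=> k; exact: push_eq0.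
Qed.

Lemma ip_push_push f g : fsupp f -> ip (push f) (push g) = ip f g.
Proof.
move=> ff; rewrite ip_push//; congr ip; apply/funext => u.
by rewrite /= push_pickle.
Qed.

End Push.

Section Lincomb.
Context {R : realType} {V : choiceType} {I : choiceType}.
Implicit Types (x : V -> I -> R) (l : seq (R * V)).

Definition lincomb l x : I -> R := \sum_(p <- l) p.1 *: x p.2.

Lemma lincomb_fsupp l x : (forall v, fsupp (x v)) -> fsupp (lincomb l x).
Proof.
move=> fx; rewrite /lincomb; elim: l => [|p l IH].
  by rewrite big_nil; exact: fsupp0.
by rewrite big_cons; apply: fsuppD => //; exact: fsuppZ.
Qed.

Lemma ip_lincombl l x z : (forall v, fsupp (x v)) ->
  ip (lincomb l x) z = \sum_(p <- l) p.1 * ip (x p.2) z.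
Proof.
move=> fx; elim: l => [|p l IH]; rewrite /lincomb ?big_nil ?ip0l// !big_cons.
rewrite -/(lincomb l x) ipDl ?ipZl ?IH//; first exact: fsuppZ.
exact: lincomb_fsupp.
Qed.

Lemma ip_lincomb l x : (forall v, fsupp (x v)) ->
  ip (lincomb l x) (lincomb l x) =
  \sum_(p <- l) p.1 * \sum_(q <- l) q.1 * ip (x q.2) (x p.2).
Proof.
move=> fx; rewrite ip_lincombl//; apply: eq_bigr => p _; congr (_ * _).
by rewrite ipC ip_lincombl.
Qed.

End Lincomb.

Section TriangularLimits.
Context {R : realType}.

Lemma cvg_eq0 (x : nat -> nat -> R) (X : nat -> R) i :
  (forall n k, (i < k)%N -> x n k = 0) ->
  (forall k, x n k @[n --> \oo] --> X k) -> forall k, (i < k)%N -> X k = 0.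
Proof.
move=> x0 xX k ik; have := xX k; under eq_fun do rewrite x0//.
by move=> h; apply/esym; exact: (cvg_unique (@Rhausdorff R) (cvg_cst 0) h).
Qed.

(** The support bound [i], uniform in [n], reduces everything to one fixed finite sum; without it
    mass could escape to infinity. *)
Lemma cvg_ip (x y : nat -> nat -> R) (X Y : nat -> R) i :
  (forall n k, (i < k)%N -> x n k = 0) ->
  (forall k, x n k @[n --> \oo] --> X k) ->
  (forall k, y n k @[n --> \oo] --> Y k) ->
  ip (x n) (y n) @[n --> \oo] --> ip X Y.
Proof.
move=> x0 xX yY; have E (f g : nat -> R) : (forall k, (i < k)%N -> f k = 0) ->
    ip f g = \sum_(k <- iota 0 i.+1) f k * g k.
  move=> f0; rewrite (@ip_seq _ _ (iota 0 i.+1)) ?iota_uniq// => k.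
  by rewrite mem_iota add0n leq0n /= ltnS -ltnNge; exact: f0.
rewrite (E X); last exact: (cvg_eq0 x0 xX).
under eq_fun => n do rewrite (E (x n) (y n) (x0 n)).
by apply: cvg_sumr => k; apply: cvgM; [exact: xX|exact: yY].
Qed.

Lemma triangular_fsupp (x : nat -> R) i : (forall k, (i < k)%N -> x k = 0) -> fsupp x.
Proof.
move=> x0; apply: (@fsupp_sub _ _ (iota 0 i.+1)) => k.
by rewrite mem_iota add0n leq0n /= ltnS -ltnNge; exact: x0.
Qed.

End TriangularLimits.

Section GaussianProcess.
Context {R : realType} d (T : measurableType d) (P : probability T R) {V : countType}.
Variables (Z : nat -> T -> R) (C : V -> nat -> R).
Hypotheses (iZ : iidN P Z) (C_fsupp : forall v, fsupp (C v)).

Lemma measurable_comb_iid v : measurable_fun setT (comb (C v) Z).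
Proof. by apply: measurable_comb => //; case: iZ. Qed.

Definition gaussX v : {RV P >-> R} := mkRV P (measurable_comb_iid v).

Lemma comb_gaussian x : fsupp x -> gaussian P (comb x Z).
Proof.
move=> fx; have [s sx [W mW [lW ->]]] := comb_normal iZ fx.
have [->|s0] := eqVneq s 0.
  left; exists 0 => B mB; rewrite /pushforward /dirac indicE.
  have [B0|B0] := boolP (0 \in B).
    rewrite (_ : _ @^-1` _ = setT) ?probability_setT//.
    by apply/seteqP; split => // w _; rewrite /= mul0r; exact: set_mem.
  rewrite (_ : _ @^-1` _ = set0) ?measure0//.
  by apply/seteqP; split => // w; rewrite /= mul0r => /mem_set; rewrite (negbTE B0).
right; exists 0, s; split => // B mB; rewrite /pushforward -normal_prob_scale// -lW//.
have := measurable_affine s 0 measurableT mB; rewrite setTI.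
by congr (measurable _); apply/seteqP; split => x'; rewrite /= /affine addr0.
Qed.

Lemma gaussX_process : gaussian_process gaussX.
Proof.
split => [s c|v].
  have -> : (fun w => \sum_(v <- s) c v * gaussX v w) =
      comb (lincomb [seq (c v, v) | v <- s] C) Z.
    by apply/funext => w; rewrite /comb ip_lincombl// big_map.
  by apply: comb_gaussian; exact: lincomb_fsupp.
have [s sx [W mW [lW E]]] := comb_normal iZ (C_fsupp v).
rewrite (_ : gaussX v = (fun w => s * W w) :> (T -> R)) ?standard_normal_mean//.
Qed.

(** The variable at [v] is a nonzero multiple of a standard normal one, whose law has no atom at
    0. *)
Lemma gaussX_nontrivial v : ip (C v) (C v) != 0 -> nontrivial gaussX.
Proof.
move=> Cv0 h.
have [s sx [W mW [lW E]]] := comb_normal iZ (C_fsupp v).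
have s0 : s != 0 by apply: contra_neq Cv0 => s0; rewrite -sx s0 expr0n.
have P0 : P (W @^-1` [set 0]) = 0%E.
  rewrite lW//.
  have /null_content_dominatesP dom := @normal_prob_dominates R 0 1.
  by apply: dom => //; exact: lebesgue_measure_set1.
have mW0 : measurable (W @^-1` [set 0]).
  by rewrite -[X in measurable X]setTI; apply: mW => //; exact: measurable_set1.
have [A [mA A0 hA]] := h.
have TU : [set: T] `<=` W @^-1` [set 0] `|` A.
  move=> w _; have [Ww|Ww] := eqVneq (W w) 0; [by left|right].
  apply: hA => h0; have : gaussX v w = 0 := h0 v.
  rewrite (_ : gaussX v w = s * W w) => [/eqP|]; last exact: (congr1 (@^~ w) E).
  by rewrite mulf_eq0 (negbTE s0) (negbTE Ww).
have : (P [set: T] <= P (W @^-1` [set 0%R] `|` A))%E.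
  by apply: le_measure; rewrite ?inE//; exact: measurableU.
rewrite probability_setT => /le_trans /(_ (measureU2 P mW0 mA)).
have -> : (P (W @^-1` [set 0%R]) + P A = 0)%E.
  by transitivity (0 + 0 : \bar R)%E; [congr (_ + _)%E|rewrite adde0].
by rewrite leNgt lte01.
Qed.

End GaussianProcess.

(** Unit vectors have Cholesky entries in [[-1, 1]], so compactness applies. The last clause, for
    arbitrary [z], yields convergence of the processes at every sample point. *)
Lemma gram_limit {R : realType} {V : countType} (x : nat -> V -> V -> R) :
  (forall n v, fsupp (x n v)) -> (forall n v, ip (x n v) (x n v) = 1) ->
  exists (s : nat -> nat) (y : nat -> V -> nat -> R) (X : V -> nat -> R),
    [/\ forall n, (n <= s n)%N,
        forall n v, fsupp (y n v) /\ fsupp (X v),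
        forall n u v, ip (y n u) (y n v) = ip (x (s n) u) (x (s n) v),
        forall u v, ip (x (s n) u) (x (s n) v) @[n --> \oo] --> ip (X u) (X v) &
        forall v z, ip (y n v) z @[n --> \oo] --> ip (X v) z].
Proof.
move=> fx x1.
pose x' n i : V -> R := if pickle_inv i is Some v then x n v else 0.
have fx' n i : fsupp (x' n i) by rewrite /x'; case: pickle_inv => [v|]; [|exact: fsupp0].
have x'E n v : x' n (choice.pickle v) = x n v by rewrite /x' choice.pickleK_inv.
pose c n := cholesky (x' n).
have fc n i : fsupp (c n i) by exact: cholesky_fsupp.
have c1 n (p : nat * nat) : `|c n p.1 p.2| <= 1.
  rewrite -[1]sqrtr1 -sqrtr_sqr ler_sqrt//.
  apply: (le_trans (sqr_le_ip _ (fc n p.1))).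
  rewrite cholesky_ip// /x'; case: pickle_inv => [v|]; first by rewrite x1.
  by rewrite ip0l.
have [s [C [sN cC]]] := ptws_bounded_subseq c1.
pose cv n (v : V) : nat -> R := c (s n) (choice.pickle v).
pose Cv (v : V) k : R := C (choice.pickle v, k).
have cvCv v k : cv n v k @[n --> \oo] --> Cv v k by exact: (cC (_, _)).
have cv0 v n k : (choice.pickle v < k)%N -> cv n v k = 0 by exact: cholesky_eq0.
have gram n u v : ip (cv n u) (cv n v) = ip (x (s n) u) (x (s n) v).
  by rewrite /cv cholesky_ip// !x'E.
exists s, cv, Cv; split => //.
- move=> n v; split; first exact: fc.
  exact: (triangular_fsupp (cvg_eq0 (cv0 v) (cvCv v))).
- move=> u v; under eq_fun do rewrite -gram.
  exact: (cvg_ip (cv0 u)).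
- by move=> v z; apply: (cvg_ip (cv0 v)) => // k; exact: cvg_cst.
Qed.

Section FiniteFactors.
Context {R : realType} d (T : measurableType d) (P : probability T R).
Context {V : countType} (G : graph V).
Variables (Z : nat -> T -> R) (beta : V -> V -> R).
Hypotheses (iZ : iidN P Z) (beta_fsupp : forall v, fsupp (beta v)).

Lemma measurable_iid k : measurable_fun setT (Z k).
Proof. by case: iZ. Qed.

Definition vertexZ (v : V) : {RV P >-> R} := mkRV P (measurable_iid (choice.pickle v)).

Lemma vertexZ_iid : iid_standard_normal vertexZ.
Proof.
have [_ indZ lZ] := iZ; split; last by move=> v B mB; exact: lZ.
exact: (indep_map (pcan_inj (@choice.pickleK V)) indZ).
Qed.

Lemma push_beta_fsupp v : fsupp (push (beta v)).
Proof. exact: push_fsupp. Qed.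

Definition factorX : V -> {RV P >-> R} := gaussX iZ push_beta_fsupp.

(** Every partial sum over a set containing the support of [beta v] equals the factor exactly, so
    the error in [L2_sum] is 0. *)
Lemma factorX_linear :
  (forall phi, automorphism G phi -> forall v u, beta (phi v) (phi u) = beta v u) ->
  linear_factor G beta vertexZ factorX.
Proof.
move=> baut; split => // v.
  apply: (@le_lt_trans _ _ (ip (beta v) (beta v))%:E); last exact: ltry.
  apply: ge_ereal_sup => _ [A [finA _] <-].
  rewrite fsbig_finite//= sumEFin lee_fin.
  exact: (sum_le_ip (fset_uniq _) (beta_fsupp v)).
move=> e e0; exists (fset_set [set u | beta v u != 0]) => B AB.
have fb := beta_fsupp v.
have E : (fun w => (factorX v w - \sum_(u <- B) beta v u * vertexZ u w) ^+ 2) = cst 0.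
  apply/funext => w.
  have -> : factorX v w = \sum_(u <- B) beta v u * vertexZ u w.
    transitivity (ip (push (beta v)) (Z^~ w)) => //.
    rewrite ip_push// (@ip_seq _ _ B) ?fset_uniq// => u uB.
    apply/eqP; apply: contraR uB => bu; apply: (fsubsetP AB).
    by rewrite in_fset_set// inE.
  by rewrite subrr expr0n.
by rewrite E expectation_cst lee_fin ltW.
Qed.

End FiniteFactors.

(** The squared norm of a combination depends only on the Gram matrix, so it passes to the limit
    although the vectors [x n] and [X] live over different index sets. *)
Lemma cvg_lincomb {R : realType} {V I J : choiceType} (x : nat -> V -> I -> R)
    (X : V -> J -> R) l : (forall n v, fsupp (x n v)) -> (forall v, fsupp (X v)) ->
  (forall u v, ip (x n u) (x n v) @[n --> \oo] --> ip (X u) (X v)) ->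
  ip (lincomb l (x n)) (lincomb l (x n)) @[n --> \oo] -->
  ip (lincomb l X) (lincomb l X).
Proof.
move=> fx fX xX; rewrite ip_lincomb//; under eq_fun do rewrite ip_lincomb//.
apply: cvg_sumr => p; apply: cvgM; first exact: cvg_cst.
by apply: cvg_sumr => q; apply: cvgM; [exact: cvg_cst|exact: xX].
Qed.

Theorem theorem4 (R : realType) (V : countType) (G : graph V)
    (V_infinite : infinite_set [set: V]) (G_transitive : vertex_transitive G)
    (lambda : R[i]) (lambda_spectrum : spectrum (adjacency G) lambda) :
  exists (d : measure_display) (T : measurableType d) (P : probability T R)
         (X : V -> {RV P >-> R}),
    [/\ gaussian_process X,
        invariant G X,
        nontrivial X,
        forall v, {ae P, forall w,
          real_complex R (\sum_(u \in neighbors G v) X u w) =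
          lambda * real_complex R (X v w)}
      & exists (d' : measure_display) (T' : measurableType d')
               (Q : probability T' R) (Z : V -> {RV Q >-> R})
               (beta : nat -> V -> V -> R) (Y : nat -> V -> {RV Q >-> R}),
          [/\ iid_standard_normal Z,
              forall n, linear_factor G (beta n) Z (Y n),
              forall n v, finite_set [set u | beta n v u != 0]
            & cvg_in_distribution Y X]].
Proof.
have [beta [fb b_aut b1 bD]] := approximate_kernels G_transitive lambda_spectrum.
have [s [y [C [sN fyC y_gram bC yC]]]] := gram_limit fb b1.
have fy n v : fsupp (y n v) by case: (fyC n v).
have fC v : fsupp (C v) by case: (fyC 0%N v).
have [Z iZ] := @exists_iidN R.
have C1 v : ip (C v) (C v) = 1.
  apply: (cvg_unique (@Rhausdorff R) (bC v v)).
  by rewrite /=; under eq_fun do rewrite b1; exact: cvg_cst.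
exists _, _, _, (gaussX iZ fC); split.
- exact: gaussX_process.
(* Invariance reduces to that of the Gram matrix of [C], a limit of Gram matrices of invariant
   kernels. *)
- move=> phi aphi; apply: (comb_same_law iZ (fun v => fC (phi v)) fC) => u v.
  apply: (cvg_unique (@Rhausdorff R) (bC (phi u) (phi v))).
  rewrite (_ : (fun n => _) = fun n => ip (beta (s n) u) (beta (s n) v)); first exact: bC.
  apply/funext => n; rewrite -[LHS](ip_comp_bij _ _ (proj1 aphi)).
  by congr ip; apply/funext => z; exact: b_aut.
(* Over an empty vertex set every process would be identically zero; infinity of the graph provides
   a vertex. *)
- have [v _] := infinite_setN0 V_infinite.
  by apply: (@gaussX_nontrivial _ _ _ _ _ _ _ _ _ v); rewrite C1 oner_neq0.
- move=> v; apply: aeW => w.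
  (* Coefficients of the defect in the eigenvalue equation at [v]. *)
  pose l : seq (R * V) := (- complex.Re lambda, v) :: [seq (1, u) | u <- nbseq G v].
  have lE (I : choiceType) (x : V -> I -> R) :
      lincomb l x = \sum_(u <- nbseq G v) x u - complex.Re lambda *: x v.
    rewrite /lincomb /l big_cons big_map /= addrC scaleNr; congr (_ - _).
    by apply: eq_bigr => u _; rewrite scale1r.
  (* The coefficient sequence of the defect has norm 0, hence vanishes, so the equation holds at
     every sample point and not only almost surely. *)
  have lC0 : lincomb l C = 0.
    apply: ip_eq0; first exact: lincomb_fsupp.
    have h := @cvg_lincomb _ _ _ _ _ _ l (fun n => fb (s n)) fC bC.
    apply/esym; apply: (cvg_unique (@Rhausdorff R) _ h).
    apply: (@squeeze_cvgr _ _ _ _ (cst 0) (fun n => n.+1%:R^-1)).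
    + apply: nearW => n; rewrite ip_ge0 /= lE; apply: le_trans (bD _ v) _.
      by rewrite lef_pV2 ?posrE ?ltr0n// ler_nat ltnS; exact: sN.
    + exact: cvg_cst.
    + exact: cvg_harmonic.
  have -> : \sum_(u \in neighbors G v) gaussX iZ fC u w =
      complex.Re lambda * gaussX iZ fC v w.
    rewrite [LHS](adjacencyE G (fun u => gaussX iZ fC u w)).
    have := @ip_lincombl _ _ _ l C (Z^~ w) fC.
    rewrite lC0 ip0l /l big_cons big_map /= mulNr addrC => /esym/eqP.
    by rewrite subr_eq0 => /eqP <-; apply: eq_bigr => u _; rewrite mul1r.
  have := spectrum_real G_transitive lambda_spectrum.
  case: lambda {lambda_spectrum bD l lE lC0} => a b /= ->.
  by apply/eqP; rewrite eq_complex /= !mul0r !mulr0 subr0 addr0 !eqxx.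
exists _, _, _, (vertexZ iZ), (fun n => beta (s n)),
  (fun n => factorX iZ (fb (s n))); split.
- exact: vertexZ_iid.
- by move=> n; apply: factorX_linear; exact: b_aut.
- by move=> n v; exact: fb.
move=> f cf [M fM].
have [mZ _ _] := iZ.
have m x : fsupp x -> measurable_fun setT (comb x Z) by move=> fx; exact: measurable_comb.
(* Each factor is replaced by the process with coefficients [y n], which has the same Gram matrix,
   hence the same law, and converges pointwise. *)
rewrite (_ : (fun n => _) = fun n =>
  ('E_(uniform_prob (@ltr01 R))[fun w => f (fun v => comb (y n v) Z w)])%E).
  apply: (cvg_expectation (Xn := fun n v => comb (y n v) Z) cf fM) => [n v|v|v w].
  - exact: m.
  - exact: m.
  - exact: yC.
apply/funext => n.
apply: (same_law_expectation (X := fun v => comb (push (beta (s n) v)) Z)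
  (Y := fun v => comb (y n v) Z) cf fM) => [v|v|].
- by apply: m; exact: push_fsupp.
- exact: m.
apply: comb_same_law => // [v|u v]; first exact: push_fsupp.
by rewrite ip_push_push// y_gram.
Qed.
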